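(* Consider aperiodic Łukasiewicz walks in the absorption model, i.e. with $P_0^{\geq}(1)<1$. Let $M(z)=\sum_n m_nz^n$ be the generating function of meanders, $E(z)$ that of excursions, $\delta=P'(1)$ the drift, and $\tau,\rho,C,\rho_1,\gamma,\kappa$ as in the context. Then as $n\to\infty$: (a) if $\delta>0$ (in any of the three cases): $[z^n]M(z)\sim 1-(1-P_0^{\geq}(1))E(1)$; (b) if $\delta<0$ and $P(\tau)<P_0^{\geq}(\tau)$ (supercritical): $[z^n]M(z)\sim\frac{\rho_1\gamma}{E(1)(\rho_1-1)}\rho_1^{-n}$; (c) if $\delta<0$ and $P(\tau)=P_0^{\geq}(\tau)$ (critical): $[z^n]M(z)\sim\frac{\rho}{E(1)\kappa(\rho-1)}\frac{\rho^{-n}}{\sqrt{\pi n}}$; (d) if $\delta<0$ and $P(\tau)>P_0^{\geq}(\tau)$ (subcritical): $[z^n]M(z)\sim\frac{E(\rho)^2}{E(1)}\frac{\kappa\rho}{2(\rho-1)}\frac{\rho^{-n}}{\sqrt{\pi n^3}}$; (e) if $\delta=0$ and $P(\tau)>P_0^{\geq}(\tau)$ (subcritical): $[z^n]M(z)\sim\frac{E(1)\kappa}{\sqrt{\pi n}}$. The cases $\delta=0$ with $P(\tau)\le P_0^{\geq}(\tau)$ do not occur in the absorption model.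
   Context: Paths start at $(0,0)$, each step moves one unit right; at altitude $k>0$ the jump $i\in\{-1,0,\dots,d\}$ has weight $p_i$, $P(u)=p_{-1}u^{-1}+p_0+\dots+p_du^d$, $p_i\in[0,1]$, $\sum p_i=1$, $p_{-1},p_d\ne0$, $P$ aperiodic (no integer $p>1$ and polynomial $H$ with $P(u)=u^{-1}H(u^p)$); at altitude $0$ the jump $i$ has weight $p_{0,i}\ge0$, $\sum_ip_{0,i}=1$, $P_0^{\geq}(u)=\sum_{i\ge0}p_{0,i}u^i$. Path weight = product of step weights (so $m_n$, the total weight of meanders of length $n$, is the probability that a random walk of length $n$ is a meander). Meanders: paths staying at altitude $\ge0$; excursions: meanders ending at $0$. $u_1(z)$: root of $1-zP(u)=0$ with $u_1(z)\to0$ as $z\to0$. $\tau>0$: root of $P'(\tau)=0$; $\rho=1/P(\tau)$; $C=\sqrt{2P(\tau)/P''(\tau)}$; $\rho_1$: the solution in $(0,\rho]$ of $1-zP_0^{\geq}(u_1(z))=0$; $\alpha=\frac{d}{dz}P_0^{\geq}(u_1(z))|_{z=\rho_1}$; $\gamma=1/(\alpha\rho_1^2+1)$; $\kappa=C\rho(P_0^{\geq})'(\tau)$.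
   Formalization: Cases (a), (c), (d), (e) additionally assume that P_0^≥ is not constant (some p_{0,i}≠0 with i>0); for constant P_0^≥=c in (0,1) one has m_n=c^n and κ=0, so the stated right-hand sides vanish or divide by zero. *)

(* Defs.v *)
From HB Require Import structures.
From mathcomp Require Import all_boot all_order all_algebra.
From mathcomp Require Import all_classical all_reals all_analysis.

Set Implicit Arguments.
Unset Strict Implicit.
Unset Printing Implicit Defensive.

Import Order.TTheory GRing.Theory Num.Theory.
Import numFieldNormedType.Exports.

Local Open Scope classical_set_scope.
Local Open Scope ring_scope.

(* [wt i] is the weight of the jump [i] at an altitude [k > 0] and [wt0 i] its
   weight at altitude [0]. Both families are indexed by [int] and are required
   to vanish outside {-1, ..., deg} and {-codeg0, ..., deg0} respectively. *)
Record walk (R : realType) := Walk {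
  deg : nat;
  wt : int -> R;
  codeg0 : nat;
  deg0 : nat;
  wt0 : int -> R }.

Section Model.
Variables (R : realType) (w : walk R).

Definition P (u : R) : R :=
  \sum_(i < (deg w).+2) wt w (i%:Z - 1) * u ^ (i%:Z - 1).

Definition P0ge (u : R) : R := \sum_(i < (deg0 w).+1) wt0 w i%:Z * u ^+ i.

Definition lukasiewicz : Prop :=
  [/\ forall i : int, 0 <= wt w i <= 1,
      forall i : int, ~~ (-1 <= i <= (deg w)%:Z) -> wt w i = 0,
      \sum_(i < (deg w).+2) wt w (i%:Z - 1) = 1,
      wt w (-1) != 0 & wt w (deg w)%:Z != 0].

Definition boundary_weights : Prop :=
  [/\ forall i : int, 0 <= wt0 w i,
      forall i : int, ~~ (- (codeg0 w)%:Z <= i <= (deg0 w)%:Z) -> wt0 w i = 0 &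
      \sum_(i < (codeg0 w + deg0 w).+1) wt0 w (i%:Z - (codeg0 w)%:Z) = 1].

Definition aperiodic : Prop :=
  ~ exists (q : nat) (H : {poly R}),
      (1 < q)%N /\ forall u : R, u != 0 -> P u = u^-1 * H.[u ^+ q].

Definition absorption : Prop := P0ge 1 < 1.

(* Equivalently, [P0ge] is not constant. If it is a constant c, meanders never
   leave altitude [0], meanders n = c ^+ n, and kappa = 0. *)
Definition leaves_zero : Prop := exists2 i : nat, (0 < i)%N & wt0 w i%:Z != 0.

(* A path is the sequence of its jumps. All the jumps of nonzero weight lie in
   {-max_down, ..., max_up}, which is enumerated by the [jump i]. *)
Definition max_down : nat := maxn 1 (codeg0 w).
Definition max_up : nat := maxn (deg w) (deg0 w).
Definition jump (i : 'I_(max_down + max_up).+1) : int := i%:Z - max_down%:Z.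

Definition altitude (s : seq int) (k : nat) : int := \sum_(j <- take k s) j.

Definition path_weight (s : seq int) : R :=
  \prod_(k < size s)
    (if altitude s k == 0 then wt0 w (nth 0 s k) else wt w (nth 0 s k)).

Definition is_meander (s : seq int) : bool :=
  [forall k : 'I_(size s).+1, 0 <= altitude s k].

Definition is_excursion (s : seq int) : bool :=
  is_meander s && (altitude s (size s) == 0).

(* [meanders n] and [excursions n] are the coefficients of z^n in M and E. *)
Definition meanders (n : nat) : R :=
  \sum_(t : n.-tuple 'I_(max_down + max_up).+1 | is_meander (map jump t))
    path_weight (map jump t).

Definition excursions (n : nat) : R :=
  \sum_(t : n.-tuple 'I_(max_down + max_up).+1 | is_excursion (map jump t))
    path_weight (map jump t).

Definition Egf (z : R) : R := limn (pseries excursions z).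

Definition drift : R := derive1 P 1.

Definition is_tau (tau : R) : Prop := 0 < tau /\ derive1 P tau = 0.

Definition rho (tau : R) : R := (P tau)^-1.

Definition Cconst (tau : R) : R := Num.sqrt (2 * P tau / derive1n 2 P tau).

Definition kappa (tau : R) : R := Cconst tau * rho tau * derive1 P0ge tau.

(* The small branch u_1 is only evaluated at real z in (0, rho], where it is
   real; continuity makes it the same branch all along this interval. *)
Definition is_small_branch (r : R) (u1 : R -> R) : Prop :=
  [/\ forall z, 0 < z <= r -> u1 z != 0 /\ 1 - z * P (u1 z) = 0,
      {within `]0, r], continuous u1} &
      u1 z @[z --> 0^'+] --> (0 : R)].

Definition is_rho1 (r : R) (u1 : R -> R) (rho1 : R) : Prop :=
  0 < rho1 <= r /\ 1 - rho1 * P0ge (u1 rho1) = 0.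

Definition alpha (u1 : R -> R) (rho1 : R) : R :=
  derive1 (fun z : R => P0ge (u1 z)) rho1.

Definition gamma (u1 : R -> R) (rho1 : R) : R :=
  (alpha u1 rho1 * rho1 ^+ 2 + 1)^-1.

End Model.

(* Main.v *)
(* A meander is killed only by a negative jump from altitude 0, so
   m_n = 1 - (1 - P_0(1)) (e_0 + ... + e_(n-1)), where e_n is the weight of the
   excursions; everything reduces to the asymptotics of e_n and, when 1 <= tau,
   of the tail sums of e_n, because E(1) = 1 / (1 - P_0(1)) then.

   The excursions are the renewal sequence of the arches (excursions that meet 0
   at their ends only). By Kemperman's formula the first passages from altitude
   k to 0 have the weight (k / n) [u^(-k)] P(u)^n, and the local limit theorem
   for the exponential tilt of P by tau, proved by Fourier inversion, gives
   arch_n rho^n ~ kappa / (2 sqrt pi) n^(-3/2).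

   At rho_1 (supercritical case) the weights arch_n rho_1^n are a probability
   distribution of mean alpha rho_1^2 + 1 and the renewal theorem applies. At rho
   one uses the coefficient form of E' = E^2 B', with B the generating function
   of the arches.
   If B(rho) < 1, then E(rho) is finite and the limit is immediate. If
   B(rho) = 1, the convolutions with E^2 are computed by comparison with
   c_n = binomial(2n, n) / 4^n, the coefficients of the square root of
   1 / (1 - z): c * c = 1, and c_n is proportional to the tail sums of the arches
   in the limit. Finally the tail sums of e_n follow by the Stolz-Cesaro
   theorem. *)

Require Import Defs.
From HB Require Import structures.
From mathcomp Require Import all_boot all_order all_algebra.
From mathcomp Require Import all_classical all_reals all_analysis.
From mathcomp Require Import ring lra zify complex.

Set Implicit Arguments.
Unset Strict Implicit.
Unset Printing Implicit Defensive.

Import Order.TTheory GRing.Theory Num.Theory.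
Import numFieldNormedType.Exports.

Local Open Scope classical_set_scope.
Local Open Scope ring_scope.

(** * Convolutions and renewal sequences *)

(** If [B(rho) = 1], the arches have infinite mean at [rho]: the renewal theorem only says that
    [e_n rho^n] tends to 0, and knowing [E] near [rho] would control partial sums, with no
    monotonicity to pass from sums to terms. The identity [n e_n = ((e * e) * (k b_k))_n] gets
    around this: the factor [k] turns the decay [k^(-3/2)] of the arches into [k^(-1/2)], which is
    comparable with [c_k], and a ratio of convolutions only sees the limit of the ratio of the
    factors. Since [c * c = 1], a limit of [e * c] becomes an equivalent of the partial sums of [e]
    without a Tauberian theorem. There is no singularity analysis: apart from the characteristic
    function of one step, all arguments are real and almost all sums have nonnegative terms. The
    branch [u_1] enters through [B(z) = z P_0(u_1(z))] on []0, rho]]; truncated first-passage sums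
    increase to a root of [z P(x) = 1] that is at most [tau], and this selects the small branch. *)

Section Convolution.
Variable R : comNzRingType.
Implicit Types a b c : nat -> R.

Definition conv a b (n : nat) : R := \sum_(k < n.+1) a k * b (n - k)%N.

Definition delta (n : nat) : R := (n == 0)%:R.

(** Truncated sequences are polynomials, from whose product commutativity and associativity are
    inherited. *)
Lemma conv_coefM a b (n m : nat) : (n <= m)%N ->
  conv a b n = (\poly_(i < m.+1) a i * \poly_(i < m.+1) b i)`_n.
Proof.
move=> nm; rewrite coefM; apply: eq_bigr => i _; rewrite !coef_poly.
by rewrite !ltnS (leq_trans _ nm) ?leq_ord // (leq_trans (leq_subr _ _) nm).
Qed.

Lemma convC a b : conv a b =1 conv b a.
Proof. by move=> n; rewrite !(conv_coefM _ _ (leqnn n)) mulrC. Qed.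

Lemma convA a b c : conv a (conv b c) =1 conv (conv a b) c.
Proof.
move=> n; rewrite [RHS](conv_coefM _ _ (leqnn n)) [LHS](conv_coefM _ _ (leqnn n)).
have E u (p : {poly R}) : (forall i, (i <= n)%N -> u i = p`_i) ->
   forall q : {poly R}, ((\poly_(i < n.+1) u i) * q)`_n = (p * q)`_n.
  move=> up q; rewrite !coefM; apply: eq_bigr => i _.
  by rewrite coef_poly ltn_ord up // leq_ord.
rewrite (E (conv a b) (\poly_(i < n.+1) a i * \poly_(i < n.+1) b i)); last first.
  by move=> i; exact: conv_coefM.
rewrite mulrC (E (conv b c) (\poly_(i < n.+1) b i * \poly_(i < n.+1) c i)); last first.
  by move=> i; exact: conv_coefM.
by congr (_`_n); rewrite mulrC mulrA.
Qed.

Lemma eq_convl a a' b n : (forall k, (k <= n)%N -> a k = a' k) ->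
  conv a b n = conv a' b n.
Proof. by move=> aa; apply: eq_bigr => i _; rewrite aa // leq_ord. Qed.

Lemma eq_convr a b b' n : (forall k, (k <= n)%N -> b k = b' k) ->
  conv a b n = conv a b' n.
Proof. by move=> bb; rewrite convC (eq_convl _ bb) convC. Qed.

Lemma convDl a a' b n : conv (fun k => a k + a' k) b n = conv a b n + conv a' b n.
Proof. by rewrite /conv -big_split; apply: eq_bigr => i _; rewrite mulrDl. Qed.

Lemma convZl x a b n : conv (fun k => x * a k) b n = x * conv a b n.
Proof. by rewrite /conv mulr_sumr; apply: eq_bigr => i _; rewrite mulrA. Qed.

Lemma convZr x a b n : conv a (fun k => x * b k) n = x * conv a b n.
Proof. by rewrite convC convZl convC. Qed.

Lemma convBl a a' b n : conv (fun k => a k - a' k) b n = conv a b n - conv a' b n.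
Proof.
by rewrite convDl; congr (_ + _); rewrite /conv -sumrN; apply: eq_bigr=> i _; rewrite mulNr.
Qed.

Lemma convBr a b b' n : conv a (fun k => b k - b' k) n = conv a b n - conv a b' n.
Proof. by rewrite convC convBl !(convC a). Qed.

Lemma conv_sumr (I : finType) (b : I -> nat -> R) a n :
  conv a (fun k => \sum_i b i k) n = \sum_i conv a (b i) n.
Proof.
by rewrite /conv exchange_big; apply: eq_bigr => i _; rewrite mulr_sumr.
Qed.

Lemma conv_delta a : conv delta a =1 a.
Proof.
move=> n; rewrite /conv big_ord_recl big1 ?addr0 ?mul1r ?subn0 //.
by move=> i _; rewrite /delta mul0r.
Qed.

Lemma conv_ones a n : conv (fun=> 1) a n = \sum_(k < n.+1) a k.
Proof. by rewrite convC; apply: eq_bigr => i _; rewrite mulr1. Qed.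

Lemma conv_expz z a b n :
  conv (fun k => a k * z ^+ k) (fun k => b k * z ^+ k) n = conv a b n * z ^+ n.
Proof.
rewrite /conv mulr_suml; apply: eq_bigr => i _.
by rewrite mulrACA -exprD subnKC // leq_ord.
Qed.

Lemma conv_natl a b n : n%:R * conv a b n =
  conv (fun k => k%:R * a k) b n + conv a (fun k => k%:R * b k) n.
Proof.
rewrite /conv mulr_sumr -big_split; apply: eq_bigr => i _ /=.
rewrite -{1}(subnKC (leq_ord i)) natrD mulrDl mulrA; congr (_ + _).
by rewrite mulrCA.
Qed.

Lemma conv_recl a b n :
  conv a b n.+1 = a 0%N * b n.+1 + conv (fun k => a k.+1) b n.
Proof. by rewrite /conv big_ord_recl subn0; congr (_ + _). Qed.

End Convolution.

Section Renewal.
Variables (R : comNzRingType) (b e : nat -> R).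
Hypotheses (b0 : b 0%N = 0) (ren : forall n, e n = delta R n + conv b e n).

(** Since [b 0 = 0], the term [conv b d n] only involves values of [d] before [n]: the equation is a
    recursion. *)
Lemma renewal_uniq (y d d' : nat -> R) :
  (forall n, d n = y n + conv b d n) -> (forall n, d' n = y n + conv b d' n) ->
  d =1 d'.
Proof.
move=> dE d'E n; elim/ltn_ind: n => n IH; rewrite dE d'E; congr (_ + _).
case: n IH => [|n] IH; first by rewrite /conv !big_ord1 b0 !mul0r.
rewrite !conv_recl b0 !mul0r !add0r; apply: eq_convr => k kn.
by rewrite IH // ltnS.
Qed.

Lemma renewal_solution (y d : nat -> R) :
  (forall n, d n = y n + conv b d n) -> d =1 conv y e.
Proof.
move=> dE; apply: renewal_uniq dE _ => n.
rewrite convC (eq_convl _ (fun k _ => ren k)) convDl conv_delta; congr (_ + _).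
by rewrite -convA; apply: eq_convr => k _; rewrite convC.
Qed.

(* Coefficientwise form of [E' = E^2 B'], which follows from [E = 1 + B E]. *)
Lemma renewal_diff n :
  n%:R * e n = conv (conv e e) (fun k => k%:R * b k) n.
Proof.
rewrite -convA convC.
(* Differentiating [E = 1 + B E] shows that [n * e n] solves the renewal equation with source
   [e * (k b_k)]. *)
rewrite -(@renewal_solution (conv e (fun k => k%:R * b k))
            (fun n => n%:R * e n)) // => {}n.
by rewrite ren mulrDr conv_natl /delta addrA (convC e); case: n => [|n];
   rewrite ?mul0r ?mulr0 add0r.
Qed.

Lemma renewal0 : e 0%N = 1.
Proof. by rewrite ren /conv big_ord1 b0 mul0r addr0. Qed.

End Renewal.

(** * Limits of sums, convolutions and quotients *)

Section Limits.
Variable R : realType.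
Implicit Types (a b u v w g r m : nat -> R).

Lemma cvg_sumr (T : Type) (F : set_system T) (FF : Filter F) (N : nat)
    (f : nat -> T -> R) (l : nat -> R) :
  (forall k, f k x @[x --> F] --> l k) ->
  (\sum_(k < N) f k x) @[x --> F] --> \sum_(k < N) l k.
Proof.
move=> fl; elim: N => [|N IH].
  by rewrite big_ord0; under eq_fun do rewrite big_ord0; exact: cvg_cst.
rewrite big_ord_recr /=; under eq_fun do rewrite big_ord_recr /=.
exact: cvgD.
Qed.

Lemma cvg_subn (j : nat) u (l : R) :
  u @ \oo --> l -> u (n - j)%N @[n --> \oo] --> l.
Proof. by move=> ul; rewrite -(cvg_shiftn j) /=; under eq_fun do rewrite addnK. Qed.

Lemma series_homo a : (forall k, 0 <= a k) ->
  {homo series a : i j / (i <= j)%N >-> i <= j}.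
Proof. by move=> a0 i j ij; rewrite -subr_ge0 sub_series_geq // sumr_ge0. Qed.

Lemma series_le_lim a (A : R) : (forall k, 0 <= a k) -> series a @ \oo --> A ->
  forall n, series a n <= A.
Proof.
move=> a0 aA n; rewrite -(cvg_lim (@Rhausdorff R) aA).
exact: nondecreasing_cvgn_le (series_homo a0) (cvgP _ aA) n.
Qed.

(** Dominated convergence for sums of growing length, the terms being dominated by [C * a k]. *)
Lemma tannery a (A Y C : R) (y : nat -> nat -> R) :
  (forall k, 0 <= a k) -> series a @ \oo --> A ->
  (forall n k, `|y n k| <= C) -> (forall k, y n k @[n --> \oo] --> Y) ->
  (\sum_(k < n) a k * y n k) @[n --> \oo] --> A * Y.
Proof.
move=> a0 aA yC yY.
have sA := series_le_lim a0 aA.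
have C0 : 0 <= C by apply: le_trans (yC 0%N 0%N).
suff H : (\sum_(k < n) a k * (y n k - Y)) @[n --> \oo] --> 0.
  have -> : A * Y = 0 + A * Y by rewrite add0r.
  have -> : (fun n => \sum_(k < n) a k * y n k) =
     (fun n => \sum_(k < n) a k * (y n k - Y) + series a n * Y).
    apply/funext => n; rewrite /series/= big_mkord mulr_suml -big_split.
    by apply: eq_bigr => i _ /=; rewrite -mulrDr subrK.
  by apply: cvgD => //; apply: cvgMr_tmp.
apply/cvgrPdist_le => e e0.
have K0 : 0 < C + `|Y| + 1 by rewrite ltr_wpDl ?addr_ge0.
have /cvgrPdist_le/(_ (e / 2 / (C + `|Y| + 1))) := aA.
rewrite !divr_gt0 // => /(_ isT) [N _ HN].
have HNN := HN N (leqnn N); rewrite /= ger0_norm ?subr_ge0 // in HNN.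
have : (\sum_(k < N) a k * `|y n k - Y|) @[n --> \oo] --> \sum_(k < N) a k * 0.
  apply: (@cvg_sumr _ _ _ N (fun k n => a k * `|y n k - Y|) (fun k => a k * 0)) => k.
  apply: cvgMl_tmp; apply/norm_cvg0P; rewrite -(subrr Y).
  by apply: cvgB => //; exact: cvg_cst.
rewrite big1 => [|i _]; last by rewrite mulr0.
move=> /cvgrPdist_le/(_ (e / 2)); rewrite divr_gt0 // => /(_ isT) H.
near=> n.
have Nn : (N <= n)%N by near: n; exists N.
rewrite sub0r normrN.
apply: le_trans (ler_norm_sum _ _ _) _.
rewrite -(big_mkord xpredT (fun k => `|a k * (y n k - Y)|)) (@big_cat_nat _ _ _ N) //=.
rewrite big_mkord [e](splitr) lerD //.
  have : `|0 - \sum_(k < N) a k * `|y n k - Y| | <= e / 2 by near: n.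
  rewrite sub0r normrN; apply: le_trans.
  rewrite ger0_norm ?sumr_ge0 // => [|i _]; last by rewrite mulr_ge0.
  by apply: ler_sum => i _; rewrite normrM ger0_norm.
apply: (@le_trans _ _ ((series a n - series a N) * (C + `|Y| + 1))).
  rewrite sub_series_geq // mulr_suml; apply: ler_sum => i _.
  rewrite normrM ger0_norm // ler_wpM2l //.
  by rewrite (le_trans (ler_normB _ _)) // ler_wpDr // lerD.
rewrite -ler_pdivlMr //; apply: le_trans HNN; exact: lerB.
Unshelve. all: by end_near. Qed.

Lemma cvgn_bounded u (l : R) : u @ \oo --> l -> exists2 C, 0 <= C & forall n, `|u n| <= C.
Proof.
move=> /cvgP/cvg_seq_bounded [C [_ HC]]; exists (`|C| + 1); first by rewrite addr_ge0.
by move=> n; apply: (HC (`|C| + 1)) => //; rewrite ltr_pwDr // ler_norm.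
Qed.

Lemma conv_cvg a y (A Y : R) : (forall k, 0 <= a k) -> series a @ \oo --> A ->
  y @ \oo --> Y -> conv a y @ \oo --> A * Y.
Proof.
move=> a0 aA yY.
have [C C0 HC] := cvgn_bounded yY.
(* The value 0 out of range makes [y'] bounded everywhere, as [tannery] requires; the shift by one
   accounts for its sums over [k < n]. *)
pose y' n k := if (k < n)%N then y (n.-1 - k)%N else 0.
have -> : conv a y = fun n => \sum_(k < n.+1) a k * y' n.+1 k.
  by apply/funext => n; apply: eq_bigr => i _; rewrite /y' ltn_ord.
rewrite (cvg_shiftS (fun n => \sum_(k < n) a k * y' n k)).
apply: (tannery a0 aA (C := C)).
  by move=> n k; rewrite /y'; case: ifP => // _; rewrite normr0.
move=> k; rewrite -(cvg_shiftn k.+1).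
apply: cvg_trans yY; apply: near_eq_cvg; near=> n.
by rewrite /y' /= addnS ltnS leq_addl /= addnK.
Unshelve. all: by end_near. Qed.

(** Summation is convolution with the constant 1, so this is associativity. *)
Lemma series_conv a b n : series (conv a b) n.+1 = conv a (fun k => series b k.+1) n.
Proof.
rewrite /series/= big_mkord -conv_ones convA; apply: esym; apply: etrans (eq_convl _ _); last first.
  by move=> k _; exact: convC.
rewrite -convA; apply: eq_convr => k _; by rewrite conv_ones /series/= big_mkord.
Qed.

Lemma cvg_series_conv a b (A B : R) : (forall k, 0 <= a k) ->
  series a @ \oo --> A -> series b @ \oo --> B -> series (conv a b) @ \oo --> A * B.
Proof.
move=> a0 aA bB; rewrite -(cvg_shiftS (series (conv a b))) /=.
under eq_fun do rewrite series_conv.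
by apply: conv_cvg => //; rewrite (cvg_shiftS (series b)).
Qed.

(** Regularity of a weighted mean: [r k] is averaged with the weights
    [g k * w (n - k) / conv w g n]. By the last hypothesis each fixed index loses its weight, so
    only the values of [r] close to [l] count. *)
Lemma conv_ratio w g r (l : R) :
  (forall k, 0 <= w k) -> (forall k, 0 <= g k) -> r @ \oo --> l ->
  (\forall n \near \oo, 0 < conv w g n) ->
  (forall j, w (n - j)%N / conv w g n @[n --> \oo] --> (0:R)) ->
  conv w (fun k => g k * r k) n / conv w g n @[n --> \oo] --> l.
Proof.
move=> w0 g0 rl D0 wD; apply/cvgrPdist_le => e e0.
have /cvgrPdist_le/(_ (e / 2)) := rl; rewrite divr_gt0 // => /(_ isT) [N _ HN].
have : (\sum_(k < N) g k * `|r k - l| * (w (n - k)%N / conv w g n)) @[n --> \oo]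
      --> \sum_(k < N) g k * `|r k - l| * 0.
  by apply: (@cvg_sumr _ _ _ N (fun k n => g k * `|r k - l| * (w (n - k)%N / conv w g n)) (fun k => g k * `|r k - l| * 0)) => k;
     apply: cvgMl_tmp.
rewrite big1 => [|i _]; last by rewrite mulr0.
move=> /cvgrPdist_le/(_ (e / 2)); rewrite divr_gt0 // => /(_ isT) H.
near=> n.
have Nn : (N <= n.+1)%N by rewrite leqW //; near: n; exists N.
have Dn : 0 < conv w g n by near: n.
have -> : l - conv w (fun k => g k * r k) n / conv w g n =
   - ((\sum_(0 <= k < n.+1) g k * (r k - l) * w (n - k)%N) / conv w g n).
  have -> : \sum_(0 <= k < n.+1) g k * (r k - l) * w (n - k)%N =
     conv w (fun k => g k * r k) n - l * conv w g n.
    rewrite big_mkord -convZr -convBr convC; apply: eq_bigr => i _.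
    by rewrite mulrBr (mulrC l).
  by rewrite mulrBl mulfK ?opprB // gt_eqF.
rewrite normrN normrM normfV (gtr0_norm Dn).
have H1 : \sum_(k < N) g k * `|r k - l| * (w (n - k)%N / conv w g n) <= e / 2.
  have : `|0 - \sum_(k < N) g k * `|r k - l| * (w (n - k)%N / conv w g n)| <= e / 2 by near: n.
  by rewrite sub0r normrN; apply: le_trans; exact: ler_norm.
rewrite ler_pdivrMr // [e]splitr mulrDl.
apply: le_trans (ler_norm_sum _ _ _) _; rewrite (@big_cat_nat _ _ _ N) //=.
rewrite big_mkord lerD //.
  rewrite -ler_pdivrMr // mulr_suml; apply: le_trans H1; apply: ler_sum => i _.
  by rewrite !normrM (ger0_norm (g0 _)) (ger0_norm (w0 _)) -!mulrA.
rewrite convC /conv mulr_sumr.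
rewrite -(big_mkord xpredT (fun k => e / 2 * (g k * w (n - k)%N))).
rewrite [leRHS](@big_cat_nat _ _ _ N) //= ler_wpDl //.
  by apply: sumr_ge0 => i _; rewrite !mulr_ge0 ?g0 ?w0 // ltW // divr_gt0.
rewrite !big_nat; apply: ler_sum => i /andP[Ni _].
rewrite !normrM (ger0_norm (g0 _)) (ger0_norm (w0 _)) [leRHS]mulrCA [leRHS]mulrA.
by rewrite ler_wpM2r // ler_wpM2l // distrC; apply: HN.
Unshelve. all: by end_near. Qed.

Lemma le_limit_shift u (N : nat) : {in [pred n | (N <= n)%N], forall n, u n <= u n.+1} ->
  u @ \oo --> (0:R) -> forall n, (N <= n)%N -> u n <= 0.
Proof.
move=> uS u0 n Nn.
have h : {homo (fun k => u (k + N)%N) : i j / (i <= j)%N >-> i <= j}.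
  apply: homo_leq => //; first exact: le_trans.
  by move=> i; rewrite addSn uS // inE leq_addl.
have c : (fun k => u (k + N)%N) @ \oo --> (0:R) by rewrite (cvg_shiftn N).
rewrite -(subnK Nn) -(cvg_lim _ c) //.
exact: (nondecreasing_cvgn_le h (cvgP _ c) (n - N)%N).
Qed.

(** Stolz-Cesaro in the case 0/0: [m - (l + e) * g] and [(l - e) * g - m] are eventually
    nondecreasing with limit 0, hence nonpositive. *)
Lemma stolz m g (l : R) : m @ \oo --> (0:R) -> g @ \oo --> (0:R) ->
  (\forall n \near \oo, g n.+1 < g n) ->
  (m n - m n.+1) / (g n - g n.+1) @[n --> \oo] --> l ->
  m n / g n @[n --> \oo] --> l.
Proof.
move=> m0 g0 gS mgl; apply/cvgrPdist_le => e e0.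
case: gS => N1 _ H1.
have /cvgrPdist_le/(_ e e0) [N2 _ H2] := mgl.
pose N := maxn N1 N2; exists N => // n /= Nn.
have gd k : (N <= k)%N -> 0 < g k - g k.+1.
  by move=> Nk; rewrite subr_gt0; apply: H1; rewrite /= (leq_trans _ Nk) // leq_maxl.
have mg k : (N <= k)%N -> `|l * (g k - g k.+1) - (m k - m k.+1)| <= e * (g k - g k.+1).
  move=> Nk; have d0 := gd k Nk.
  rewrite -[X in _ <= e * X](gtr0_norm d0) -ler_pdivrMr ?normr_gt0 ?gt_eqF //.
  rewrite -normf_div mulrBl mulfK ?gt_eqF //; apply: H2.
  by rewrite /= (leq_trans _ Nk) // leq_maxr.
have gpos : 0 < g n.
  have gn k : (N <= k)%N -> 0 <= g k.
    move=> Nk; rewrite -oppr_le0; apply: (@le_limit_shift (fun k => - g k) N) => //.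
      by move=> i; rewrite inE => /gd; lra.
    by rewrite -oppr0; apply: cvgN.
  by have := gd n Nn; have := gn n.+1 (leqW Nn); lra.
have A1 : m n - (l + e) * g n <= 0.
  apply: (@le_limit_shift (fun k => m k - (l + e) * g k) N) => //.
    move=> k; rewrite inE => Nk; have := mg k Nk; rewrite ler_distl => /andP[]; lra.
  have -> : (0:R) = 0 - (l + e) * 0 by rewrite mulr0 subr0.
  by apply: cvgB => //; apply: cvgMl_tmp.
have A2 : (l - e) * g n - m n <= 0.
  apply: (@le_limit_shift (fun k => (l - e) * g k - m k) N) => //.
    move=> k; rewrite inE => Nk; have := mg k Nk; rewrite ler_distl => /andP[]; lra.
  have -> : (0:R) = (l - e) * 0 - 0 by rewrite mulr0 subr0.
  by apply: cvgB => //; apply: cvgMl_tmp.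
rewrite ler_distl; rewrite lerBlDr ler_pdivrMr //.
by rewrite -lerBlDr ler_pdivlMr //; apply/andP; split; lra.
Qed.

(** Telescoping, by [1 / sqrt (n + 1) <= 2 * (sqrt (n + 1) - sqrt n)]. *)
Lemma sum_inv_sqrt (C : R) u : 0 <= C -> u 0%N <= 0 ->
  (forall n, u n.+1 <= C / Num.sqrt n.+1%:R) ->
  forall n, \sum_(k < n.+1) u k <= 2 * C * Num.sqrt n%:R.
Proof.
move=> C0 u0 uC; elim=> [|n IH]; first by rewrite big_ord1 sqrtr0 mulr0.
rewrite big_ord_recr /=; apply: le_trans (lerD IH (uC n)) _.
set x := Num.sqrt n%:R; set y := Num.sqrt n.+1%:R.
have x0 : 0 <= x by exact: sqrtr_ge0.
have y0 : 0 < y by rewrite sqrtr_gt0.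
have xE : y ^+ 2 = x ^+ 2 + 1 by rewrite !sqr_sqrtr // -natr1.
rewrite -lerBrDl ler_pdivrMr //.
have -> : (2 * C * y - 2 * C * x) * y = C * (2 * (y - x) * y) by ring.
rewrite ler_peMr //; nra.
Qed.

End Limits.

(** * The renewal theorem for eventually positive weights *)

Section RenewalTheorem.
Variable R : realType.
Implicit Types y b e : nat -> R.

Lemma exists_limsup y (C : R) : (forall n, `|y n| <= C) -> exists L : R,
  [/\ `|L| <= C, forall eps, 0 < eps -> \forall n \near \oo, y n <= L + eps &
   forall eps (N : nat), 0 < eps -> exists2 n, (N <= n)%N & L - eps <= y n].
Proof.
move=> yC; pose A := [set x | \forall n \near \oo, y n <= x].
have AC : A C by near=> n; rewrite (le_trans _ (yC n)) ?ler_norm.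
have lbA : lbound A (- C).
  move=> x [N _ /(_ N (leqnn N)) /=]; apply: le_trans.
  by have := yC N; rewrite ler_norml => /andP[].
have hA : has_inf A by split; [exists C | exists (- C)].
exists (inf A); split.
- rewrite ler_norml lb_le_inf //=; last by exists C.
  exact: ge_inf hA.2 _ AC.
- move=> eps e0; have [x Ax xl] := inf_adherent e0 hA.
  by apply: filterS Ax => n yx; rewrite (le_trans yx) // ltW.
- move=> eps N e0; apply: contrapT => H.
  have : A (inf A - eps).
    exists N => // n /= Nn; apply/ltW; rewrite ltNge; apply/negP => Hn.
    by apply: H; exists n.
  by move=> /(ge_inf hA.2); lra.
Unshelve. all: by end_near. Qed.

Section Window.
Variables (b y : nat -> R) (L : R) (K : nat).
Hypotheses (b0 : forall k, 0 <= b k) (b1 : series b @ \oo --> (1:R))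
  (bK : forall k, (K <= k)%N -> 0 < b k).
Hypotheses (y1 : forall n, `|y n| <= 1) (L1 : `|L| <= 1)
  (yb : forall n, y n.+1 = conv b y n.+1)
  (Lsup : forall eps, 0 < eps -> \forall n \near \oo, y n <= L + eps)
  (Linf : forall eps (N : nat), 0 < eps -> exists2 n, (N <= n)%N & L - eps <= y n).

Let sb1 := series_le_lim b0 b1.

(* A value of [y] near its limsup is an average of earlier values none of which
   can be much larger, so those of positive weight are near the limsup too. *)
Lemma limsup_window (J N : nat) (eps : R) : 0 < eps ->
  exists2 n, (N + J <= n)%N & forall j, (j < J)%N -> L - eps <= y (n - j)%N.
Proof.
move=> e0.
have [beta beta0 Hbeta] : exists2 beta : R, 0 < beta &
    forall j, (j < J)%N -> beta <= b (K + j)%N.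
  elim: J => [|J' [beta beta0 H]]; first by exists 1.
  exists (Num.min beta (b (K + J')%N)); first by rewrite lt_min beta0 bK ?leq_addr.
  move=> j; rewrite ltnS leq_eqVlt => /orP[/eqP ->|/H]; first by rewrite ge_min lexx orbT.
  by rewrite ge_min => ->.
(* The total shortfall of the terms of index below [A] will be at most [6 * d]. Since this is at
   most [eps * beta], no term of weight at least [beta] can fall short by more than [eps]. *)
pose d := Num.min 1 (eps * beta / 6).
have d0 : 0 < d by rewrite lt_min ltr01 divr_gt0 // mulr_gt0.
have d1 : d <= 1 by rewrite ge_min lexx.
have db : 6 * d <= eps * beta.
  by have : d <= eps * beta / 6 by [rewrite ge_min lexx orbT]; lra.
have [N1 _ HN1] := Lsup d0.
have /cvgrPdist_le/(_ d d0) [A' _ HA'] := b1.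
pose A := maxn A' (K + J).
have HA : 1 - d <= series b A.
  have := HA' A (leq_maxl _ _); rewrite /= ler_norml => /andP[_]; lra.
have [m Hm Lm] := Linf (N1 + A + K + N + J).+1 d0.
(* The window ends at [m - K] because the weights are known to be positive only from index [K]
   on. *)
exists (m - K)%N => [|j jJ]; first lia.
have -> : (m - K - j = m - (K + j))%N by lia.
have kA : (K + j < A)%N by rewrite leq_max ltn_add2l jJ orbT.
have Am : (A <= m.+1)%N by lia.
have ym : y m <= \sum_(0 <= k < A) b k * y (m - k)%N + d.
  have -> : y m = conv b y m by case: m {Lm Am} Hm => // m' _; exact: yb.
  rewrite /conv -(big_mkord xpredT (fun k => b k * y (m - k)%N)) (@big_cat_nat _ _ _ A) //=.
  rewrite lerD2l; apply: (@le_trans _ _ (series b m.+1 - series b A)).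
    rewrite sub_series_geq //; apply: ler_sum => i _; rewrite ler_piMr //.
    by rewrite (le_trans (ler_norm _)).
  by have := sb1 m.+1; lra.
have S : \sum_(0 <= k < A) b k * (L + d - y (m - k)%N) <= 6 * d.
  have -> : \sum_(0 <= k < A) b k * (L + d - y (m - k)%N) =
     series b A * (L + d) - \sum_(0 <= k < A) b k * y (m - k)%N.
    by rewrite /series/= mulr_suml -sumrB; apply: eq_bigr => i _; ring.
  have := sb1 A; move: L1; rewrite ler_norml => /andP[]; nra.
have kS : b (K + j)%N * (L + d - y (m - (K + j))%N) <= 6 * d.
  apply: le_trans S; rewrite big_mkord (bigD1 (Ordinal kA)) //= ler_wpDr //.
  apply: sumr_ge0 => i _; rewrite mulr_ge0 // subr_ge0; apply: HN1 => /=.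
  have := ltn_ord i; lia.
have := Hbeta j jJ => bb; rewrite leNgt; apply/negP => H.
have : eps * beta < b (K + j)%N * (L + d - y (m - (K + j))%N); last lra.
apply: (@lt_le_trans _ _ ((eps + d) * beta)); first by rewrite mulrDl ltrDl mulr_gt0.
rewrite [leRHS]mulrC; apply: ler_pM => //; try lra; exact: ltW.
Qed.

End Window.

Variables (b e : nat -> R) (K : nat).
Hypotheses (b00 : b 0%N = 0) (b0 : forall k, 0 <= b k) (b1 : series b @ \oo --> (1:R))
  (bK : forall k, (K <= k)%N -> 0 < b k) (ren : forall n, e n = delta R n + conv b e n).

Let t n := 1 - series b n.+1.

Let t0 n : 0 <= t n.
Proof. by rewrite subr_ge0; exact: series_le_lim. Qed.

(** Decomposition by the last renewal up to time [n]: it happens at [n - k] with probability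
    [e (n - k) * t k], where [t k] is the probability that a waiting time exceeds [k]. *)
Lemma conv_tail n : conv t e n = 1.
Proof.
rewrite convBl (@eq_convl _ (fun n => series b n.+1) (conv (fun=> 1) b)); last first.
  by move=> k _; rewrite conv_ones /series/= big_mkord.
rewrite -convA -convBr (@eq_convr _ _ _ (delta R)); last by move=> k _; rewrite ren addrK.
by rewrite convC conv_delta.
Qed.

Lemma renewal_ge0 n : 0 <= e n.
Proof.
elim/ltn_ind: n => n IH; rewrite ren addr_ge0 ?ler0n //.
case: n IH => [|n] IH; first by rewrite /conv big_ord1 b00 mul0r.
rewrite conv_recl b00 mul0r add0r; apply: sumr_ge0 => i _; rewrite mulr_ge0 // IH //.
by rewrite ltnS leq_subr.
Qed.

Lemma renewal_le1 n : e n <= 1.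
Proof.
have te : t 0 = 1 by rewrite /t /series/= big_nat1 b00 subr0.
rewrite -(conv_tail n) convC /conv big_ord_recr /= subnn te mulr1 ler_wpDl // sumr_ge0 // => i _.
by rewrite mulr_ge0 ?t0 ?renewal_ge0.
Qed.

(** On a window of [J] values of [e] close to the limsup, the first [J] terms of [conv_tail] already
    amount to almost [L * series t J]. *)
Lemma renewal_limsup (L : R) :
  (forall eps (N : nat), 0 < eps -> exists2 n, (N <= n)%N & L - eps <= e n) ->
  (forall eps, 0 < eps -> \forall n \near \oo, e n <= L + eps) -> `|L| <= 1 ->
  forall J, L * series t J <= 1.
Proof.
move=> Linf Lsup L1 J; apply/ler_addgt0Pr => eps e0.
have T0 : 0 <= series t J by apply: sumr_ge0.
have d0 : 0 < eps / (series t J + 1) by rewrite divr_gt0 // ltr_wpDl.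
have e1 n : `|e n| <= 1 by rewrite ger0_norm ?renewal_ge0 // renewal_le1.
have eb n : e n.+1 = conv b e n.+1 by rewrite {1}ren /delta add0r.
have [n Jn Hn] := limsup_window b0 b1 bK e1 L1 eb Lsup Linf J 1 d0.
have : (L - eps / (series t J + 1)) * series t J <= 1.
  move: Hn; move: (eps / _) => d Hn.
  rewrite -[X in _ <= X](conv_tail n) /conv -(big_mkord xpredT (fun k => t k * e (n - k)%N)).
  rewrite (@big_cat_nat _ _ _ J) //=; last by lia.
  apply: ler_wpDr; first by apply: sumr_ge0 => i _; rewrite mulr_ge0 // renewal_ge0.
  rewrite mulrC /series/= mulr_suml !big_nat; apply: ler_sum => i iJ.
  by apply: ler_wpM2l; [exact: t0 | exact: Hn].
suff : eps / (series t J + 1) * series t J <= eps by lra.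
by rewrite mulrAC ler_pdivrMr ?ltr_wpDl // ler_wpM2l ?ltW // ltrDl.
Qed.

(** The sum of the tails is the mean waiting time; this is the case of an infinite mean. *)
Lemma renewal_cvg0 : series t @ \oo --> +oo -> e @ \oo --> (0:R).
Proof.
move=> too.
have e1 n : `|e n| <= 1 by rewrite ger0_norm ?renewal_ge0 // renewal_le1.
have [L [L1 Lsup Linf]] := exists_limsup e1.
apply/cvgrPdist_le => eps e0.
have /cvgryPge/(_ (2 / eps)) [J _ /(_ J (leqnn J)) /= HJ] := too.
have LJ := renewal_limsup Linf Lsup L1 J.
have L2 : L <= eps / 2.
  rewrite leNgt; apply/negP => H.
  have : eps / 2 * (2 / eps) < L * series t J.
    apply: (@lt_le_trans _ _ (L * (2 / eps))); first by rewrite ltr_pM2r // divr_gt0.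
    rewrite ler_wpM2l //; lra.
  by rewrite (_ : eps / 2 * (2 / eps) = 1); [lra | field; rewrite gt_eqF].
have e20 : 0 < eps / 2 by rewrite divr_gt0.
near=> n; rewrite sub0r normrN ger0_norm ?renewal_ge0 //.
have : e n <= L + eps / 2 by near: n; exact: Lsup.
by lra.
Unshelve. all: by end_near. Qed.

Lemma renewal_cvg (mu : R) : series t @ \oo --> mu -> e @ \oo --> mu^-1.
Proof.
move=> tmu.
have tmu' := series_le_lim t0 tmu.
have mu0 : 0 < mu.
  by apply: lt_le_trans (tmu' 1%N); rewrite /series/= big_nat1 /t /series/= big_nat1 b00 subr0.
have e1 n : `|e n| <= 1 by rewrite ger0_norm ?renewal_ge0 // renewal_le1.
have [L [L1 Lsup Linf]] := exists_limsup e1.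
have Lmu : L * mu <= 1.
  rewrite -(cvg_lim (@Rhausdorff R) (cvgMl_tmp (a := L) tmu)).
  apply: limr_le; first exact: cvgP (cvgMl_tmp tmu).
  by near=> J; exact: renewal_limsup.
(* The liminf is minus the limsup of [- e], to which [limsup_window] applies because it assumes no
   sign. The terms of [conv_tail] outside the window are then bounded by a remainder of the
   convergent series of the tails. *)
pose y n := - e n.
have y1 n : `|y n| <= 1 by rewrite normrN.
have yb n : y n.+1 = conv b y n.+1.
  rewrite /y ren /delta add0r -[RHS]opprK; congr (- _).
  by rewrite -mulN1r -convZr; apply: eq_convr => k _; rewrite mulN1r opprK.
have [L' [L1' Lsup' Linf']] := exists_limsup y1.
have Lmu' : 1 <= - L' * mu.
  apply/ler_addgt0Pr => eps e0.
  have d0 : 0 < eps / (2 * mu) by rewrite divr_gt0 // mulr_gt0.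
  have /cvgrPdist_le/(_ (eps / 4)) := tmu; rewrite divr_gt0 // => /(_ isT) [J _ /(_ J (leqnn J)) /=].
  rewrite ger0_norm ?subr_ge0 // => HJ.
  have [n Jn Hn] := limsup_window b0 b1 bK y1 L1' yb Lsup' Linf' J 1 d0.
  have tn : series t n.+1 - series t J <= eps / 4 by have := tmu' n.+1; lra.
  have : 1 <= (- L' + eps / (2 * mu)) * series t J + (series t n.+1 - series t J).
    rewrite -[X in X <= _](conv_tail n) /conv -(big_mkord xpredT (fun k => t k * e (n - k)%N)).
    rewrite sub_series_geq; last lia.
    rewrite (@big_cat_nat _ _ _ J) //=; last by lia.
    apply: lerD.
      rewrite mulrC /series/= mulr_suml !big_nat; apply: ler_sum => i iJ.
      apply: ler_wpM2l; first exact: t0.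
      by have := Hn i iJ; rewrite /y; lra.
    by apply: ler_sum => i _; apply: ler_piMr; [exact: t0 | exact: renewal_le1].
  have : eps / (2 * mu) * series t J <= eps / 2.
    have -> : eps / 2 = eps / (2 * mu) * mu by field; rewrite gt_eqF.
    by rewrite ler_wpM2l // ltW.
  have : - L' * series t J <= - L' * mu + eps / 4; last lra.
  suff : L' * (mu - series t J) <= eps / 4 by lra.
  by have := tmu' J; move: L1'; rewrite ler_norml => /andP[_ ? ?]; nra.
have LL : L <= mu^-1 by rewrite -ler_pdivlMr // div1r in Lmu.
have LL' : mu^-1 <= - L' by rewrite -ler_pdivrMr // div1r in Lmu'.
apply/cvgrPdist_le => eps e0; near=> n.
have : e n <= L + eps by near: n; exact: Lsup.
have : y n <= L' + eps by near: n; exact: Lsup'.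
by rewrite ler_norml /y => ? ?; apply/andP; split; lra.
Unshelve. all: by end_near. Qed.

End RenewalTheorem.

(** * Limits involving square roots *)

Section SquareRoots.
Variable R : realType.
Let rt n : R := Num.sqrt n%:R.

Lemma cvg_sqrtV : (rt n)^-1 @[n --> \oo] --> (0:R).
Proof.
rewrite -[X in _ --> X](@sqrtr0 R).
have -> : (fun n => (rt n)^-1) = (fun n => Num.sqrt (n%:R^-1 : R)).
  by apply/funext => n; rewrite sqrtrV.
apply: continuous_cvg; first exact: sqrt_continuous.
by rewrite -(cvg_shiftS (fun n => n%:R^-1 : R)); exact: cvg_harmonic.
Qed.

Lemma cvg_sqrt_shift k : rt n / rt (n - k) @[n --> \oo] --> (1:R).
Proof.
have H : Num.sqrt (1 + k%:R * n.+1%:R^-1) @[n --> \oo] --> (1:R).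
  have : (1 + k%:R * n.+1%:R^-1 : R) @[n --> \oo] --> (1 + k%:R * 0 : R).
    apply: cvgD; first exact: cvg_cst.
    by apply: cvgMl_tmp; exact: cvg_harmonic.
  rewrite mulr0 addr0 => H; rewrite -[X in _ --> X](@sqrtr1 R).
  by apply: continuous_cvg H; exact: sqrt_continuous.
rewrite -(cvg_shiftn k.+1); apply: cvg_trans H; apply: near_eq_cvg; near=> n.
by rewrite /= addnS -addSn addnK /rt -sqrtrV // -sqrtrM // natrD mulrDl divff // pnatr_eq0.
Unshelve. all: by end_near. Qed.

Lemma cvg_sqrt_ratio : rt n / rt n.+1 @[n --> \oo] --> (1:R).
Proof.
have H : rt n.+1 / rt n @[n --> \oo] --> (1:R).
  have := cvg_sqrt_shift 1; rewrite -(cvg_shiftS (fun n => Num.sqrt n%:R / _)) /=.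
  by under eq_fun do rewrite subSS subn0.
rewrite -[X in _ --> X]invr1.
have -> : (fun n => rt n / rt n.+1) = (fun n => (rt n.+1 / rt n)^-1).
  by apply/funext => n; rewrite invf_div.
by apply: cvgV => //; exact: oner_neq0.
Qed.

Lemma cvg_sqrt_pow3_ratio : (n.+1%:R * rt n.+1) / (n%:R * rt n) @[n --> \oo] --> (1:R).
Proof.
have H : (rt n / rt n.+1)^-1 @[n --> \oo] --> (1^-1 : R).
  by apply: cvgV; [exact: oner_neq0 | exact: cvg_sqrt_ratio].
rewrite invr1 in H.
have H3 : (rt n / rt n.+1)^-1 * ((rt n / rt n.+1)^-1 * (rt n / rt n.+1)^-1) @[n --> \oo]
    --> (1 * (1 * 1) : R) by apply: cvgM => //; exact: cvgM.
rewrite !mul1r in H3; apply: cvg_trans H3; apply: near_eq_cvg; near=> n.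
have n0 : (0 < n)%N by near: n; exists 1%N.
have r0 : 0 < rt n by rewrite sqrtr_gt0 ltr0n.
have r1 : 0 < rt n.+1 by rewrite sqrtr_gt0.
have e0 : n%:R = rt n ^+ 2 by rewrite sqr_sqrtr.
have e1 : n.+1%:R = rt n.+1 ^+ 2 by rewrite sqr_sqrtr.
by rewrite e0 e1; field; rewrite !gt_eqF.
Unshelve. all: by end_near. Qed.

(** Stolz-Cesaro against [1 / sqrt n], whose decrements are equivalent to [n^(-3/2) / 2]; hence the
    factor 2. *)
Lemma cvg_sqrt_tail (m : nat -> R) (l : R) : m @ \oo --> (0:R) ->
  n.+1%:R * rt n.+1 * (m n - m n.+1) @[n --> \oo] --> l ->
  rt n * m n @[n --> \oo] --> 2 * l.
Proof.
move=> m0 ml.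
have rt0 n : (0 < n)%N -> 0 < rt n by move=> n0; rewrite sqrtr_gt0 ltr0n.
have rt2 n : rt n ^+ 2 = n%:R by rewrite sqr_sqrtr.
suff : m n / (rt n)^-1 @[n --> \oo] --> 2 * l.
  by under eq_fun do rewrite invrK mulrC.
apply: stolz => //.
- exact: cvg_sqrtV.
- near=> n; have n0 : (0 < n)%N by near: n; exists 1%N.
  by rewrite ltf_pV2 ?posrE ?rt0 // /rt ltr_sqrt ?ltr0n // ltr_nat.
have H : (n.+1%:R * rt n.+1 * (m n - m n.+1)) * ((rt n / rt n.+1) * (rt n / rt n.+1 + 1))
    @[n --> \oo] --> l * (1 * (1 + 1)).
  apply: cvgM => //.
  by apply: cvgM; first exact: cvg_sqrt_ratio; apply: cvgD; [exact: cvg_sqrt_ratio | exact: cvg_cst].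
rewrite (_ : 2 * l = l * (1 * (1 + 1))); last by ring.
apply: cvg_trans H; apply: near_eq_cvg; near=> n.
have n0 : (0 < n)%N by near: n; exists 1%N.
have rn := rt0 n n0; have rn1 := rt0 n.+1 (ltn0Sn n).
have q : (rt n.+1 - rt n) * (rt n.+1 + rt n) = 1.
  by rewrite -subr_sqr !rt2 -natr1; ring.
have d0 : rt n.+1 - rt n != 0.
  by apply/negP => /eqP h; move: q; rewrite h mul0r => /eqP; rewrite eq_sym oner_eq0.
have d1 : rt n.+1 + rt n = (rt n.+1 - rt n)^-1.
  by apply: (mulfI d0); rewrite q divff.
have -> : rt n / rt n.+1 + 1 = (rt n.+1 - rt n)^-1 / rt n.+1.
  by rewrite -d1; field; rewrite gt_eqF.
have -> : (rt n)^-1 - (rt n.+1)^-1 = (rt n.+1 - rt n) / (rt n * rt n.+1).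
  by field; rewrite !gt_eqF.
rewrite -(rt2 n.+1); field.
by rewrite d0 !gt_eqF.
Unshelve. all: by end_near. Qed.

End SquareRoots.

(** * Subcritical renewal sequences *)

Section SubcriticalRenewal.
Variable R : realType.
Variables (b e : nat -> R) (beta kap : R).
Hypotheses (b00 : b 0%N = 0) (b0 : forall k, 0 <= b k)
  (b1 : series b @ \oo --> beta) (beta1 : beta < 1)
  (ren : forall n, e n = delta R n + conv b e n).

Let e0 := renewal_ge0 b00 b0 ren.

(** The partial sums satisfy [S <= 1 + beta * S], which bounds them as [beta < 1]; the limit then
    satisfies [E = 1 + beta * E]. *)
Lemma renewal_series : series e @ \oo --> (1 - beta)^-1.
Proof.
have sb := series_le_lim b0 b1.
have d0 : 0 < 1 - beta by rewrite subr_gt0.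
have eE n : series e n.+1 = 1 + series (conv b e) n.+1.
  rewrite /series/= (eq_bigr _ (fun k _ => ren k)) big_split /=; congr (_ + _).
  by rewrite big_nat_recl // big1 ?addr0 // => i _; rewrite /delta.
have bnd n : series e n <= (1 - beta)^-1.
  case: n => [|n]; first by rewrite /series/= big_geq // invr_ge0 ltW.
  rewrite -[leRHS]mul1r ler_pdivlMr //.
  suff : series (conv b e) n.+1 <= beta * series e n.+1 by have := eE n; lra.
  rewrite series_conv; apply: (@le_trans _ _ (series b n.+1 * series e n.+1)).
    rewrite /conv /series/= [X in _ <= X * _]big_mkord mulr_suml.
    apply: ler_sum => i _; rewrite ler_wpM2l //.
    by apply: series_homo => //; rewrite ltnS leq_subr.
  by rewrite ler_wpM2r // sumr_ge0.
have ce : cvgn (series e).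
  by apply: nondecreasing_is_cvgn; [exact: series_homo | exists (1 - beta)^-1 => _ [n _ <-]].
suff <- : limn (series e) = (1 - beta)^-1 by [].
have c1 : series e n.+1 @[n --> \oo] --> limn (series e) by rewrite (cvg_shiftS (series e)).
have c2 : series e n.+1 @[n --> \oo] --> 1 + beta * limn (series e).
  under eq_fun do rewrite eE; apply: cvgD; first exact: cvg_cst.
  by rewrite (cvg_shiftS (series (conv b e))); exact: cvg_series_conv.
have : limn (series e) = 1 + beta * limn (series e) by rewrite -[LHS](cvg_lim (@Rhausdorff R) c1) -[RHS](cvg_lim (@Rhausdorff R) c2).
move: (limn _) => E EE; apply: (mulIf (lt0r_neq0 d0)); rewrite mulVf ?gt_eqF //; lra.
Qed.

Let E := (1 - beta)^-1.
Let rt n : R := Num.sqrt n%:R.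
Let w n : R := n%:R * rt n.

Hypothesis bK : w n * b n @[n --> \oo] --> kap.

Let rt_ge0 n : 0 <= rt n. Proof. exact: sqrtr_ge0. Qed.
Let w_ge0 n : 0 <= w n. Proof. by rewrite mulr_ge0. Qed.
Let rt2 n : rt n ^+ 2 = n%:R. Proof. by rewrite sqr_sqrtr. Qed.
Let rt_le (m n : nat) : (m <= n)%N -> rt m <= rt n.
Proof. by move=> mn; rewrite ler_sqrt // ler_nat. Qed.
Let rtM (m n : nat) : rt (m * n)%N = rt m * rt n.
Proof. by rewrite /rt natrM sqrtrM. Qed.

(** The true factor is [N^(3/2)]; the cruder square keeps roots out of the constants. *)
Let w_le N n k : (n <= N * k)%N -> w n <= N%:R ^+ 2 * w k.
Proof.
move=> nNk; apply: (@le_trans _ _ (w (N * k)%N)).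
  by apply: ler_pM => //; [rewrite ler_nat | exact: rt_le].
rewrite /w rtM natrM [leRHS](_ : _ = (N%:R * k%:R) * (N%:R * rt k)); last by ring.
rewrite ler_wpM2l ?mulr_ge0 // ler_wpM2r //.
case: N {nNk} => [|N]; first by rewrite /rt sqrtr0.
by rewrite -[leRHS](rt2 N.+1) expr2 ler_peMl // -sqrtr1 ler_sqrt // ler1n.
Qed.

(* Removing from [n] a part [k <= n / N] costs at most a factor close to 1. *)
Let w_sub N n k : (0 < N)%N -> (N * k <= n)%N -> (1 - 2 / N%:R) * w n <= w (n - k)%N.
Proof.
move=> N0 Nkn; have kn : (k <= n)%N by nia.
case: (posnP n) => [->|n0]; first by rewrite [X in _ * X](_ : _ = 0) ?mulr0 ?w_ge0 // /w mul0r.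
have N0' : 0 < N%:R :> R by rewrite ltr0n.
have n0' : 0 < n%:R :> R by rewrite ltr0n.
(* With [x = (n - k) / n <= 1] this is [x <= sqrt x]. Hence [w (n - k) / w n >= x ^+ 2], and
   [x >= 1 - 1 / N] gives [x ^+ 2 >= 1 - 2 / N]. *)
have h : rt n * (n - k)%:R <= n%:R * rt (n - k).
  rewrite -(rt2 n) -(rt2 (n - k)).
  have := rt_le (leq_subr k n); rewrite -subr_ge0.
  by move=> /(mulr_ge0 (mulr_ge0 (rt_ge0 n) (rt_ge0 (n - k)))); nra.
have q : (1 - N%:R^-1) * n%:R <= (n - k)%:R :> R.
  rewrite natrB // mulrBl mul1r lerD2l lerN2 ler_pdivlMl // -natrM ler_nat //.
have q0 : 0 <= 1 - N%:R^-1 :> R by rewrite subr_ge0 invf_le1 // ler1n.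
apply: (@le_trans _ _ ((1 - N%:R^-1) * (1 - N%:R^-1) * w n)).
  rewrite ler_wpM2r //.
  have : 0 <= N%:R^-1 * N%:R^-1 :> R by rewrite mulr_ge0 // invr_ge0 ltW.
  by set i : R := N%:R^-1; nra.
have r0 := rt_ge0 n; have rk0 := rt_ge0 (n - k).
rewrite /w -(ler_pM2l n0').
have -> : n%:R * ((1 - N%:R^-1) * (1 - N%:R^-1) * (n%:R * rt n)) =
  ((1 - N%:R^-1) * n%:R) * (rt n * ((1 - N%:R^-1) * n%:R)) :> R by ring.
have -> : n%:R * ((n - k)%:R * rt (n - k)) = (n - k)%:R * (n%:R * rt (n - k)) by ring.
apply: ler_pM => //; [by rewrite mulr_ge0 ?ler0n| by rewrite !mulr_ge0 ?ler0n|].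
by apply: le_trans h; rewrite ler_wpM2l.
Qed.

Let be_exp : 0 <= beta.
Proof.
rewrite -(cvg_lim _ b1) //; apply: limr_ge; first exact: cvgP b1.
by near=> n; exact: sumr_ge0.
Unshelve. all: by end_near. Qed.

Let E0 : 0 <= E. Proof. by rewrite invr_ge0 subr_ge0 ltW. Qed.

Let se n : series e n <= E.
Proof.
have ec : series e @ \oo --> E := renewal_series.
rewrite -(cvg_lim _ ec) //; apply: nondecreasing_cvgn_le; last exact: cvgP ec.
by move=> i j ij; rewrite -subr_ge0 sub_series_geq // sumr_ge0.
Qed.

Let conv_ones_bound (u : nat -> R) n : \sum_(k < n.+1) u (n - k)%N = \sum_(k < n.+1) u k.
Proof.
by rewrite -[RHS]conv_ones /conv; apply: eq_bigr => i _; rewrite mul1r.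
Qed.

(** Strong induction, on the length of the first arch. If it is short compared with [n], the
    induction hypothesis applies at a small loss, which [beta < 1] compensates; if it is long, [w n]
    is absorbed by the bound on [b], and the values of [e] sum to at most [E]. *)
Let e_bound : exists2 A, 0 <= A & forall n, w n * e n <= A.
Proof.
have [C C0 HC] := cvgn_bounded bK.
have HC' n : w n * b n <= C by apply: le_trans (HC n); exact: ler_norm.
have d0 : 0 < 1 - beta by rewrite subr_gt0.
(* [N] is so large that the loss factor of [w_sub] is at most [2 / (1 + beta)], whose product with
   [beta] is still below 1. *)
have [N N4] : exists N : nat, 4 / (1 - beta) < N%:R.
  by exists (Num.bound (4 / (1 - beta))); apply: archi_boundP; rewrite divr_ge0 // ltW.
have N0 : (0 < N)%N.
  by rewrite -(ltr_nat R); apply: lt_trans N4; rewrite divr_gt0.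
have N0' : 0 < N%:R :> R by rewrite ltr0n.
have q : (1 + beta) / 2 <= 1 - 2 / N%:R.
  move: N4; rewrite ltr_pdivrMr // => N4.
  suff : 2 / N%:R <= (1 - beta) / 2 by lra.
  by rewrite ler_pdivrMr //; lra.
(* The solution of [A = A * (2 / (1 + beta)) * beta + N ^+ 2 * C * E], the recursive bound obtained
   below. *)
pose A := N%:R ^+ 2 * C * E * (1 + beta) / (1 - beta).
have b1p : 0 < 1 + beta by have := be_exp; lra.
have A0 : 0 <= A by apply: divr_ge0; [apply: mulr_ge0; [rewrite !mulr_ge0|exact: ltW] | exact: ltW].
exists A => //; elim/ltn_ind => n IH.
case: n IH => [|n] IH; first by rewrite /w mul0r mul0r.
rewrite ren /delta add0r conv_recl b00 mul0r add0r /conv mulr_sumr.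
apply: (@le_trans _ _ (\sum_(i < n.+1) (A * (2 / (1 + beta)) * b i.+1 + N%:R ^+ 2 * C * e (n - i)%N))).
  apply: ler_sum => i _; have i_n := ltn_ord i.
  case: (leqP (N * i.+1) n.+1) => H.
    rewrite ler_wpDr ?mulr_ge0 //.
    have := IH (n - i)%N; rewrite ltnS leq_subr => /(_ isT) IHi.
    have := w_sub N0 H; rewrite subSS => ws.
    have wq : w n.+1 <= 2 / (1 + beta) * w (n - i).
      rewrite mulrAC ler_pdivlMr // mulrC.
      have := ler_wpM2r (w_ge0 n.+1) q; lra.
    rewrite mulrCA [leRHS]mulrC ler_wpM2l //.
    apply: le_trans (ler_wpM2r (e0 _) wq) _.
    rewrite -[leLHS]mulrA (mulrC A); apply: ler_wpM2l => //; exact/ltW/divr_gt0.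
  apply: ler_wpDl.
    by apply: mulr_ge0 => //; apply: mulr_ge0 => //; apply/ltW/divr_gt0.
  rewrite mulrA ler_wpM2r //.
  apply: (@le_trans _ _ (N%:R ^+ 2 * w i.+1 * b i.+1)).
    by rewrite ler_wpM2r // w_le // ltnW.
  by rewrite -mulrA ler_wpM2l ?exprn_ge0.
rewrite big_split /= -!mulr_sumr (conv_ones_bound e).
have se' := se n.+1; rewrite /series/= big_mkord in se'.
have sb' : \sum_(i < n.+1) b i.+1 <= beta.
  rewrite -(cvg_lim _ b1) //; apply: le_trans (nondecreasing_cvgn_le _ _ n.+2); last exact: cvgP b1.
    by rewrite /series/= big_mkord big_ord_recl b00 add0r.
  by move=> i j ij; rewrite -subr_ge0 sub_series_geq // sumr_ge0.
apply: (@le_trans _ _ (A * (2 / (1 + beta)) * beta + N%:R ^+ 2 * C * E)).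
  apply: lerD; apply: ler_wpM2l => //; last by rewrite !mulr_ge0.
  by apply: mulr_ge0 => //; apply/ltW/divr_gt0.
rewrite le_eqVlt; apply/orP; left; apply/eqP; rewrite /A; field.
by rewrite !gt_eqF.
Qed.

Let s := conv e e.

Let s_ge0 n : 0 <= s n. Proof. by apply: sumr_ge0 => i _; rewrite mulr_ge0. Qed.

(** One of two indices of sum [n] is at least [n / 2]; there [e] is of order [1 / w n], and the
    other factor is summable. *)
Let s_bound : exists2 A, 0 <= A & forall n, w n * s n <= A.
Proof.
have [A A0 HA] := e_bound; exists (8 * A * E); first by rewrite !mulr_ge0.
move=> n; rewrite /s /conv mulr_sumr.
apply: (@le_trans _ _ (\sum_(k < n.+1) (4 * A * e k + 4 * A * e (n - k)%N))).
  apply: ler_sum => k _; have k_n := ltn_ord k.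
  case: (leqP n (2 * k)) => H.
    rewrite ler_wpDl ?mulr_ge0 // mulrA ler_wpM2r //.
    apply: le_trans (ler_wpM2r (e0 _) (w_le H)) _.
    by rewrite -mulrA (_ : 2%:R ^+ 2 = 4) ?ler_wpM2l // -natrX.
  rewrite ler_wpDr ?mulr_ge0 // mulrCA [leRHS]mulrC ler_wpM2l //.
  have H' : (n <= 2 * (n - k))%N by lia.
  apply: le_trans (ler_wpM2r (e0 _) (w_le H')) _.
  by rewrite -mulrA (_ : 2%:R ^+ 2 = 4) ?ler_wpM2l // -natrX.
rewrite big_split /= -!mulr_sumr (conv_ones_bound e).
have se' := se n.+1; rewrite /series/= big_mkord in se'.
have := ler_wpM2l A0 se'; lra.
Qed.

(** By [renewal_diff], [w n * e n] is [sqrt n] times the sum of the [s k * x (n - k)]. For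
    [k < n / 2] dominated convergence applies, with [sum s = E ^+ 2]. For [k >= n / 2], [s k] is of
    order [n^(-3/2)] and the [x] sum to order [sqrt n], so that this part vanishes like
    [1 / sqrt n]. *)
Theorem subcritical_renewal : w n * e n @[n --> \oo] --> kap * E ^+ 2.
Proof.
have [C C0 HC] := cvgn_bounded bK.
have HC' n : w n * b n <= C by apply: le_trans (HC n); exact: ler_norm.
have [A A0 HA] := s_bound.
pose x k : R := k%:R * b k.
have x0 k : 0 <= x k by rewrite mulr_ge0.
have xC k : rt k * x k <= C by rewrite /x mulrA (mulrC (rt k)) HC'.
have xs n : \sum_(k < n.+1) x k <= 2 * C * rt n.
  apply: sum_inv_sqrt => //; first by rewrite /x mul0r.
  by move=> k; rewrite ler_pdivlMr ?sqrtr_gt0 ?ltr0n // mulrC xC.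
pose y n k : R := if (2 * k < n)%N then rt n * x (n - k)%N else 0.
have ser_s : series s @ \oo --> E ^+ 2 by rewrite expr2; apply: cvg_series_conv => //; exact: renewal_series.
have T1 : (\sum_(k < n) s k * y n k) @[n --> \oo] --> E ^+ 2 * kap.
  apply: (tannery (C := 2 * C)) => //.
    move=> n k; rewrite /y; case: ifP => H; last by rewrite normr0 mulr_ge0.
    rewrite ger0_norm ?mulr_ge0 //.
    apply: (@le_trans _ _ (2 * rt (n - k) * x (n - k)%N)); last by rewrite -mulrA ler_wpM2l.
    rewrite ler_wpM2r //; apply: le_trans (rt_le (_ : n <= 4 * (n - k))%N) _; first lia.
    rewrite rtM (_ : rt 4 = 2) // /rt (_ : 4%:R = 2 ^+ 2 :> R); last by rewrite -natrX.
    by rewrite sqrtr_sqr ger0_norm.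
  move=> k; have : (rt n / rt (n - k)) * (w (n - k)%N * b (n - k)%N) @[n --> \oo] --> 1 * kap.
    apply: cvgM; first exact: cvg_sqrt_shift.
    exact: (@cvg_subn R k (fun m => w m * b m)).
  rewrite mul1r; apply: cvg_trans; apply: near_eq_cvg; near=> n.
  have nk : (2 * k < n)%N by near: n; exists (2 * k).+1.
  have r0 : rt (n - k) != 0 by rewrite gt_eqF // sqrtr_gt0 ltr0n subn_gt0; lia.
  by rewrite /y nk /w /x; field.
have T2 : (\sum_(k < n.+1) s k * (rt n * x (n - k)%N - y n k)) @[n --> \oo] --> (0:R).
  apply: (@squeeze_cvgr _ _ _ _ (fun=> 0) (fun n => 8 * A * C * (rt n)^-1)); last first.
  - have -> : 0 = 8 * A * C * 0 :> R by rewrite mulr0.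
    by apply: cvgMl_tmp; exact: cvg_sqrtV.
  - exact: cvg_cst.
  near=> n; have n0 : (0 < n)%N by near: n; exists 1%N.
  have n0' : 0 < n%:R :> R by rewrite ltr0n.
  have r0 : 0 < rt n by rewrite sqrtr_gt0.
  have d0 k : 0 <= rt n * x (n - k)%N - y n k.
    by rewrite /y; case: ifP => _; rewrite ?subrr // subr0 mulr_ge0.
  rewrite sumr_ge0 => [|i _]; last by rewrite mulr_ge0.
  apply: (@le_trans _ _ (\sum_(k < n.+1) 4 * A / n%:R * x (n - k)%N)).
    apply: ler_sum => k _; rewrite /y; case: ifP => H.
      by rewrite subrr mulr0 !mulr_ge0 ?invr_ge0.
    rewrite subr0 mulrA ler_wpM2r // ler_pdivlMr // -mulrA (mulrC (rt n)).
    rewrite -/(w n) mulrC.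
    have H' : (n <= 2 * k)%N by rewrite leqNgt H.
    apply: le_trans (ler_wpM2r (s_ge0 _) (w_le H')) _.
    by rewrite -mulrA (_ : 2%:R ^+ 2 = 4) ?ler_wpM2l // -natrX.
  rewrite -mulr_sumr (conv_ones_bound x).
  apply: (@le_trans _ _ (4 * A / n%:R * (2 * C * rt n))).
    by rewrite ler_wpM2l // !mulr_ge0 ?invr_ge0.
  rewrite -(rt2 n) expr2 le_eqVlt; apply/orP; left; apply/eqP; field.
  by rewrite gt_eqF.
rewrite mulrC -[X in _ --> X]addr0.
have -> : (fun n => w n * e n) = fun n => \sum_(k < n.+1) s k * y n k +
    \sum_(k < n.+1) s k * (rt n * x (n - k)%N - y n k).
  apply/funext => n; rewrite -big_split /= /w mulrAC (renewal_diff b00 ren) mulrC.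
  have -> : conv (conv e e) (fun k => k%:R * b k) n = \sum_(k < n.+1) s k * x (n - k)%N by [].
  by rewrite mulr_sumr; apply: eq_bigr => i _ /=; ring.
apply: cvgD T2; apply: cvg_trans T1; apply: near_eq_cvg; near=> n.
rewrite big_ord_recr /= (_ : y n n = 0) ?mulr0 ?addr0 // /y ifF //.
by apply/negbTE; rewrite -leqNgt; lia.
Unshelve. all: by end_near. Qed.

End SubcriticalRenewal.

(** * The coefficients of the inverse square root of 1 - z *)

Section CentralBinomial.
Variable R : realType.

(* The coefficients [binomial(2n, n) / 4 ^ n] of [(1 - z)^(-1/2)]. *)
Fixpoint invsqrt_coef (n : nat) : R :=
  if n is m.+1 then invsqrt_coef m * ((2 * m + 1)%:R / (2 * m + 2)%:R) else 1.

Local Notation c := invsqrt_coef.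

Lemma invsqrt_coef_gt0 n : 0 < c n.
Proof. by elim: n => //= n IH; rewrite mulr_gt0 // divr_gt0 // ltr0n; lia. Qed.

Lemma invsqrt_coef_le1 n : c n <= 1.
Proof.
elim: n => //= n IH; rewrite mulr_ile1 ?(ltW (invsqrt_coef_gt0 _)) ?divr_ge0 //.
by rewrite ler_pdivrMr ?ltr0n ?mul1r ?ler_nat; lia.
Qed.

Lemma invsqrt_coefS n : n.+1%:R * c n.+1 = (n%:R + 2^-1) * c n.
Proof.
rewrite [c _](_ : _ = c n * ((2 * n + 1)%:R / (2 * n + 2)%:R)) // (natrD _ (2 * n) 1) (natrD _ (2 * n) 2) natrM.
have -> : (2 * n%:R + 2%:R : R) = 2 * n.+1%:R by rewrite -natr1; ring.
have : n.+1%:R != 0 :> R by rewrite pnatr_eq0.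
by move: n.+1%:R => N N0; field.
Qed.

(** The recursion for [c] says that its generating function satisfies [2 (1 - z) F' = F]. Therefore
    [(1 - z) (F^2)' = F^2], so the coefficients of [F^2] are all equal. *)
Lemma conv_invsqrt n : conv c c n = 1.
Proof.
have dbl m : m%:R * conv c c m = 2 * conv (fun k => k%:R * c k) c m.
  by rewrite conv_natl (convC c) mulr2n mulrDl mul1r.
elim: n => [|n IH]; first by rewrite /conv big_ord1 /= mulr1.
apply: (@mulfI _ n.+1%:R); first by rewrite pnatr_eq0.
rewrite mulr1 dbl conv_recl mul0r mul0r add0r.
rewrite (@eq_convl _ _ (fun k => k%:R * c k + 2^-1 * c k)); last first.
  by move=> k _; rewrite -mulrDl invsqrt_coefS.
by rewrite convDl convZl mulrDr -dbl IH -natr1; field.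
Qed.

Lemma sum_invsqrt n : \sum_(k < n.+1) c k = (2 * n + 1)%:R * c n.
Proof.
elim: n => [|n IH]; first by rewrite big_ord1 muln0 mulr1.
rewrite big_ord_recr {}IH.
rewrite [c n.+1](_ : _ = c n * ((2 * n + 1)%:R / (2 * n + 2)%:R)) //.
have -> : (2 * n.+1 + 1)%:R = (2 * n + 2)%:R + 1 :> R by rewrite natr1; congr (_%:R); lia.
have : (2 * n + 2)%:R != 0 :> R by rewrite pnatr_eq0; lia.
have : (2 * n + 1)%:R = (2 * n + 2)%:R - 1 :> R.
  by rewrite (_ : (2 * n + 2 = (2 * n + 1).+1)%N) -?natr1 ?addrK //; lia.
by move: ((2 * n + 2)%:R) ((2 * n + 1)%:R) => N _ -> N0 /=; field.
Qed.

End CentralBinomial.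

(** * Critical renewal sequences *)

Section CriticalRenewal.
Variable R : realType.
Variables (b e : nat -> R) (kap g0 : R).
Hypotheses (b00 : b 0%N = 0) (b0 : forall k, 0 <= b k)
  (b1 : series b @ \oo --> (1:R)) (ren : forall n, e n = delta R n + conv b e n)
  (kap0 : 0 < kap) (g00 : 0 < g0).

Let c := invsqrt_coef R.
Let rt n : R := Num.sqrt n%:R.

(** The limit [g0] remains abstract here; its value [1 / sqrt pi] will come from the local limit
    theorem. *)
Hypotheses (bK : n%:R * rt n * b n @[n --> \oo] --> kap)
  (cg : rt n * c n @[n --> \oo] --> g0).

Let rt0 n : (0 < n)%N -> 0 < rt n. Proof. by move=> n0; rewrite sqrtr_gt0 ltr0n. Qed.
Let rt2 n : rt n ^+ 2 = n%:R. Proof. by rewrite sqr_sqrtr. Qed.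
Let e0 := renewal_ge0 b00 b0 ren.
Let c0 := @invsqrt_coef_gt0 R.
Let t n := 1 - series b n.+1.
Let s := conv e e.
Let U n := \sum_(k < n.+1) e k.

Let b_pos : exists K, forall k, (K <= k)%N -> 0 < b k.
Proof.
have /cvgrPdist_lt/(_ kap kap0) [K _ HK] := bK.
exists K.+1 => k Kk; have := HK k (ltnW Kk).
rewrite /= ltr_norml => /andP[_]; rewrite ltrBlDr ltrDl => h.
have k0 : 0 < k%:R * rt k by rewrite mulr_gt0 ?ltr0n ?rt0 //; exact: leq_trans Kk.
by rewrite pmulr_rgt0 in h.
Qed.

Let sb := series_le_lim b0 b1.

Let t_gt0 n : 0 < t n.
Proof.
have [K HK] := b_pos; rewrite subr_gt0; apply: lt_le_trans (sb (n.+1 + K).+1).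
rewrite -subr_gt0 sub_series_geq; last lia.
rewrite big_nat_recr /=; last lia.
by rewrite ltr_wpDl // ?sumr_ge0 // HK //; lia.
Qed.

Let cvg_tail : rt n * t n @[n --> \oo] --> 2 * kap.
Proof.
apply: cvg_sqrt_tail.
- rewrite -(subrr (1:R)); apply: cvgB; first exact: cvg_cst.
  by rewrite (cvg_shiftS (series b)).
have -> : (fun n => n.+1%:R * Num.sqrt n.+1%:R * (t n - t n.+1)) =
    (fun n => n.+1%:R * rt n.+1 * b n.+1).
  by apply/funext => n; rewrite /t -(seriesSB b n.+1); congr (_ * _); ring.
by rewrite (cvg_shiftS (fun n => n%:R * rt n * b n)).
Qed.

(** The tails decrease and are equivalent to [2 * kap / sqrt n], so [series t n >= n * t n]
    diverges: the mean is infinite. *)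
Let e_cvg0 : e @ \oo --> (0:R).
Proof.
have [K HK] := b_pos; apply: (renewal_cvg0 b00 b0 b1 HK ren) => //.
have tle : {homo t : i j / (i <= j)%N >-> j <= i}.
  move=> i j ij; rewrite lerD2l lerN2 -subr_ge0 sub_series_geq ?sumr_ge0 //.
have /cvgrPdist_le/(_ kap kap0) [N _ HN] := cvg_tail.
apply/cvgryPge => A; near=> n.
have Nn : (N <= n)%N by near: n; exists N.
have n0 : (0 < n)%N by near: n; exists 1%N.
have An : A / kap <= rt n.
  have : (A / kap) ^+ 2 <= n%:R.
    near: n; exists (Num.bound ((A / kap) ^+ 2)) => // m /= Hm.
    apply: ltW; apply: lt_le_trans (archi_boundP _) _; first exact: sqr_ge0.
    by rewrite ler_nat.
  by rewrite -(rt2 n) -ler_sqrt ?sqr_ge0 // !sqrtr_sqr (ger0_norm (ltW (rt0 n0))) => /(le_trans (ler_norm _)).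
have : `|2 * kap - rt n * t n| <= kap by exact: HN.
rewrite ler_norml => /andP[_ h].
apply: (@le_trans _ _ (n%:R * t n)).
  rewrite -(rt2 n) expr2 -mulrA; rewrite ler_pdivrMr // in An; apply: le_trans An _.
  by rewrite ler_wpM2l ?(ltW (rt0 n0)) //; lra.
rewrite /series/= mulr_natl -[X in _ *+ X](subn0 n) -sumr_const_nat !big_nat.
by apply: ler_sum => i /andP[_ /ltnW]; exact: tle.
Unshelve. all: by end_near. Qed.

Let lam := g0 / (2 * kap).
Let lam0 : 0 < lam. Proof. by rewrite divr_gt0 // mulr_gt0. Qed.

(** Comparison with [conv e t = 1], as [lam] is the limit of [c / t]. Here [e_cvg0] gives the
    negligibility that [conv_ratio] requires. *)
Let ec_cvg : conv e c @ \oo --> lam.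
Proof.
have te n : conv e t n = 1 by rewrite convC; exact: conv_tail.
have -> : conv e c = fun n => conv e (fun k => t k * (c k / t k)) n / conv e t n.
  apply/funext => n; rewrite te divr1; apply: eq_convr => k _.
  by rewrite mulrCA divff ?mulr1 // gt_eqF.
apply: conv_ratio => //.
- by move=> k; exact: ltW.
- have H : (rt n * c n) / (rt n * t n) @[n --> \oo] --> lam.
    by apply: cvgM => //; apply: cvgV => //; rewrite gt_eqF // mulr_gt0.
  apply: cvg_trans H; apply: near_eq_cvg; near=> n.
  have n0 : (0 < n)%N by near: n; exists 1%N.
  by field; rewrite !gt_eqF // rt0.
- by near=> n; rewrite te.
- move=> j; under eq_fun do rewrite te divr1.
  exact: cvg_subn.
Unshelve. all: by end_near. Qed.

Let cvg_natr_ratio : (2 * n + 1)%:R / n%:R @[n --> \oo] --> (2:R).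
Proof.
have H : (2 + n%:R^-1 : R) @[n --> \oo] --> (2 + 0 : R).
  apply: cvgD; first exact: cvg_cst.
  by rewrite -(cvg_shiftS (fun n => n%:R^-1 : R)); exact: cvg_harmonic.
rewrite addr0 in H; apply: cvg_trans H; apply: near_eq_cvg; near=> n.
have n0 : n%:R != 0 :> R by rewrite pnatr_eq0 -lt0n; near: n; exists 1%N.
by rewrite natrD natrM; field.
Unshelve. all: by end_near. Qed.

Let csum_cvg : (\sum_(k < n.+1) c k) / rt n @[n --> \oo] --> 2 * g0.
Proof.
have H : (2 * n + 1)%:R / n%:R * (rt n * c n) @[n --> \oo] --> 2 * g0 by exact: cvgM.
apply: cvg_trans H; apply: near_eq_cvg; near=> n.
have n0 : (0 < n)%N by near: n; exists 1%N.
by rewrite sum_invsqrt -/c -(rt2 n); field; rewrite gt_eqF // rt0.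
Unshelve. all: by end_near. Qed.

Let conv1_gt0 (u : nat -> R) n : 0 < u 0%N -> (forall k, 0 <= u k) -> 0 < \sum_(k < n.+1) u k.
Proof. by move=> u0 uk; rewrite big_ord_recl ltr_wpDr // sumr_ge0. Qed.

(** As [c * c = 1], the partial sums of [e] are [c * (e * c)], so they are equivalent to [lam] times
    those of [c]. *)
Let U_cvg : U n / rt n @[n --> \oo] --> 2 * g0 * lam.
Proof.
have H : conv c (fun k => 1 * conv e c k) n / conv c (fun=> 1) n @[n --> \oo] --> lam.
  apply: conv_ratio => //.
  - by move=> k; exact: ltW.
  - by near=> n; rewrite convC conv_ones conv1_gt0 // => k; exact: ltW.
  move=> j; apply: (@squeeze_cvgr _ _ _ _ (fun=> 0) (fun n => (rt n)^-1 / ((\sum_(k < n.+1) c k) / rt n))).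
  - near=> n; have n0 : (0 < n)%N by near: n; exists 1%N.
    have S0 : 0 < \sum_(k < n.+1) c k by rewrite conv1_gt0 // => k; exact: ltW.
    rewrite convC conv_ones; apply/andP; split; first by apply: divr_ge0; apply: ltW.
    rewrite [leRHS](_ : _ = 1 / \sum_(k < n.+1) c k); last first.
      by field; rewrite !gt_eqF // rt0.
    by rewrite ler_pM2r ?invr_gt0 // invsqrt_coef_le1.
  - exact: cvg_cst.
  - rewrite -[X in _ --> X](mul0r (2 * g0)^-1); apply: cvgM; first exact: cvg_sqrtV.
    by apply: cvgV => //; rewrite gt_eqF // mulr_gt0.
have -> : (fun n => U n / rt n) = (fun n => ((\sum_(k < n.+1) c k) / rt n) *
    (conv c (fun k => 1 * conv e c k) n / conv c (fun=> 1) n)).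
  apply/funext => n.
  have -> : conv c (fun k => 1 * conv e c k) n = U n.
    rewrite /U -conv_ones (eq_convr _ (fun k _ => mul1r _)) (eq_convr _ (fun k _ => convC _ _ k)).
    by rewrite convA; apply: eq_convl => k _; rewrite conv_invsqrt.
  rewrite (convC c) conv_ones [RHS]mulrC [RHS]mulrA divfK // gt_eqF // conv1_gt0 // => k; exact: ltW.
by apply: cvgM.
Unshelve. all: by end_near. Qed.

Let U_gt0 n : 0 < U n.
Proof. by rewrite conv1_gt0 // (renewal0 b00 ren). Qed.

(** By associativity [s * c = e * (e * c)], where [e * c] tends to [lam]. *)
Let sc_cvg : conv s c n / U n @[n --> \oo] --> lam.
Proof.
have H : conv e (fun k => 1 * conv e c k) n / conv e (fun=> 1) n @[n --> \oo] --> lam.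
  apply: conv_ratio => //.
  - by near=> n; rewrite convC conv_ones U_gt0.
  move=> j; apply: (@squeeze_cvgr _ _ _ _ (fun=> 0) (fun n => e (n - j)%N)).
  - near=> n; rewrite convC conv_ones divr_ge0 ?(ltW (U_gt0 _)) //= ler_pdivrMr ?U_gt0 //.
    rewrite ler_peMr // /U big_ord_recl (renewal0 b00 ren) lerDl sumr_ge0 //.
  - exact: cvg_cst.
  - exact: cvg_subn.
apply: cvg_trans H; apply: near_eq_cvg; near=> n.
rewrite (convC e (fun=> 1)) conv_ones; congr (_ / _).
by rewrite /s -convA; apply: eq_convr => k _; rewrite mul1r.
Unshelve. all: by end_near. Qed.

Let s_ge0 n : 0 <= s n. Proof. by apply: sumr_ge0 => i _; rewrite mulr_ge0. Qed.

(** One of two indices of sum [n] is at least [n / 2], where [e] is small; the other factor sums to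
    [U n]. *)
Let s_small : s n / U n @[n --> \oo] --> (0:R).
Proof.
apply/cvgrPdist_le => eps eps0.
have /cvgrPdist_le/(_ (eps / 2)) := e_cvg0; rewrite divr_gt0 // => /(_ isT) [N _ HN].
exists (2 * N)%N => // n /= Nn.
rewrite sub0r normrN ger0_norm ?divr_ge0 ?(ltW (U_gt0 _)) // ler_pdivrMr ?U_gt0 //.
have small m : (N <= m)%N -> e m <= eps / 2.
  by move=> Nm; have := HN m Nm; rewrite /= sub0r normrN ger0_norm.
apply: (@le_trans _ _ (\sum_(k < n.+1) (eps / 2 * e (n - k)%N + eps / 2 * e k))).
  apply: ler_sum => k _; case: (leqP N k) => Nk.
    by rewrite ler_wpDr ?mulr_ge0 ?divr_ge0 ?(ltW eps0) // ler_wpM2r // small.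
  rewrite ler_wpDl ?mulr_ge0 ?divr_ge0 ?(ltW eps0) // mulrC ler_wpM2r // small //.
  by have := ltn_ord k; lia.
rewrite big_split /= -!mulr_sumr -/(U n).
have -> : \sum_(k < n.+1) e (n - k)%N = U n.
  by rewrite /U -conv_ones /conv; apply: eq_bigr => i _; rewrite mul1r.
by rewrite -mulrDl -splitr.
Qed.

(** By [renewal_diff], [n * e n = (s * x) n] with [x k / c k] tending to [kap / g0]. Hence [n * e n]
    is equivalent to [kap / g0] times [s * c], thus to [kap / g0 * lam * U n], and [U n] is of order
    [sqrt n]. *)
Theorem critical_renewal : rt n * e n @[n --> \oo] --> g0 ^+ 2 / (2 * kap).
Proof.
pose x k : R := k%:R * b k.
have Usc : U n / conv s c n @[n --> \oo] --> lam^-1.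
  under eq_fun do rewrite -invf_div; by apply: cvgV => //; rewrite gt_eqF.
have sc0 n : 0 < conv s c n.
  have u0 : 0 < s 0%N by rewrite /s /conv big_ord1 (renewal0 b00 ren) mulr1.
  rewrite /conv big_ord_recl /= subn0 ltr_wpDr ?mulr_gt0 //.
  by apply: sumr_ge0 => i _; rewrite mulr_ge0 // ltW.
have H : conv s (fun k => c k * (x k / c k)) n / conv s c n @[n --> \oo] --> kap / g0.
  apply: conv_ratio => //.
  - by move=> k; exact: ltW.
  - have H : (n%:R * rt n * b n) / (rt n * c n) @[n --> \oo] --> kap / g0.
      by apply: cvgM => //; apply: cvgV => //; rewrite gt_eqF.
    apply: cvg_trans H; apply: near_eq_cvg; near=> n.
    have n0 : (0 < n)%N by near: n; exists 1%N.
    by rewrite /x; field; rewrite !gt_eqF // rt0.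
  - by near=> n.
  (* [s_small] is relative to [U (n - j)], which is at most [U n], and [U n] is comparable with
     [(s * c) n]. *)
  move=> j; apply: (@squeeze_cvgr _ _ _ _ (fun=> 0)
     (fun n => s (n - j)%N / U (n - j)%N * (U n / conv s c n))).
  - near=> n; rewrite divr_ge0 ?(ltW (sc0 _)) //= mulrA ler_pM2r ?invr_gt0 //.
    rewrite mulrAC ler_pdivlMr ?U_gt0 // ler_wpM2l // /U.
    rewrite -!(big_mkord xpredT e) (@big_cat_nat _ _ _ (n - j).+1 _ n.+1) //= ?ltnS ?leq_subr //.
    by rewrite lerDl sumr_ge0.
  - exact: cvg_cst.
  - rewrite -[X in _ --> X](mul0r lam^-1); apply: cvgM => //.
    exact: (@cvg_subn R j (fun m => s m / U m)).
have -> : g0 ^+ 2 / (2 * kap) = kap / g0 * (lam * (2 * g0 * lam)).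
  by rewrite /lam; field; rewrite !gt_eqF.
have H2 : conv s (fun k => c k * (x k / c k)) n / conv s c n *
   (conv s c n / U n * (U n / rt n)) @[n --> \oo] --> kap / g0 * (lam * (2 * g0 * lam)).
  by apply: cvgM => //; apply: cvgM.
apply: cvg_trans H2; apply: near_eq_cvg; near=> n.
have n0 : (0 < n)%N by near: n; exists 1%N.
have -> : conv s (fun k => c k * (x k / c k)) n = n%:R * e n.
  rewrite (renewal_diff b00 ren); apply: eq_convr => k _.
  by rewrite mulrCA divff ?mulr1 // gt_eqF.
rewrite -(rt2 n); field; rewrite (gt_eqF (rt0 n0)) (gt_eqF (U_gt0 n)) (gt_eqF (sc0 n)) //.
Unshelve. all: by end_near. Qed.

End CriticalRenewal.

(** * Taylor bounds for sine, cosine and exponential *)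

Section RealInequalities.
Variable R : realType.
Implicit Types x y t : R.

Lemma sin_le_id x : 0 <= x -> sin x <= x.
Proof.
rewrite le_eqVlt => /predU1P[<-|x0]; first by rewrite sin0.
have [c _] := @MVT R sin cos 0 x x0 (fun z _ => is_derive_sin z)
  (continuous_subspaceT (@continuous_sin R)).
rewrite sin0 !subr0 => ->; rewrite ler_piMl ?cos_le1 //; exact: ltW.
Qed.

Lemma abs_sin_le x : `|sin x| <= `|x|.
Proof.
wlog x0 : x / 0 <= x => [H|].
  by have [/H //|/ltW xle] := leP 0 x; rewrite -normrN -sinN -(normrN x) H // oppr_ge0.
rewrite (ger0_norm x0); case: (lerP x 1) => x1; last first.
  by rewrite (le_trans (sin_max _)) // ltW.
rewrite ger0_norm ?sin_le_id //; apply: sin_ge0_pi; rewrite x0 /=.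
by rewrite (le_trans x1) // (le_trans _ (pi_ge2 R)) // ler1n.
Qed.

Lemma cos_half x : 1 - cos x = 2 * sin (x / 2) ^+ 2.
Proof.
have -> : cos x = cos ((x / 2) *+ 2) by congr cos; rewrite -mulr_natr divfK.
by rewrite cos_mulr2n cos2sin2; ring.
Qed.

Lemma cos_ge x : 1 - cos x <= x ^+ 2 / 2.
Proof.
rewrite cos_half -(@real_normK _ (sin _)) ?num_real //.
have := abs_sin_le (x / 2); rewrite normrM (@ger0_norm _ 2^-1) // => h.
have : `|sin (x / 2)| ^+ 2 <= (`|x| / 2) ^+ 2 by rewrite lerXn2r // nnegrE ?divr_ge0.
by rewrite expr_div_n (@real_normK _ x) ?num_real //; lra.
Qed.

Lemma sin_taylor x : `|x - sin x| <= `|x| ^+ 3.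
Proof.
wlog x0 : x / 0 < x => [H|].
  have [/H //|xl|<-] := ltgtP 0 x; last by rewrite sin0 subr0 normr0 expr0n.
  have := H (- x); rewrite oppr_gt0 xl => /(_ isT).
  by rewrite sinN -opprD !normrN.
have d z : is_derive z (1:R) (id - sin) (1 - cos z) by exact: is_deriveB.
have cont : {within `[0, x], continuous (id - sin : R -> R)}.
  by apply: continuous_subspaceT => z; apply: continuousB => //; exact: continuous_sin.
have [c cx] := @MVT R _ _ 0 x x0 (fun z _ => d z) cont.
rewrite /= !fctE /= sin0 !subr0 => ->.
rewrite !normrM (gtr0_norm x0) exprS mulrC ler_wpM2l ?(ltW x0) //.
rewrite ger0_norm ?subr_ge0 ?cos_le1 // (le_trans (cos_ge c)) //.
move: cx; rewrite in_itv /= => /andP[c0 cx]; nra.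
Qed.

Lemma cos_taylor x : `|cos x - (1 - x ^+ 2 / 2)| <= `|x| ^+ 4.
Proof.
have -> : cos x - (1 - x ^+ 2 / 2) = 2 * ((x / 2 - sin (x / 2)) * (x / 2 + sin (x / 2))).
  by have := cos_half x; lra.
rewrite !normrM (@ger0_norm _ 2) //.
have h1 := sin_taylor (x / 2); have h2 : `|x / 2 + sin (x / 2)| <= 2 * `|x / 2|.
  by apply: le_trans (ler_normD _ _) _; have := abs_sin_le (x / 2); lra.
apply: (@le_trans _ _ (2 * (`|x / 2| ^+ 3 * (2 * `|x / 2|)))).
  by rewrite ler_wpM2l // ler_pM.
rewrite normrM (@ger0_norm _ 2^-1) //.
have -> : 2 * ((`|x| / 2) ^+ 3 * (2 * (`|x| / 2))) = `|x| ^+ 4 / 4 by field.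
by rewrite ler_pdivrMr // ler_peMr ?exprn_ge0 // ler1n.
Qed.

(** Only [expR y >= 1 + y] is used: it gives [expR (- y) <= 1 / (1 + y) <= 1 - y + y ^+ 2]. *)
Lemma expRN_taylor y : 0 <= y -> `|expR (- y) - (1 - y)| <= y ^+ 2.
Proof.
move=> y0; have h := expR_ge1Dx (- y); have h' := expR_ge1Dx y.
rewrite ger0_norm; last by lra.
have : expR (- y) * (1 + y) <= 1.
  have := expRxMexpNx_1 y; have := ler_wpM2r (expR_ge0 (- y)) h'; lra.
have := expR_ge0 (- y); nra.
Qed.

End RealInequalities.

(** * The local limit theorem *)

Section FourierIntegral.
Variable R : realType.
Local Notation mu := (@lebesgue_measure R).

Lemma integral_gauss (a : R) : 0 < a ->
  mu.-integrable setT (EFin \o (fun x => expR (- (a * x ^+ 2)))) /\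
  \int[mu]_x expR (- (a * x ^+ 2)) = Num.sqrt (pi / a).
Proof.
(* The standard deviation of the centred normal density proportional to the integrand. *)
move=> a0; pose s : R := (Num.sqrt (2 * a))^-1.
have sa0 : 0 < Num.sqrt (2 * a) by rewrite sqrtr_gt0 mulr_gt0.
have s0 : s != 0 by rewrite invr_neq0 // gt_eqF.
have s2 : s ^+ 2 = (2 * a)^-1 by rewrite exprVn sqr_sqrtr // mulr_ge0 // ltW.
have pk : normal_peak s = (Num.sqrt (pi / a))^-1.
  by rewrite /normal_peak s2; congr (Num.sqrt _)^-1; field; rewrite gt_eqF.
have g0 : 0 < Num.sqrt (pi / a) by rewrite sqrtr_gt0 divr_gt0 // pi_gt0.
have E : (fun x => expR (- (a * x ^+ 2))) = (fun x => Num.sqrt (pi / a) * normal_pdf 0 s x).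
  apply/funext => x; rewrite /normal_pdf (negbTE s0) /= pk [RHS]mulrA divff ?gt_eqF // mul1r.
  rewrite /normal_fun subr0 s2.
  by congr expR; field; rewrite gt_eqF.
have I := integrable_normal_pdf (0:R) s.
split.
  rewrite E (_ : EFin \o _ = (fun x => (Num.sqrt (pi / a))%:E * (normal_pdf 0 s x)%:E)%E) //.
  exact: integrableZl.
rewrite E RintegralZl //.
by rewrite /Rintegral integral_normal_pdf mulr1.
Qed.

Lemma sin_natrpi (n : nat) : sin (n%:R * pi) = 0 :> R.
Proof.
elim: n => [|n IH]; first by rewrite mul0r sin0.
by rewrite -natr1 mulrDl mul1r sinDpi IH oppr0.
Qed.

(** The primitive [F] is explicit. As [sin] vanishes at integer multiples of [pi], only its linear
    term, from [m = m0], contributes. *)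
Lemma fourier_coef (A : nat -> R) (D m0 : nat) : (m0 < D)%N ->
  \int[mu]_(t in `[-pi, pi]) (\sum_(m < D) A m * cos ((m%:R - m0%:R) * t)) = 2 * pi * A m0.
Proof.
move=> m0D; pose F t : R := \sum_(m < D) (if m == m0 :> nat then A m * t
   else A m * (sin ((m%:R - m0%:R) * t) / (m%:R - m0%:R))).
have pi0 := pi_gt0 R.
have dF t : is_derive t (1:R) F (\sum_(m < D) A m * cos ((m%:R - m0%:R) * t)).
  rewrite (_ : F = \sum_(m < D) (fun t => if m == m0 :> nat then A m * t
   else A m * (sin ((m%:R - m0%:R) * t) / (m%:R - m0%:R)))); last first.
    by apply/funext => u; rewrite fct_sumE.
  apply: is_derive_sum => m; case: eqP => [->|/eqP mm0].
    rewrite subrr mul0r cos0 (_ : (fun u => _) = A m0 \*: (id : R -> R)); last exact/funext.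
    by apply: is_derive_eq; rewrite /GRing.scale /= mulr1.
  have d0 : m%:R - m0%:R != 0 :> R by rewrite subr_eq0 eqr_nat.
  rewrite (_ : (fun u => _) = (A m / (m%:R - m0%:R)) \*: (sin \o ( *%R (m%:R - m0%:R)))); last first.
    by apply/funext => u /=; rewrite /GRing.scale /= mulrA mulrAC.
  apply: is_derive_eq.
  by rewrite /GRing.scale /=; field.
have cF t : {for t, continuous F} by apply: differentiable_continuous; apply/derivable1_diffP; apply: ex_derive.
have cf : continuous (fun t : R => \sum_(m < D) A m * cos ((m%:R - m0%:R) * t)).
  move=> t; apply: (@cvg_sumr R _ _ _ D (fun m u => A m * cos ((m%:R - m0%:R) * u))
    (fun m => A m * cos ((m%:R - m0%:R) * t))) => m.
  apply: cvgMl_tmp; apply: continuous_comp; last exact: continuous_cos.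
  exact: cvgMl_tmp.
have sk m : sin ((m%:R - m0%:R) * pi) = 0 :> R.
  by rewrite mulrBl sinB !sin_natrpi mul0r mulr0 subr0.
have HF : F pi - F (- pi) = 2 * pi * A m0.
  rewrite /F -sumrB (bigD1 (Ordinal m0D)) //= eqxx big1 => [|m mm0]; first by ring.
  by rewrite !ifN // mulrN sinN sk oppr0 mul0r mulr0 subr0.
rewrite /Rintegral (@continuous_FTC2 _ _ F) //=.
- by rewrite gtrN.
- exact: continuous_subspaceT.
- split.
  + by move=> t _; apply: ex_derive.
  + by apply: cvg_at_right_filter; exact: cF.
  + by apply: cvg_at_left_filter; exact: cF.
- by move=> t _; rewrite derive1E; apply: derive_val.
Qed.

(** Outside [[-pi, pi]] only the Gaussian remains. Because [b >= 2 * a], half of its exponent yields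
    the factor [expR (- (a * pi ^+ 2))] and the other half is integrated. *)
Lemma gauss_compare (f : R -> R) (a b H : R) : continuous f -> 0 < a -> 2 * a <= b ->
  (forall t, - pi <= t <= pi -> `|f t - expR (- (b * t ^+ 2))| <= H * expR (- (a * t ^+ 2))) ->
  0 <= H ->
  `| \int[mu]_(t in `[-pi, pi]) f t - Num.sqrt (pi / b)| <=
    (H + expR (- (a * pi ^+ 2))) * Num.sqrt (pi / a).
Proof.
move=> cf a0 ab fH H0; have b0 : 0 < b by lra.
have [Ia Ea] := integral_gauss a0; have [Ib Eb] := integral_gauss b0.
have mD : measurable (`[(-pi)%R, pi] : set R) by exact: measurable_itv.
have If : mu.-integrable `[-pi, pi] (EFin \o f).
  by apply: continuous_compact_integrable; [exact: segment_compact | exact: continuous_subspaceT].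
have If' : mu.-integrable setT (EFin \o (f \_ `[-pi, pi])).
  rewrite -restrict_EFin; exact (proj1 (@integrable_mkcond _ _ _ mu _ (EFin \o f) mD) If).
rewrite Rintegral_mkcond -Eb -RintegralB //.
pose fD := f \_ `[-pi, pi]; pose gb t := expR (- (b * t ^+ 2)).
have Ifb : mu.-integrable setT (EFin \o (fun t => fD t - gb t)).
  rewrite (_ : _ \o _ = ((EFin \o fD) \- (EFin \o gb))%E) //.
  exact: integrableB.
apply: le_trans (le_normr_Rintegral _ Ifb) _ => //.
rewrite -Ea -RintegralZl //; apply: le_Rintegral => //.
- exact: integrable_norm Ifb.
- pose c := H + expR (- (a * pi ^+ 2)); pose ga x := expR (- (a * x ^+ 2)).
  rewrite (_ : _ \o _ = (fun x => c%:E * (ga x)%:E)%E) //.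
  exact: integrableZl.
move=> t _; rewrite /= /fD /patch; case: ifPn => [|/negP tD].
  rewrite inE /= in_itv /= => /fH /le_trans; apply.
  by rewrite ler_wpM2r ?expR_ge0 // lerDl expR_ge0.
rewrite sub0r normrN ger0_norm ?expR_ge0 // mulrDl ler_wpDl ?mulr_ge0 ?expR_ge0 //.
rewrite -expRD ler_expR -opprD lerN2.
have t2 : pi ^+ 2 <= t ^+ 2.
  rewrite -[t ^+ 2]real_normK ?num_real // lerXn2r ?nnegrE ?pi_ge0 //.
  rewrite leNgt; apply/negP => /ltW; rewrite ler_norml => h; apply: tD.
  by rewrite inE /= in_itv.
by have := ler_wpM2l (ltW a0) t2; have := sqr_ge0 t; nra.
Qed.

End FourierIntegral.

(** * The complex exponential on the imaginary axis *)

Section ComplexExponential.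
Variable R : realType.
Implicit Types (z : R[i]) (x t : R).
Local Open Scope complex_scope.

Local Notation nm := (@Normc.normc R).
Local Notation Re := (@complex.Re R).

Definition expi t : R[i] := cos t +i* sin t.

Lemma expi0 : expi 0 = 1.
Proof. by rewrite /expi cos0 sin0. Qed.

Lemma expiD x t : expi (x + t) = expi x * expi t.
Proof. by apply/eqP; rewrite eq_complex /= cosD sinD addrC eqxx /= addrC (mulrC (cos x)) eqxx. Qed.

Lemma expiM (n : nat) t : expi (n%:R * t) = expi t ^+ n.
Proof.
elim: n => [|n IH]; first by rewrite mul0r expi0 expr0.
by rewrite -natr1 mulrDl mul1r expiD IH exprSr.
Qed.

Lemma normc_expi t : nm (expi t) = 1.
Proof. by rewrite /= cos2Dsin2 sqrtr1. Qed.

Lemma normcX z n : nm (z ^+ n) = nm z ^+ n.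
Proof.
by elim: n => [|n IH]; rewrite ?expr0 ?Normc.normc1 // !exprS Normc.normcM IH.
Qed.

Lemma normc_real x : nm x%:C = `|x|.
Proof. by rewrite /= expr0n addr0 sqrtr_sqr. Qed.

Lemma normc_ge0 z : 0 <= nm z.
Proof. by case: z => a b /=; exact: sqrtr_ge0. Qed.

Lemma Re_le_normc z : `|Re z| <= nm z.
Proof. by rewrite -lecR; have := normc_ge_Re z; rewrite normc_def; case: z. Qed.

Lemma normc_le (a b : R) : nm (a +i* b) <= `|a| + `|b|.
Proof.
rewrite /= -[leRHS]ger0_norm ?addr_ge0 // -sqrtr_sqr ler_sqrt ?sqr_ge0 //.
rewrite sqrrD !real_normK ?num_real //.
by have : 0 <= `|a| * `|b| by [rewrite mulr_ge0]; lra.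
Qed.

Lemma normc_sum (I : Type) (s : seq I) (F : I -> R[i]) :
  nm (\sum_(i <- s) F i) <= \sum_(i <- s) nm (F i).
Proof.
elim: s => [|i s IH]; first by rewrite !big_nil Normc.normc0.
by rewrite !big_cons; apply: le_trans (le_normcD _ _) _; rewrite lerD2l.
Qed.

Lemma normc_subX (z w : R[i]) (M : R) n : nm z <= M -> nm w <= M ->
  nm (z ^+ n - w ^+ n) <= n%:R * M ^+ n.-1 * nm (z - w).
Proof.
move=> zM wM; have M0 : 0 <= M by apply: le_trans zM; exact: normc_ge0.
elim: n => [|n IH]; first by rewrite !expr0 subrr Normc.normc0 !mul0r.
have -> : z ^+ n.+1 - w ^+ n.+1 = z ^+ n * (z - w) + (z ^+ n - w ^+ n) * w.
  by rewrite !exprS; ring.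
apply: le_trans (le_normcD _ _) _; rewrite !Normc.normcM normcX -natr1 mulrDl mulrDl mul1r addrC.
apply: lerD; last first.
  by rewrite ler_wpM2r ?normc_ge0 // lerXn2r // nnegrE ?normc_ge0.
case: n IH => [|n] IH; first by rewrite !expr0 subrr Normc.normc0 !mul0r.
apply: (@le_trans _ _ (n.+1%:R * M ^+ n * nm (z - w) * M)).
  by apply: ler_pM; rewrite ?normc_ge0.
by rewrite /= exprSr mulrAC mulrA.
Qed.

Lemma expi_taylor x : nm (expi x - ((1 - x ^+ 2 / 2) +i* x)) <= `|x| ^+ 4 + `|x| ^+ 3.
Proof.
have -> : expi x - ((1 - x ^+ 2 / 2) +i* x) = ((cos x - (1 - x ^+ 2 / 2)) +i* (sin x - x)) by [].
apply: le_trans (normc_le _ _) (lerD (cos_taylor _) _).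
by rewrite distrC; exact: sin_taylor.
Qed.

Lemma expi_eq1 t : 0 < t <= pi -> expi t != 1.
Proof.
move=> /andP[t0 tpi]; apply/negP => /eqP [c1 _].
have : t = 0 :> R; last by move=> h; rewrite h ltxx in t0.
apply: cos_inj; rewrite ?cos0 //; rewrite in_itv /= ?lexx ?pi_ge0 ?(ltW t0) //.
Qed.

End ComplexExponential.

(** * The local limit theorem for a centred aperiodic law *)

Section LocalLimit.
Variables (R : realType) (r : nat -> R) (D : nat) (s2 : R).
Local Open Scope complex_scope.

Local Notation nm := (@Normc.normc R).
Local Notation Re := (@complex.Re R).
Local Notation mu := (@lebesgue_measure R).

Hypotheses (r0 : forall j, 0 <= r j) (r00 : 0 < r 0%N)
  (rsum : \sum_(j < D) r j = 1) (rmean : \sum_(j < D) r j * (j%:R - 1) = 0)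
  (rvar : \sum_(j < D) r j * (j%:R - 1) ^+ 2 = s2) (s20 : 0 < s2)
  (raper : forall q, (1 < q)%N -> exists2 j, (j < D)%N & (r j != 0) && ~~ (q %| j)%N).

(** The characteristic function of a step that equals [j - 1] with probability [r j]. *)
Definition chi (t : R) : R[i] := \sum_(j < D) (r j)%:C * expi ((j%:R - 1) * t).

Let Q := \poly_(j < D) r j.

Lemma D_gt0 : (0 < D)%N.
Proof. by case: D rsum => // /eqP; rewrite big_ord0 eq_sym oner_eq0. Qed.

Lemma chi_horner t : chi t = (map_poly (real_complex R) Q).[expi t] * expi (- t).
Proof.
rewrite (@horner_coef_wide _ D); last by rewrite size_map_poly size_poly.
rewrite mulr_suml; apply: eq_bigr => j _.
rewrite coef_map coef_poly ltn_ord -mulrA -expiM -expiD; congr (_ * expi _); ring.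
Qed.

(** The coefficient of index [n - k] of [Q ^+ n] is the probability that [n] steps add up to [- k].
    The factor [expi (k%:R * t)] brings it to frequency 0. *)
Lemma Re_chiX n k t N : (k <= n)%N -> (size (Q ^+ n) <= N)%N ->
  Re (chi t ^+ n * expi (k%:R * t)) =
  \sum_(m < N) (Q ^+ n)`_m * cos ((m%:R - (n - k)%:R) * t).
Proof.
move=> kn sN; rewrite chi_horner exprMn -horner_exp -rmorphXn.
rewrite (@horner_coef_wide _ N); last by rewrite size_map_poly.
rewrite -expiM -mulrA -expiD mulr_suml raddf_sum; apply: eq_bigr => j _.
rewrite coef_map -mulrA -expiM -expiD natrB //=.
by rewrite mul0r subr0; congr (_ * cos _); ring.
Qed.

(** Mean 0 and variance [s2] make both expansions agree up to order 2; on [[-pi, pi]] the quartic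
    errors are absorbed in the cubic one. *)
Lemma chi_taylor : exists2 C, 0 <= C &
  forall t, `|t| <= pi -> nm (chi t - (expR (- (s2 / 2 * t ^+ 2)))%:C) <= C * `|t| ^+ 3.
Proof.
pose C1 := \sum_(j < D) r j * (`|j%:R - 1| ^+ 4 * pi + `|j%:R - 1| ^+ 3).
exists (C1 + (s2 / 2) ^+ 2 * pi).
  apply: addr_ge0; last by rewrite mulr_ge0 ?sqr_ge0 ?pi_ge0.
  apply: sumr_ge0 => j _.
  by rewrite mulr_ge0 // addr_ge0 ?mulr_ge0 ?exprn_ge0 ?pi_ge0.
move=> t tpi.
have E : chi t - (expR (- (s2 / 2 * t ^+ 2)))%:C =
   \sum_(j < D) (r j)%:C * (expi ((j%:R - 1) * t) -
      ((1 - ((j%:R - 1) * t) ^+ 2 / 2) +i* ((j%:R - 1) * t))) +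
   ((1 - s2 / 2 * t ^+ 2) - expR (- (s2 / 2 * t ^+ 2)))%:C.
  under eq_bigr do rewrite mulrBr.
  rewrite sumrB -/(chi t) -addrA; congr (_ + _).
  have -> : \sum_(j < D) (r j)%:C * ((1 - ((j%:R - 1) * t) ^+ 2 / 2) +i* ((j%:R - 1) * t)) =
      (1 - s2 / 2 * t ^+ 2)%:C.
    apply/eqP; rewrite eq_complex !raddf_sum /=; apply/andP; split; apply/eqP.
      transitivity (\sum_(j < D) r j - (\sum_(j < D) r j * (j%:R - 1) ^+ 2) / 2 * t ^+ 2); last first.
        by rewrite rsum rvar.
      rewrite !mulr_suml -sumrB; apply: eq_bigr => j _ /=.
      by field.
    transitivity ((\sum_(j < D) r j * (j%:R - 1)) * t); last by rewrite rmean mul0r.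
    by rewrite mulr_suml; apply: eq_bigr => j _ /=; ring.
  move: (1 - s2 / 2 * t ^+ 2) (expR _) => x y.
  by apply/eqP; rewrite eq_complex /=; apply/andP; split; apply/eqP; ring.
rewrite E; apply: le_trans (le_normcD _ _) _; rewrite mulrDl; apply: lerD.
  apply: le_trans (normc_sum _ _) _; rewrite mulr_suml; apply: ler_sum => j _.
  rewrite Normc.normcM normc_real (ger0_norm (r0 _)) -[leRHS]mulrA ler_wpM2l //.
  apply: le_trans (expi_taylor _) _; rewrite normrM !exprMn mulrDl lerD2r.
  by rewrite -[leRHS]mulrA ler_wpM2l ?exprn_ge0 // (exprS `|t|) ler_wpM2r ?exprn_ge0.
rewrite normc_real distrC; have y0 : 0 <= s2 / 2 * t ^+ 2.
  by rewrite mulr_ge0 ?sqr_ge0 // divr_ge0 // ltW.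
apply: le_trans (expRN_taylor y0) _; rewrite exprMn -[leRHS]mulrA ler_wpM2l ?sqr_ge0 //.
have -> : (t ^+ 2) ^+ 2 = `|t| * `|t| ^+ 3.
  by rewrite -exprS -(@real_normK _ t) ?num_real // -exprM.
by rewrite ler_wpM2r ?exprn_ge0.
Qed.

(** Equality in the triangle inequality gives all terms of positive weight the same phase as the
    term [j = 0], so [expi t ^+ j = 1] on the support of [r]. The order of [expi t] then divides the
    support, hence is 1 by aperiodicity, which is impossible for such [t]. *)
Lemma chi_lt1 t : 0 < t <= pi -> nm (chi t) < 1.
Proof.
move=> tpi.
have nF (j : 'I_D) : nm ((r j)%:C * expi ((j%:R - 1) * t)) = r j.
  by rewrite Normc.normcM normc_expi normc_real mulr1 ger0_norm.
have le1 : nm (chi t) <= 1.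
  by apply: le_trans (normc_sum _ _) _; rewrite (eq_bigr _ (fun j _ => nF j)) rsum.
rewrite lt_neqAle le1 andbT; apply/negP => /eqP h1.
have nC (z : R[i]) : `|z| = (nm z)%:C by rewrite normc_def; case: z.
have : `|chi t| = \sum_(j < D) `|(r j)%:C * expi ((j%:R - 1) * t)|.
  by rewrite nC h1 -[in LHS]rsum rmorph_sum; apply: eq_bigr => j _; rewrite nC nF.
move=> /normC_sum_eq [u _ Hu].
have rj (j : 'I_D) : r j != 0 -> expi ((j%:R - 1) * t) = u.
  move=> rj0; have := Hu j isT; rewrite nC nF; apply: mulfI.
  by apply: contra rj0 => /eqP [->].
have E0 : expi (- t) = u.
  by have := rj (Ordinal D_gt0) (lt0r_neq0 r00); rewrite sub0r mulN1r.
have Ej j : (j < D)%N -> r j != 0 -> expi t ^+ j = 1.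
  move=> jD rj0; have := rj (Ordinal jD) rj0; rewrite -E0 /= => h.
  rewrite -expiM (_ : j%:R * t = (j%:R - 1) * t + t); last by ring.
  by rewrite expiD h -expiD addNr expi0.
(* Aperiodicity at [q = 2] provides a nonzero element of the support, so [expi t] has finite
   order. *)
have [j jD /andP[rj0 j2]] := raper (leqnn 2).
have j0 : (0 < j)%N by case: j j2 {jD rj0}.
have [q pq _] := prim_order_exists j0 (Ej j jD rj0).
case: (ltnP 1 q) => q1.
  have [k kD /andP[rk0]] := raper q1.
  by rewrite (prim_order_dvd pq) Ej // eqxx.
have := expi_eq1 tpi; have := prim_expr_order pq; have := prim_order_gt0 pq.
by case: q pq q1 => [|[|]] // _ _ _; rewrite expr1 => ->; rewrite eqxx.
Qed.

Lemma nm_sqr t : nm (chi t) ^+ 2 =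
  (\sum_(j < D) r j * cos ((j%:R - 1) * t)) ^+ 2 + (\sum_(j < D) r j * sin ((j%:R - 1) * t)) ^+ 2.
Proof.
have -> : chi t = (\sum_(j < D) r j * cos ((j%:R - 1) * t)) +i* (\sum_(j < D) r j * sin ((j%:R - 1) * t)).
  apply/eqP; rewrite eq_complex !raddf_sum /=; apply/andP; split; apply/eqP; apply: eq_bigr => j _ /=.
    by rewrite mul0r subr0.
  by rewrite mul0r addr0.
by rewrite sqr_sqrtr // addr_ge0 ?sqr_ge0.
Qed.

Lemma nm_chiN t : nm (chi (- t)) = nm (chi t).
Proof.
apply: (@pexpIrn _ 2) => //; rewrite ?nnegrE ?normc_ge0 // !nm_sqr; congr (_ + _).
  by under eq_bigr do rewrite mulrN cosN.
by under eq_bigr do rewrite mulrN sinN mulrN; rewrite sumrN sqrrN.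
Qed.

Lemma continuous_trig_sum (A b : nat -> R) N (f : R -> R) : continuous f ->
  continuous (fun t : R => \sum_(m < N) A m * f (b m * t)).
Proof.
move=> cf t; apply: (@cvg_sumr R _ _ _ N (fun m u => A m * f (b m * u)) (fun m => A m * f (b m * t))) => m.
apply: cvgMl_tmp; apply: continuous_comp; last exact: cf.
exact: cvgMl_tmp.
Qed.

(** Near 0 the Taylor bound gives the exponent [s2 / 4]. Away from 0, compactness and [chi_lt1]
    bound the modulus by some [M < 1]. *)
Lemma chi_gauss : exists2 c, 0 < c <= s2 / 4 &
  forall t, `|t| <= pi -> nm (chi t) <= expR (- (c * t ^+ 2)).
Proof.
have [C C0 HC] := chi_taylor; have pi0 := pi_gt0 R.
pose d := Num.min 1 (Num.min (s2^-1) (s2 / 8 / (C + 1 + s2 ^+ 2))).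
have K0 : 0 < C + 1 + s2 ^+ 2 by rewrite ltr_wpDr ?sqr_ge0 // ltr_wpDl.
have d0 : 0 < d by rewrite !lt_min ltr01 invr_gt0 s20 !divr_gt0.
have near0 t : 0 <= t <= d -> t <= pi -> nm (chi t) <= expR (- (s2 / 4 * t ^+ 2)).
  move=> /andP[t0 td] tpi.
  have := HC t; rewrite ger0_norm // => /(_ tpi) h.
  have h2 : nm (chi t) <= C * t ^+ 3 + expR (- (s2 / 2 * t ^+ 2)).
    have -> : chi t = (chi t - (expR (- (s2 / 2 * t ^+ 2)))%:C) + (expR (- (s2 / 2 * t ^+ 2)))%:C.
      by rewrite subrK.
    apply: le_trans (le_normcD _ _) _; rewrite normc_real (ger0_norm (expR_ge0 _)).
    by rewrite lerD2r.
  have y0 : 0 <= s2 / 2 * t ^+ 2 by rewrite mulr_ge0 ?sqr_ge0 // divr_ge0 // ltW.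
  have := expRN_taylor y0; rewrite ler_distl => /andP[_ h3].
  have h4 := expR_ge1Dx (- (s2 / 4 * t ^+ 2)).
  have t1 : t <= 1 by apply: le_trans td _; rewrite ge_min lexx.
  have t2 : t * (C + 1 + s2 ^+ 2) <= s2 / 8.
    by rewrite -ler_pdivlMr //; apply: le_trans td _; rewrite !ge_min lexx !orbT.
  have t3 : t ^+ 2 * (t * (C + 1 + s2 ^+ 2)) <= t ^+ 2 * (s2 / 8) by rewrite ler_wpM2l ?sqr_ge0.
  have t4 : (s2 / 2 * t ^+ 2) ^+ 2 <= t ^+ 2 * (t * s2 ^+ 2).
    rewrite exprMn; have : 0 <= s2 ^+ 2 * t ^+ 3 by rewrite mulr_ge0 ?sqr_ge0 ?exprn_ge0.
    have : s2 ^+ 2 * t ^+ 3 * t <= s2 ^+ 2 * t ^+ 3 * 1.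
      by rewrite ler_wpM2l // mulr_ge0 ?sqr_ge0 ?exprn_ge0.
    nra.
  have t5 : C * t ^+ 3 = t ^+ 2 * (t * C) by ring.
  have t6 : 0 <= t ^+ 2 * t by rewrite mulr_ge0 ?sqr_ge0.
  have t7 : 0 <= t ^+ 2 * s2 by rewrite mulr_ge0 ?sqr_ge0 ?ltW.
  have t8 : t ^+ 2 * (t * (C + 1 + s2 ^+ 2)) = t ^+ 2 * (t * C) + t ^+ 2 * t + t ^+ 2 * (t * s2 ^+ 2) by ring.
  lra.
have [M M1 HM] : exists2 M, M < 1 & forall t, d <= t <= pi -> nm (chi t) <= M.
  have [dpi|] := leP d pi; last first.
    move=> pid; exists 0 => // t /andP[dt tpi].
    by have := lt_le_trans pid (le_trans dt tpi); rewrite ltxx.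
  have cont : continuous (fun t => nm (chi t) ^+ 2).
    rewrite (_ : (fun t => _) = (fun t => (\sum_(j < D) r j * cos ((j%:R - 1) * t)) ^+ 2 +
       (\sum_(j < D) r j * sin ((j%:R - 1) * t)) ^+ 2)); last by apply/funext => t; exact: nm_sqr.
    have cc := @continuous_trig_sum r (fun j => j%:R - 1) D _ (@continuous_cos R).
    have cs := @continuous_trig_sum r (fun j => j%:R - 1) D _ (@continuous_sin R).
    move=> t; apply: cvgD.
      exact: (continuous_comp (cc t) (@exprn_continuous R 2 _)).
    exact: (continuous_comp (cs t) (@exprn_continuous R 2 _)).
  have [t0] := EVT_max dpi (continuous_subspaceT cont).
  rewrite in_itv /= => /andP[dt0 t0pi] Hmax; exists (nm (chi t0)).
    by apply: chi_lt1; rewrite t0pi (lt_le_trans d0).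
  move=> t dt; rewrite -(@ler_pXn2r _ 2) // ?nnegrE ?normc_ge0 //.
  by apply: Hmax; rewrite in_itv.
(* The second term ensures [M <= 1 - c * t ^+ 2 <= expR (- (c * t ^+ 2))] up to [t = pi]. *)
pose c := Num.min (s2 / 4) ((1 - M) / pi ^+ 2).
have c0 : 0 < c by rewrite lt_min !divr_gt0 // ?exprn_gt0 // subr_gt0.
exists c; first by rewrite c0 ge_min lexx.
move=> t; wlog t0 : t / 0 <= t => [H|].
  have [/H //|tl] := leP 0 t; have := H (- t); rewrite normrN nm_chiN sqrrN; apply.
  by rewrite oppr_ge0 ltW.
rewrite ger0_norm // => tpi.
have [td|dt] := leP t d.
  apply: le_trans (near0 t _ tpi) _; first by rewrite t0 td.
  by rewrite ler_expR lerN2 ler_wpM2r ?sqr_ge0 // ge_min lexx.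
apply: le_trans (HM t _) _; first by rewrite (ltW dt) tpi.
apply: le_trans (expR_ge1Dx _).
have : c * t ^+ 2 <= (1 - M) / pi ^+ 2 * pi ^+ 2.
  apply: ler_pM; rewrite ?sqr_ge0 ?(ltW c0) //; first by rewrite ge_min lexx orbT.
  by rewrite lerXn2r // nnegrE // ltW.
by rewrite divfK ?gt_eqF ?exprn_gt0 //; lra.
Qed.

Let expi_sub1 (x : R) : nm (expi x - 1) <= `|x| * (1 + `|x|).
Proof.
have -> : expi x - 1 = ((cos x - 1) +i* sin x).
  by apply/eqP; rewrite eq_complex /= subr0 !eqxx.
apply: le_trans (normc_le _ _) _; rewrite addrC mulrDr mulr1.
apply: lerD; first exact: abs_sin_le.
rewrite distrC ger0_norm ?subr_ge0 ?cos_le1 //; apply: le_trans (cos_ge x) _.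
by rewrite -expr2 real_normK ?num_real // ler_pdivrMr // ler_peMr ?sqr_ge0 // ler1n.
Qed.

Let pow_exp_bound (a y : R) : 0 < a -> 0 <= y ->
  y <= (1 + a^-1) * expR (a * y ^+ 2) /\ y ^+ 3 <= (a^-1 + 2 / a ^+ 2) * expR (a * y ^+ 2).
Proof.
move=> a0 y0; have ay0 : 0 <= a * y ^+ 2 by rewrite mulr_ge0 ?sqr_ge0 // ltW.
have e1 := expR_ge1Dx (a * y ^+ 2); have e2 := @expR_ge1Dxn R _ 1 ay0.
have ai0 : 0 < a^-1 by rewrite invr_gt0.
set E := expR _ in e1 e2 *.
have y2 : y ^+ 2 <= a^-1 * E.
  by rewrite mulrC ler_pdivlMr // mulrC; lra.
have y4 : y ^+ 4 <= 2 / a ^+ 2 * E.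
  rewrite mulrAC ler_pdivlMr ?exprn_gt0 //.
  have -> : y ^+ 4 * a ^+ 2 = (a * y ^+ 2) ^+ 2 by ring.
  by move: e2; rewrite (_ : 2`! = 2)%N //; lra.
split; first by nra.
rewrite mulrDl; apply: le_trans (lerD y2 y4); have -> : y ^+ 3 = y ^+ 2 * y by ring.
have -> : y ^+ 2 + y ^+ 4 = y ^+ 2 * (1 + y ^+ 2) by ring.
by rewrite ler_wpM2l ?sqr_ge0 //; nra.
Qed.

(** With [y = sqrt n * |t|], the errors [|t|] and [n * |t| ^+ 3] are [y / sqrt n] and
    [y ^+ 3 / sqrt n]. Half of the exponent [c] absorbs these powers of [y], and the other half [a]
    remains. *)
Let chiX_gauss (k : nat) : exists a H : R, [/\ 0 < a, 2 * a <= s2 / 2, 0 <= H &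
  forall n t, (0 < n)%N -> `|t| <= pi ->
  `|Re (chi t ^+ n * expi (k%:R * t)) - expR (- (n%:R * (s2 / 2) * t ^+ 2))| <=
  H / Num.sqrt n%:R * expR (- (n%:R * a * t ^+ 2))].
Proof.
have [c /andP[c0 cs] Hc] := chi_gauss; have [C C0 HC] := chi_taylor.
pose a := c / 2; have a0 : 0 < a by rewrite divr_gt0.
have ai0 : 0 < a^-1 by rewrite invr_gt0.
pose K1 : R := k%:R * (1 + k%:R * pi); pose K3 := C * expR (c * pi ^+ 2).
have K10 : 0 <= K1 by rewrite mulr_ge0 // addr_ge0 // mulr_ge0 // pi_ge0.
have K30 : 0 <= K3 by rewrite mulr_ge0 // expR_ge0.
exists a, (K1 * (1 + a^-1) + K3 * (a^-1 + 2 / a ^+ 2)); split => //.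
- by rewrite /a; lra.
- by apply: addr_ge0; apply: mulr_ge0 => //; apply: addr_ge0; rewrite ?divr_ge0 ?exprn_ge0 // ltW.
move=> n t n0 tpi; set g := expR (- (s2 / 2 * t ^+ 2)); set M := expR (- (c * t ^+ 2)).
have gn : expR (- (n%:R * (s2 / 2) * t ^+ 2)) = g ^+ n.
  by rewrite /g -expRM_natl; congr expR; ring.
have Mn : M ^+ n = expR (- (n%:R * c * t ^+ 2)).
  by rewrite /M -expRM_natl; congr expR; ring.
have gM : nm g%:C <= M.
  by rewrite normc_real ger0_norm ?expR_ge0 // ler_expR lerN2 ler_wpM2r ?sqr_ge0 //; lra.
have M0 : 0 <= M := expR_ge0 _.
have cM : nm (chi t) <= M by exact: Hc.
have A1 : nm (chi t ^+ n * expi (k%:R * t) - (g ^+ n)%:C) <=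
     M ^+ n * (K1 * `|t|) + n%:R * M ^+ n.-1 * (C * `|t| ^+ 3).
  have -> : chi t ^+ n * expi (k%:R * t) - (g ^+ n)%:C =
     chi t ^+ n * (expi (k%:R * t) - 1) + (chi t ^+ n - g%:C ^+ n).
    by rewrite rmorphXn /=; ring.
  apply: le_trans (le_normcD _ _) _; apply: lerD.
    rewrite Normc.normcM normcX; apply: ler_pM; rewrite ?exprn_ge0 ?normc_ge0 //.
      by rewrite lerXn2r ?nnegrE ?normc_ge0.
    apply: le_trans (expi_sub1 _) _; rewrite normrM (ger0_norm (ler0n _ _)) /K1 -!mulrA.
    by rewrite ler_wpM2l // mulrC ler_wpM2r // lerD2l ler_wpM2l.
  apply: le_trans (normc_subX n cM gM) _; rewrite ler_wpM2l ?mulr_ge0 ?exprn_ge0 //.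
  exact: HC.
(* The factor missing from the difference of two powers costs only a constant, since [M] is bounded
   below on [[-pi, pi]]. *)
have A2 : M ^+ n.-1 <= expR (c * pi ^+ 2) * M ^+ n.
  have -> : M ^+ n = M * M ^+ n.-1 by rewrite -exprS prednK.
  rewrite mulrA ler_peMl ?exprn_ge0 //.
  rewrite /M -expRD -expR0 ler_expR subr_ge0 ler_wpM2l ?(ltW c0) //.
  by rewrite -(@real_normK _ t) ?num_real // lerXn2r // nnegrE ?pi_ge0.
apply: le_trans (_ : M ^+ n * (K1 * `|t| + n%:R * K3 * `|t| ^+ 3) <= _); last first.
  pose y := Num.sqrt n%:R * `|t|.
  have rn0 : 0 < Num.sqrt n%:R :> R by rewrite sqrtr_gt0 ltr0n.
  have rn2 : Num.sqrt n%:R ^+ 2 = n%:R :> R by rewrite sqr_sqrtr.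
  have y0 : 0 <= y by rewrite mulr_ge0 // sqrtr_ge0.
  have y2 : y ^+ 2 = n%:R * t ^+ 2 by rewrite exprMn rn2 real_normK ?num_real.
  have [Y1 Y3] := pow_exp_bound a0 y0.
  have -> : K1 * `|t| + n%:R * K3 * `|t| ^+ 3 = (K1 * y + K3 * y ^+ 3) / Num.sqrt n%:R.
    rewrite /y; move: rn2 rn0; move: (Num.sqrt _) => rn <- rn0.
    by field; rewrite gt_eqF.
  have -> : M ^+ n = expR (- (n%:R * a * t ^+ 2)) * expR (- (a * y ^+ 2)).
    by rewrite Mn -expRD y2 /a; congr expR; field.
  set E1 := expR (- (n%:R * _ * _)).
  have E10 : 0 <= E1 := expR_ge0 _.
  rewrite [leRHS]mulrC -mulrA ler_wpM2l // mulrA ler_wpM2r ?invr_ge0 ?(ltW rn0) //.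
  rewrite expRN ler_pdivrMl ?expR_gt0 // mulrDr; apply: lerD.
    by rewrite [leRHS]mulrCA ler_wpM2l // [leRHS]mulrC.
  by rewrite [leRHS]mulrCA ler_wpM2l // [leRHS]mulrC.
rewrite gn; apply: le_trans (_ : nm (chi t ^+ n * expi (k%:R * t) - (g ^+ n)%:C) <= _).
  by apply: le_trans (Re_le_normc _); rewrite raddfB.
apply: le_trans A1 _; rewrite mulrDr lerD2l.
have -> : M ^+ n * (n%:R * K3 * `|t| ^+ 3) =
  n%:R * (expR (c * pi ^+ 2) * M ^+ n) * (C * `|t| ^+ 3) by rewrite /K3; ring.
by rewrite ler_wpM2r ?mulr_ge0 ?exprn_ge0 // ler_wpM2l.
Qed.

Theorem local_limit (k : nat) :
  Num.sqrt n%:R * (Q ^+ n)`_(n - k)%N @[n --> \oo] --> (Num.sqrt (2 * pi * s2))^-1.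
Proof.
have [a [H [a0 as2 H0 Hn]]] := chiX_gauss k; have pi0 := pi_gt0 R.
have L : (Num.sqrt (2 * pi * s2))^-1 = (2 * pi)^-1 * Num.sqrt (2 * pi / s2).
  have X0 : 0 < Num.sqrt (2 * pi * s2) by rewrite sqrtr_gt0 !mulr_gt0.
  have X2 : Num.sqrt (2 * pi * s2) ^+ 2 = 2 * pi * s2 by rewrite sqr_sqrtr // !mulr_ge0 ?(ltW pi0) ?(ltW s20).
  have -> : Num.sqrt (2 * pi / s2) = Num.sqrt (2 * pi * s2) / s2.
    rewrite (_ : 2 * pi / s2 = (Num.sqrt (2 * pi * s2) / s2) ^+ 2).
      by rewrite sqrtr_sqr ger0_norm // divr_ge0 ?(ltW s20) // ltW.
    by rewrite expr_div_n X2; field; rewrite gt_eqF.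
  have ps : 0 < 2 * pi * s2 by rewrite !mulr_gt0.
  move: X2 X0; move: (Num.sqrt _) => X X2 X0; apply: (mulfI (lt0r_neq0 X0)).
  rewrite divff ?gt_eqF //; have -> : X * ((2 * pi)^-1 * (X / s2)) = X ^+ 2 / (2 * pi * s2).
    by move: pi0; move: (pi : R) => p p0; field; rewrite !gt_eqF.
  by rewrite X2 divff // gt_eqF.
rewrite L.
have -> : (fun n => Num.sqrt n%:R * (Q ^+ n)`_(n - k)%N) =
  (fun n => (2 * pi)^-1 * (Num.sqrt n%:R * (2 * pi * (Q ^+ n)`_(n - k)%N))).
  by apply/funext => n; move: pi0; move: (pi : R) => p p0; field; rewrite gt_eqF.
apply: cvgMl_tmp; apply/cvgrPdist_le => e e0.
pose K := (H + (a * pi ^+ 2)^-1) * Num.sqrt (pi / a).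
have : K * (Num.sqrt n%:R)^-1 @[n --> \oo] --> K * 0.
  by apply: cvgMl_tmp; exact: cvg_sqrtV.
rewrite mulr0 => /cvgrPdist_le/(_ e e0) HK; near=> n.
have n0 : (0 < n)%N by near: n; exists 1%N.
have kn : (k <= n)%N by near: n; exists k.
have n0' : 0 < n%:R :> R by rewrite ltr0n.
have rn0 : 0 < Num.sqrt n%:R :> R by rewrite sqrtr_gt0.
have rn2 : Num.sqrt n%:R ^+ 2 = n%:R :> R by rewrite sqr_sqrtr // ltW.
have -> : 2 * pi * (Q ^+ n)`_(n - k)%N =
    \int[mu]_(t in `[-pi, pi]) Re (chi t ^+ n * expi (k%:R * t)).
  pose N := maxn (size (Q ^+ n)) n.+1.
  have nN : (n - k < N)%N by rewrite leq_max ltnS leq_subr orbT.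
  rewrite -(fourier_coef (fun m => (Q ^+ n)`_m) nN); apply: eq_Rintegral => t _.
  by rewrite (@Re_chiX n k t N) // leq_maxl.
have cont : continuous (fun t => Re (chi t ^+ n * expi (k%:R * t))).
  rewrite (_ : (fun t => _) = (fun t => \sum_(m < size (Q ^+ n))
     (Q ^+ n)`_m * cos ((m%:R - (n - k)%:R) * t))); last first.
    by apply/funext => t; exact: Re_chiX.
  exact: (@continuous_trig_sum (fun m => (Q ^+ n)`_m) (fun m => m%:R - (n - k)%:R) _ _
           (@continuous_cos R)).
have := @gauss_compare R _ (n%:R * a) (n%:R * (s2 / 2)) (H / Num.sqrt n%:R) cont.
rewrite mulr_gt0 // mulrCA ler_pM2l // divr_ge0 ?(ltW rn0) // => /(_ isT as2).
have HH t : - pi <= t <= pi -> `|Re (chi t ^+ n * expi (k%:R * t)) -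
   expR (- (n%:R * (s2 / 2) * t ^+ 2))| <= H / Num.sqrt n%:R * expR (- (n%:R * a * t ^+ 2)).
  by rewrite -ler_norml => /(Hn n t n0).
move=> /(_ HH isT); set I := Rintegral _ _ _ => HI.
have -> : Num.sqrt (2 * pi / s2) = Num.sqrt n%:R * Num.sqrt (pi / (n%:R * (s2 / 2))).
  rewrite -sqrtrM ?ler0n //; congr Num.sqrt; field; rewrite !gt_eqF //.
rewrite -mulrBr normrM (gtr0_norm rn0) distrC.
have E : Num.sqrt (pi / (n%:R * a)) = Num.sqrt (pi / a) / Num.sqrt n%:R.
  rewrite -sqrtrV ?(ltW n0') // -sqrtrM ?divr_ge0 ?(ltW pi0) ?(ltW a0) //.
  by congr Num.sqrt; field; rewrite !gt_eqF.
(* The other error is only of order [1 / sqrt n], so [expR (- x) <= 1 / x] suffices for this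
   exponentially small one. *)
have G : expR (- (n%:R * a * pi ^+ 2)) <= (a * pi ^+ 2)^-1 / Num.sqrt n%:R.
  have api : 0 < a * pi ^+ 2 by rewrite mulr_gt0 ?exprn_gt0.
  rewrite expRN -invfM lef_pV2 ?posrE ?expR_gt0 ?mulr_gt0 //.
  apply: le_trans (_ : n%:R * a * pi ^+ 2 <= _); last first.
    by apply: le_trans (expR_ge1Dx _); rewrite lerDr.
  have rn1 : 1 <= Num.sqrt n%:R :> R by rewrite -[leLHS]sqrtr1 ler_sqrt ?ler1n.
  rewrite -mulrA mulrC ler_wpM2r ?(ltW api) //; move: rn1 rn2 rn0.
  by move: (Num.sqrt _) => rn rn1 <- rn0; rewrite expr2 ler_peMl // ltW.
have : `|0 - K / Num.sqrt n%:R| <= e by near: n.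
rewrite sub0r normrN; apply: le_trans; apply: le_trans (ler_norm _).
rewrite mulrC -ler_pdivlMr //; apply: le_trans HI _; rewrite E /K.
apply: le_trans (_ : (H / Num.sqrt n%:R + (a * pi ^+ 2)^-1 / Num.sqrt n%:R) *
   (Num.sqrt (pi / a) / Num.sqrt n%:R) <= _).
  by rewrite ler_wpM2r ?divr_ge0 ?sqrtr_ge0 // lerD2l.
move: (Num.sqrt (pi / a)) ((a * pi ^+ 2)^-1) => S X.
by rewrite le_eqVlt; apply/orP; left; apply/eqP; field; rewrite gt_eqF.
Unshelve. all: by end_near. Qed.

End LocalLimit.

(** * Central binomial coefficients *)

Section CentralBinomialLimit.
Variable R : realType.

Lemma invsqrt_coef_bin n : invsqrt_coef R n * 4 ^+ n = 'C(2 * n, n)%:R.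
Proof.
have H : invsqrt_coef R n * 4 ^+ n * (n`! * n`!)%:R = ((2 * n)`!)%:R.
  elim: n => [|n IH]; first by rewrite /= expr0 !mulr1.
  have -> : (2 * n.+1 = (2 * n).+2)%N by lia.
  rewrite !factS !natrM -IH.
  rewrite [invsqrt_coef R n.+1](_ : _ = invsqrt_coef R n * ((2 * n + 1)%:R / (2 * n + 2)%:R)) //.
  rewrite exprS natrM (_ : (2 * n + 2)%:R = 2 * n.+1%:R :> R); last by rewrite -natrM; congr (_%:R); lia.
  rewrite (_ : (2 * n).+2%:R = 2 * n.+1%:R :> R); last by rewrite -natrM; congr (_%:R); lia.
  rewrite (_ : (2 * n).+1%:R = (2 * n + 1)%:R :> R); last by congr (_%:R); lia.
  have : n.+1%:R != 0 :> R by rewrite pnatr_eq0.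
  by move: (n.+1%:R) ((2 * n + 1)%:R) => a b a0; field.
have f0 : ((n`! * n`!)%:R : R) != 0 by rewrite pnatr_eq0 -lt0n muln_gt0 fact_gt0.
apply: (mulIf f0); rewrite H -natrM; congr (_%:R).
by rewrite -[LHS](@bin_fact (2 * n) n); [congr (_ * (_ * _`!))%N; lia | lia].
Qed.

(** [c n] is the central coefficient of [((1 + X) / 2) ^+ (2 * n)]: the probability that [n] steps
    in {-1, 0, 1} of weights 1/4, 1/2, 1/4 add up to 0. The variance 1/2 gives the constant. *)
Lemma invsqrt_coef_cvg :
  Num.sqrt n%:R * invsqrt_coef R n @[n --> \oo] --> (Num.sqrt pi)^-1.
Proof.
pose r (j : nat) : R := nth 0 [:: 4^-1; 2^-1; 4^-1] j.
have r0 j : 0 <= r j by move: j => [|[|[|j]]]; rewrite /r /= ?nth_nil ?invr_ge0.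
have E3 (f : nat -> R) : \sum_(j < 3) f j = f 0%N + f 1%N + f 2%N.
  by rewrite !big_ord_recr big_ord0 /= add0r.
have rsum : \sum_(j < 3) r j = 1 by rewrite E3 /r /=; field.
have rmean : \sum_(j < 3) r j * (j%:R - 1) = 0.
  by rewrite (E3 (fun j => r j * (j%:R - 1))) /r /=; field.
have rvar : \sum_(j < 3) r j * (j%:R - 1) ^+ 2 = 2^-1.
  by rewrite (E3 (fun j => r j * (j%:R - 1) ^+ 2)) /r /=; field.
have aper q : (1 < q)%N -> exists2 j, (j < 3)%N & (r j != 0) && ~~ (q %| j)%N.
  by move=> q1; exists 1%N; rewrite // /r /= invr_eq0 pnatr_eq0 /= dvdn1; case: q q1 => [|[|]].
have r00 : 0 < r 0%N by rewrite invr_gt0.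
have s20 : 0 < 2^-1 :> R by rewrite invr_gt0.
have := local_limit r0 r00 rsum rmean rvar s20 aper 0.
rewrite (_ : 2 * pi * 2^-1 = pi); last by rewrite mulrAC divff ?mul1r.
apply: cvg_trans; apply: near_eq_cvg; near=> n; congr (_ * _); rewrite subn0.
have -> : \poly_(j < 3) r j = (2^-1%:P * ('X + 1)) ^+ 2.
  apply/polyP => j; rewrite exprMn -rmorphXn coefCM coef_poly sqrrD1 !coefD coefXn coefX coef1 /r.
  by case: j => [|[|[|j]]] /=; field.
rewrite -exprM exprMn -rmorphXn coefCM exprDn coef_sum.
have hn : (n < (2 * n).+1)%N by lia.
rewrite (bigD1 (Ordinal hn)) //= big1 => [|i]; last first.
  rewrite expr1n mulr1 coefMn coefXn => /eqP h; case: eqP => //; rewrite ?mul0rn // => hi.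
  by case: h; apply: val_inj => /=; have := ltn_ord i; lia.
rewrite expr1n mulr1 coefMn coefXn addr0 (_ : (2 * n - n = n)%N) ?eqxx; last lia.
rewrite -invsqrt_coef_bin exprM (_ : 2^-1 ^+ 2 = 4^-1 :> R); last by field.
by rewrite exprVn mulrCA mulVf ?mulr1 // expf_neq0 // pnatr_eq0.
Unshelve. all: by end_near. Qed.

End CentralBinomialLimit.

(** * Walks and first passages *)

Section Paths.
Variables (R : realType) (w : walk R).
Implicit Types (a x : int) (s : seq int) (f : int -> R).

(** The starting altitude becomes a parameter, so that weight and positivity can be computed by
    removing the first jump. *)
Fixpoint weight_from a s : R :=
  if s is x :: s' then (if a == 0 then wt0 w x else wt w x) * weight_from (a + x) s' else 1.

Fixpoint nonneg_from a s : bool :=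
  (0 <= a) && (if s is x :: s' then nonneg_from (a + x) s' else true).

Lemma altitude_cons x s k : altitude (x :: s) k.+1 = x + altitude s k.
Proof. by rewrite /altitude /= big_cons. Qed.

Lemma altitude0 s : altitude s 0 = 0.
Proof. by rewrite /altitude take0 big_nil. Qed.

Lemma weight_fromE a s : weight_from a s =
  \prod_(k < size s) (if a + altitude s k == 0 then wt0 w (nth 0 s k) else wt w (nth 0 s k)).
Proof.
elim: s a => [|x s IH] a /=; first by rewrite big_ord0.
rewrite big_ord_recl altitude0 addr0 IH /=; congr (_ * _); apply: eq_bigr => k _.
by rewrite altitude_cons addrA.
Qed.

Lemma path_weightE s : path_weight w s = weight_from 0 s.
Proof. by rewrite weight_fromE; apply: eq_bigr => k _; rewrite add0r. Qed.

Lemma nonneg_fromE a s :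
  nonneg_from a s = [forall k : 'I_(size s).+1, 0 <= a + altitude s k].
Proof.
elim: s a => [|x s IH] a /=.
  rewrite andbT; apply/idP/forallP => [a0 k|/(_ ord0)]; last by rewrite altitude0 addr0.
  by rewrite ord1 altitude0 addr0.
rewrite IH; apply/andP/forallP => [[a0 /forallP H] k|H].
  case: (unliftP ord0 k) => [j ->|->]; last by rewrite altitude0 addr0.
  by rewrite lift0 altitude_cons addrA.
split; first by have := H ord0; rewrite altitude0 addr0.
apply/forallP => j; have := H (lift ord0 j).
by rewrite lift0 altitude_cons addrA.
Qed.

Lemma is_meanderE s : is_meander s = nonneg_from 0 s.
Proof. by rewrite nonneg_fromE; apply: eq_forallb => k; rewrite add0r. Qed.

(** [f] tests the final altitude: the constant 1 yields meanders, the indicator of 0 excursions. *)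
Definition paths_from f n a : R :=
  \sum_(t : n.-tuple 'I_(max_down w + max_up w).+1)
    (nonneg_from a (map (@jump R w) t))%:R * weight_from a (map (@jump R w) t) *
    f (a + \sum_(x <- map (@jump R w) t) x).

Lemma meandersE n : meanders w n = paths_from (fun=> 1) n 0.
Proof.
rewrite /meanders big_mkcond; apply: eq_bigr => t _.
by rewrite -is_meanderE -path_weightE mulr1; case: ifP; rewrite ?mul1r ?mul0r.
Qed.

Lemma excursionsE n : excursions w n = paths_from (fun a => (a == 0)%:R) n 0.
Proof.
rewrite /excursions big_mkcond; apply: eq_bigr => t _.
rewrite /is_excursion is_meanderE -path_weightE add0r /altitude take_size.
by case: (nonneg_from _ _); case: (_ == _); rewrite ?mul1r ?mulr1 ?mul0r ?mulr0.
Qed.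

Lemma sum_tuple_cons (T : finType) n (F : seq T -> R) :
  \sum_(t : n.+1.-tuple T) F t = \sum_(x : T) \sum_(t : n.-tuple T) F (x :: t).
Proof.
rewrite pair_big /= (reindex (fun p : T * n.-tuple T => [tuple of p.1 :: p.2])) //=.
exists (fun t => (thead t, [tuple of behead t])) => [[x t] _|t _] /=.
  by rewrite theadE; congr (_, _); apply/val_inj.
by rewrite [t in RHS]tuple_eta; apply: val_inj.
Qed.

Lemma paths_from_neg f n a : a < 0 -> paths_from f n a = 0.
Proof.
move=> a0; apply: big1 => t _.
by case: (tval t) => [|i s] /=; rewrite leNgt a0 /= !mul0r.
Qed.

Lemma paths_fromS f n a : 0 <= a -> paths_from f n.+1 a =
  \sum_(i < (max_down w + max_up w).+1)
    (if a == 0 then wt0 w (jump i) else wt w (jump i)) * paths_from f n (a + jump i).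
Proof.
move=> a0; rewrite /paths_from (@sum_tuple_cons _ _ (fun t => (nonneg_from a (map (@jump R w) t))%:R
   * weight_from a (map (@jump R w) t) * f (a + \sum_(x <- map (@jump R w) t) x))).
apply: eq_bigr => i _; rewrite mulr_sumr; apply: eq_bigr => t _ /=.
by rewrite a0 /= big_cons !mulrA; congr (_ * _ * f _); [exact: mulrC | exact: addrA].
Qed.

(** Shrinks the common range of jumps to the one that is relevant at a given altitude. *)
Lemma sum_shift (G : int -> R) (m m' M M' : nat) : (m <= m')%N -> (M <= M')%N ->
  (forall x, ~~ (- m%:Z <= x <= M%:Z) -> G x = 0) ->
  \sum_(i < (m' + M').+1) G (i%:Z - m'%:Z) = \sum_(i < (m + M).+1) G (i%:Z - m%:Z).
Proof.
move=> mm MM G0.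
rewrite -(big_mkord xpredT (fun i => G (i%:Z - m'%:Z))) -(big_mkord xpredT (fun i => G (i%:Z - m%:Z))).
rewrite (@big_cat_nat _ _ _ (m' - m)) //=; last lia.
rewrite big_nat_cond big1 ?add0r; last first.
  by move=> i /andP[/andP[_ Hi] _]; apply: G0; apply/negP => /andP[]; lia.
rewrite (@big_cat_nat _ _ _ (m' + M).+1) //=; try lia.
rewrite [X in _ + X]big_nat_cond [X in _ + X]big1 ?addr0; last first.
  by move=> i /andP[/andP[Hi _] _]; apply: G0; apply/negP => /andP[_]; lia.
rewrite -{1}(add0n (m' - m)%N) big_addn (_ : (m' + M).+1 - (m' - m) = (m + M).+1)%N; last lia.
by apply: eq_bigr => i _; congr G; lia.
Qed.

(** The [n]-th power of the transition operator of the walk killed below 0, applied to [f]. From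
    [k'.+1] the jump [j - 1] leads to [k' + j], so no truncated subtraction occurs. *)
Fixpoint evol (f : nat -> R) n (k : nat) : R :=
  if n is n'.+1 then
    if k is k'.+1 then \sum_(j < (deg w).+2) wt w (j%:Z - 1) * evol f n' (k' + j)
    else \sum_(i < (deg0 w).+1) wt0 w i%:Z * evol f n' i
  else f k.

Hypotheses (hw : lukasiewicz w) (hw0 : boundary_weights w).

Lemma paths_from_evol f n (k : nat) : paths_from f n k%:Z = evol (fun m => f m%:Z) n k.
Proof.
have [_ wt_out _ _ _] := hw; have [_ wt0_out _] := hw0.
elim: n k => [|n IH] k.
  rewrite /paths_from (big_pred1 [tuple]) => [|t]; last by rewrite /= [t]tuple0; exact/esym/eqxx.
  by rewrite /= big_nil addr0 !mul1r.
rewrite paths_fromS //; case: k => [|k] /=.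
  rewrite (@sum_shift (fun x => wt0 w x * paths_from f n (0%:Z + x)) 0 _ (deg0 w)) ?leq_maxr //.
    by apply: eq_bigr => i _; rewrite subr0 add0r IH.
  (* Negative jumps from 0 may have positive weight, but no meander continues from a negative
     altitude. *)
  move=> x Hx; rewrite add0r; case: (ltrP x 0) => x0; first by rewrite paths_from_neg ?mulr0.
  by rewrite wt0_out ?mul0r //; apply: contra Hx => /andP[_ ->]; rewrite oppr0 x0.
rewrite (@sum_shift (fun x => wt w x * paths_from f n (k.+1%:Z + x)) 1 _ (deg w)) ?leq_maxl //.
  apply: eq_bigr => i _; congr (_ * _).
  by rewrite -IH; congr paths_from; rewrite PoszD -addn1 PoszD; ring.
by move=> x Hx; rewrite wt_out ?mul0r.
Qed.

Lemma meanders_evol n : meanders w n = evol (fun=> 1) n 0.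
Proof. by rewrite meandersE (paths_from_evol _ _ 0). Qed.

Lemma excursions_evol n : excursions w n = evol (fun k => (k == 0)%:R) n 0.
Proof. by rewrite excursionsE (paths_from_evol _ _ 0). Qed.

End Paths.

(** * First passages, arches and Kemperman's formula *)

Section Hitting.
Variables (R : realType) (w : walk R).
Hypotheses (hw : lukasiewicz w) (hw0 : boundary_weights w).

Let phi (j : nat) : R := wt w (j%:Z - 1).
Let D := (deg w).+2.

(* [hit n k] is the weight of the first passages from altitude [k] to [0] at
   time [n]. *)
Fixpoint hit (n k : nat) : R :=
  if n is n'.+1 then
    if k is k'.+1 then \sum_(j < (deg w).+2) wt w (j%:Z - 1) * hit n' (k' + j) else 0
  else (k == 0)%:R.

Lemma hit0 n : hit n 0 = delta R n.
Proof. by case: n. Qed.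

Lemma hitSS n k : hit n.+1 k.+1 = \sum_(j < D) phi j * hit n (k + j).
Proof. by []. Qed.

Lemma phi_ge0 j : 0 <= phi j.
Proof. by have [H _ _ _ _] := hw; have /andP[] := H (j%:Z - 1). Qed.

Lemma wt0_ge0 i : 0 <= wt0 w i.
Proof. by have [H _ _] := hw0; exact: H. Qed.

Lemma phi0_gt0 : 0 < phi 0.
Proof. by have [_ _ _ H _] := hw; rewrite lt_def phi_ge0 /phi sub0r H. Qed.

Lemma sum_phi : \sum_(j < D) phi j = 1.
Proof. by have [_ _ H _ _] := hw. Qed.

Lemma hit_ge0 n k : 0 <= hit n k.
Proof.
elim: n k => [|n IH] k; first exact: ler0n.
case: k => [|k] //=; apply: sumr_ge0 => j _; rewrite mulr_ge0 //; exact: phi_ge0.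
Qed.

(** Decomposition at the first visit to 0: a family that obeys the one-step recursion above 0 and
    starts from 0 there is determined by its values at altitude 0. *)
Lemma hit_conv (v : nat -> nat -> R) :
  (forall k, v 0%N k.+1 = 0) ->
  (forall n k, v n.+1 k.+1 = \sum_(j < D) phi j * v n (k + j)%N) ->
  forall n k, v n k = conv (fun m => hit m k) (fun m => v m 0%N) n.
Proof.
move=> v0 vS; elim=> [|n IH] k.
  by rewrite /conv big_ord1 /=; case: k => [|k]; rewrite ?mul1r // v0 mul0r.
case: k => [|k]; first by rewrite (eq_convl _ (fun m _ => hit0 m)) conv_delta.
rewrite vS conv_recl mul0r add0r convC.
rewrite (@eq_convr _ _ _ (fun m => \sum_(j < D) phi j * hit m (k + j))) // conv_sumr.
by apply: eq_bigr => j _; rewrite convZr convC -IH.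
Qed.

(** The only downward jump is -1, so a walk going from [k + l] to 0 must meet [l] first. *)
Lemma hit_add k l n : hit n (k + l) = conv (fun m => hit m k) (fun m => hit m l) n.
Proof.
rewrite (@hit_conv (fun n k => hit n (k + l))) // => {}n {}k.
by rewrite addSn hitSS; apply: eq_bigr => j _; rewrite addnAC.
Qed.

Definition exc n : R := evol w (fun k => (k == 0)%:R) n 0.
Definition mea n : R := evol w (fun=> 1) n 0.

Lemma evol_ge0 f n k : (forall k, 0 <= f k) -> 0 <= evol w f n k.
Proof.
move=> f0; elim: n k => [|n IH] [|k] //=; apply: sumr_ge0 => j _; rewrite mulr_ge0 //.
  exact: wt0_ge0.
exact: phi_ge0.
Qed.

Lemma exc_ge0 n : 0 <= exc n.
Proof. by apply: evol_ge0 => k; exact: ler0n. Qed.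

Lemma mea_ge0 n : 0 <= mea n.
Proof. exact: evol_ge0. Qed.

(* The weight of the arches (excursions that meet [0] at their ends only) of
   length [n]. *)
Definition arch (n : nat) : R :=
  if n is m.+1 then \sum_(i < (deg0 w).+1) wt0 w i%:Z * hit m i else 0.

Lemma arch_ge0 n : 0 <= arch n.
Proof.
case: n => [|n] //=; apply: sumr_ge0 => i _.
by rewrite mulr_ge0 ?wt0_ge0 ?hit_ge0.
Qed.

Lemma exc_renewal n : exc n = delta R n + conv arch exc n.
Proof.
case: n => [|n]; first by rewrite /conv big_ord1 mul0r addr0.
rewrite conv_recl mul0r !add0r /= convC conv_sumr; apply: eq_bigr => i _.
by rewrite convZr convC -(hit_conv (v := evol w (fun k => (k == 0)%:R))).
Qed.

Lemma P0ge1E : P0ge w 1 = \sum_(i < (deg0 w).+1) wt0 w i%:Z.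
Proof. by apply: eq_bigr => i _; rewrite expr1n mulr1. Qed.

(* A meander dies only by a negative jump from altitude [0]. *)
Lemma evol_killed n k :
  evol w (fun=> 1) n.+1 k = evol w (fun=> 1) n k - (1 - P0ge w 1) * evol w (fun k => (k == 0)%:R) n k.
Proof.
elim: n k => [|n IH] k.
  case: k => [|k] /=; under eq_bigr do rewrite mulr1.
    by rewrite P0ge1E; ring.
  by rewrite sum_phi mulr0 subr0.
have e0 f m : evol w f m.+1 0 = \sum_(i < (deg0 w).+1) wt0 w i%:Z * evol w f m i by [].
have eS f m j : evol w f m.+1 j.+1 = \sum_(i < D) phi i * evol w f m (j + i) by [].
case: k => [|k]; rewrite ?e0 ?eS; under eq_bigr do rewrite IH mulrBr mulrCA;
  by rewrite sumrB -mulr_sumr.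
Qed.

Lemma meaE n : mea n = 1 - (1 - P0ge w 1) * series exc n.
Proof.
elim: n => [|n IH]; first by rewrite /mea /series/= big_geq // mulr0 subr0.
by rewrite /mea evol_killed -/(mea n) -/(exc n) IH seriesSr; ring.
Qed.

Let Phi := \poly_(j < D) phi j.

Let sum_Phi (G : nat -> R) m : (forall j, (m < j)%N -> G j = 0) ->
  \sum_(j < D) phi j * G j = \sum_(j < m.+1) Phi`_j * G j.
Proof.
move=> G0; pose N := maxn D m.+1.
have DN : (D <= N)%N by rewrite leq_maxl.
have mN : (m.+1 <= N)%N by rewrite leq_maxr.
rewrite -(big_mkord xpredT (fun j => phi j * G j)) -(big_mkord xpredT (fun j => Phi`_j * G j)).
transitivity (\sum_(0 <= j < N) Phi`_j * G j); last first.
  rewrite (@big_cat_nat _ _ _ m.+1) //= [X in _ + X]big_nat_cond [X in _ + X]big1 ?addr0 //.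
  by move=> j /andP[/andP[mj _] _]; rewrite G0 ?mulr0.
rewrite [RHS](@big_cat_nat _ _ _ D) //= [X in _ = _ + X]big_nat_cond [X in _ = _ + X]big1 ?addr0.
  by rewrite !big_nat; apply: eq_bigr => j /andP[_ jD]; rewrite coef_poly jD.
by move=> j /andP[/andP[Dj _] _]; rewrite coef_poly ltnNge Dj /= mul0r.
Qed.

(** The weight of the unconstrained walks from [k] to 0 in [n] steps; the test guards against
    truncated subtraction. *)
Let coefn n k := if (k <= n)%N then (Phi ^+ n)`_(n - k) else 0.

Let sum_coefn n k : (k <= n)%N ->
  \sum_(j < D) phi j * coefn n (k + j) = (Phi ^+ n.+1)`_(n - k).
Proof.
move=> kn; rewrite (@sum_Phi (fun j => coefn n (k + j)) (n - k)); last first.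
  by move=> j Hj; rewrite /coefn ifN // -ltnNge; lia.
rewrite exprS coefM; apply: eq_bigr => j _; rewrite /coefn ifT; last by have := ltn_ord j; lia.
by rewrite subnDA.
Qed.

(** A coefficient of [X * (Phi ^+ n.+1)' = n.+1 * X * Phi' * Phi ^+ n]. *)
Let sum_coefn_natl n k : (k <= n)%N ->
  n.+1%:R * (\sum_(j < D) phi j * (j%:R * coefn n (k + j))) = (n - k)%:R * (Phi ^+ n.+1)`_(n - k).
Proof.
move=> kn; rewrite (@sum_Phi (fun j => j%:R * coefn n (k + j)) (n - k)); last first.
  by move=> j Hj; rewrite /coefn ifN ?mulr0 // -ltnNge; lia.
have -> : \sum_(j < (n - k).+1) Phi`_j * (j%:R * coefn n (k + j)) =
   ('X * Phi^`() * Phi ^+ n)`_(n - k).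
  rewrite coefM; apply: eq_bigr => j _; rewrite /coefn ifT; last by have := ltn_ord j; lia.
  rewrite subnDA mulrA; congr (_ * _); rewrite coefXM; case: (j : nat) => [|i] /=.
    by rewrite mulr0.
  by rewrite coef_deriv mulr_natr.
have -> : (n - k)%:R * (Phi ^+ n.+1)`_(n - k) = ('X * (Phi ^+ n.+1)^`())`_(n - k).
  by rewrite coefXM; case: (n - k)%N => [|i] /=; rewrite ?mul0r // coef_deriv mulr_natl.
by rewrite deriv_exp /= mulrnAr coefMn mulr_natl mulrA.
Qed.

(* Kemperman's formula: [n P_k(T_0 = n) = k P(S_n = - k)]. *)
Lemma hit_coef n k : n%:R * hit n k = k%:R * (if (k <= n)%N then (Phi ^+ n)`_(n - k) else 0).
Proof.
rewrite -/(coefn n k); elim: n k => [|n IH] k.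
  by rewrite mul0r; case: k => [|k]; rewrite ?mul0r // /coefn /= mulr0.
case: k => [|k]; first by rewrite mulr0 mul0r.
(* One step is treated apart: at time 0 the induction hypothesis is multiplied by 0 and gives no
   information. *)
case: n IH => [|n] IH.
  rewrite mul1r hitSS /= /coefn ltnS leqn0; case: k => [|k] /=.
    rewrite mul1r expr1 subnn coef_poly /= /D big_ord_recl /= mulr1 big1 ?addr0 // => j _.
    by rewrite mulr0.
  by rewrite mulr0 big1 // => j _; rewrite mulr0.
have n0 : n.+1%:R != 0 :> R by rewrite pnatr_eq0.
apply: (mulfI n0); rewrite hitSS.
have -> : n.+1%:R * (n.+2%:R * \sum_(j < D) phi j * hit n.+1 (k + j)) =
   n.+2%:R * (k%:R * (\sum_(j < D) phi j * coefn n.+1 (k + j)) +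
             \sum_(j < D) phi j * (j%:R * coefn n.+1 (k + j))).
  rewrite mulrCA; congr (_ * _); rewrite !mulr_sumr -big_split; apply: eq_bigr => j _ /=.
  by rewrite mulrCA IH natrD; ring.
case: (leqP k n.+1) => kn; last first.
  have z j : coefn n.+1 (k + j) = 0 by rewrite /coefn ifN // -ltnNge; lia.
  rewrite /coefn ifN -?ltnNge ?ltnS // !mulr0 big1 ?mulr0 ?add0r => [|j _]; last by rewrite -/(coefn _ _) z mulr0.
  by rewrite big1 ?mulr0 // => j _; rewrite -/(coefn _ _) z !mulr0.
rewrite mulrDr sum_coefn_natl // sum_coefn // /coefn ltnS kn subSS natrB // -!natr1.
ring.
Qed.

End Hitting.

(** * Generating functions of arches *)

Section PolyDerivative.
Variables (R : nzRingType) (n : nat) (E : nat -> R).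

Lemma horner_deriv_poly (x : R) :
  (\poly_(i < n) E i)^`().[x] = \sum_(i < n) E i * (i%:R * x ^+ i.-1).
Proof.
rewrite poly_def raddf_sum horner_sum; apply: eq_bigr => i _ /=.
by rewrite derivZ derivXn hornerZ hornerMn hornerXn mulr_natl.
Qed.

Lemma horner_deriv2_poly (x : R) : (\poly_(i < n) E i)^`()^`().[x] =
  \sum_(i < n) E i * (i%:R * (i.-1%:R * x ^+ i.-2)).
Proof.
rewrite poly_def !raddf_sum horner_sum; apply: eq_bigr => i _ /=.
by rewrite derivZ derivXn derivZ derivMn derivXn hornerZ !hornerMn hornerXn !mulr_natl.
Qed.

End PolyDerivative.

(** * Convexity of P and generating functions of first passages *)

Section SmallBranch.
Variables (R : realType) (w : walk R).
Hypotheses (hw : lukasiewicz w) (hw0 : boundary_weights w).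

Let phi (j : nat) : R := wt w (j%:Z - 1).
Let D := (deg w).+2.
Let p1 := \poly_(j < (deg w).+1) phi j.+1.
Let p0 := \poly_(i < (deg0 w).+1) wt0 w i%:Z.

Lemma P_horner u : P w u = phi 0 * u^-1 + p1.[u].
Proof.
rewrite /P big_ord_recl /=; congr (_ + _).
rewrite horner_poly; apply: eq_bigr => j _; rewrite /phi /bump leq0n add1n.
by rewrite (_ : j.+1%:Z - 1 = j%:Z) //; lia.
Qed.

Lemma P_sum u : u != 0 -> u * P w u = \sum_(j < D) phi j * u ^+ j.
Proof.
move=> u0; rewrite P_horner horner_poly mulrDr mulrCA divff // mulr1 [RHS]big_ord_recl /= expr0 mulr1.
congr (_ + _); rewrite mulr_sumr; apply: eq_bigr => j _.
by rewrite /bump leq0n add1n exprS; ring.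
Qed.

Lemma P0ge_horner u : P0ge w u = p0.[u].
Proof. by rewrite horner_poly. Qed.

Let dP u := - phi 0 / u ^+ 2 + p1^`().[u].
Let ddP u := 2 * phi 0 / u ^+ 3 + p1^`()^`().[u].

Lemma is_derive_P u : u != 0 -> is_derive u (1:R) (P w) (dP u).
Proof.
move=> u0.
have d1 : is_derive u (1:R) (fun x : R => x^-1) (- u ^- 2 *: 1) := is_deriveV u0 (is_derive_id u 1).
have d2 := is_deriveD (is_deriveZ (phi 0) d1) (is_derive_poly p1 u).
rewrite (_ : P w = (phi 0 \*: (fun x : R => x^-1)) + horner p1); last first.
  by apply/funext => x; rewrite P_horner.
apply: (is_derive_eq d2).
by rewrite /dP /GRing.scale /= mulr1 mulNr mulrN.
Qed.

Lemma derive1_P u : u != 0 -> derive1 (P w) u = dP u.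
Proof. by move=> u0; rewrite derive1E; apply: derive_val; exact: is_derive_P. Qed.

Lemma derive2_P u : u != 0 -> derive1n 2 (P w) u = ddP u.
Proof.
move=> u0; rewrite /= derive1E.
have d0 : is_derive u (1:R) (fun x : R => x ^+ 2) (2 * u).
  apply: (is_derive_eq (is_deriveX 2 (is_derive_id u (1:R)))).
  by rewrite /GRing.scale /= mulr1 expr1.
have d1 := @is_deriveV R (fun x : R => x ^+ 2) u _ 1 (expf_neq0 2 u0) d0.
have d2 := is_deriveD (is_deriveZ (- phi 0) d1) (is_derive_poly p1^`() u).
have -> : ddP u = (- phi 0) *: (- (u ^+ 2) ^- 2 *: (2 * u)) + p1^`()^`().[u].
  by rewrite /ddP /GRing.scale /=; congr (_ + _); field.
rewrite -[RHS](@derive_val _ _ _ _ _ _ _ d2).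
apply: near_eq_derive; near=> x.
by rewrite derive1_P //; near: x; exact: (cvgr_neq0 u cvg_id u0).
Unshelve. all: by end_near. Qed.

(** Together with [derive2_P_sum], this expresses the mean and the variance of the law tilted by [u]
    through the derivatives of [P]. *)
Lemma derive1_P_sum u : u != 0 ->
  u ^+ 2 * derive1 (P w) u = \sum_(j < D) phi j * u ^+ j * (j%:R - 1).
Proof.
move=> u0; rewrite derive1_P // /dP big_ord_recl /= expr0 mulr1 sub0r mulrN1.
rewrite mulrDr mulrCA divff ?mulr1 ?expf_neq0 //; congr (_ + _).
rewrite horner_deriv_poly mulr_sumr; apply: eq_bigr => j _.
rewrite /bump leq0n add1n -natr1 addrK.
by case: (j : nat) => [|i] /=; rewrite ?mulr0 // !exprS; ring.
Qed.

Lemma derive2_P_sum u : u != 0 ->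
  u ^+ 3 * derive1n 2 (P w) u =
  \sum_(j < D) phi j * u ^+ j * ((j%:R - 1) * (j%:R - 2)).
Proof.
move=> u0; rewrite derive2_P // /ddP big_ord_recl /= expr0 mulr1 !sub0r mulrNN mul1r.
rewrite mulrDr mulrCA divff ?mulr1 ?expf_neq0 //; congr (_ + _); first by ring.
rewrite horner_deriv2_poly mulr_sumr; apply: eq_bigr => j _.
rewrite /bump leq0n add1n; case: (j : nat) => [|[|i]] /=.
- by ring.
- by ring.
by rewrite -!natr1 !exprS; ring.
Qed.

(** Strict convexity of [P] on the positive half-line, the strictness being due to the pole at 0. *)
Lemma dP_mono x y : 0 < x -> x < y -> dP x < dP y.
Proof.
move=> x0 xy; have y0 := lt_trans x0 xy; apply: ltr_leD.
  rewrite ltr_nM2l ?oppr_lt0 ?phi0_gt0 // ltf_pV2 ?posrE ?exprn_gt0 //.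
  by rewrite ltrXn2r // ltW.
rewrite !horner_deriv_poly; apply: ler_sum => j _.
by rewrite ler_wpM2l ?phi_ge0 // ler_wpM2l ?ler0n // lerXn2r // ?nnegrE ltW.
Qed.

Lemma P_mvt x y : 0 < x -> x < y -> exists2 c, x < c < y & P w y - P w x = dP c * (y - x).
Proof.
move=> x0 xy.
have d z : z \in `]x, y[ -> is_derive z (1:R) (P w) (dP z).
  by rewrite in_itv /= => /andP[xz _]; apply: is_derive_P; rewrite gt_eqF // (lt_trans x0).
have cont : {within `[x, y], continuous (P w)}.
  apply: derivable_within_continuous => z; rewrite in_itv /= => /andP[xz _].
  by apply: ex_derive; apply: is_derive_P; rewrite gt_eqF // (lt_le_trans x0).
by have [c] := MVT xy d cont; rewrite in_itv => cxy E; exists c.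
Qed.

Variable tau : R.
Hypothesis htau : is_tau w tau.

Let tau0 : 0 < tau. Proof. by case: htau. Qed.

Lemma dP_tau : dP tau = 0.
Proof. by case: htau => t0; rewrite derive1_P // gt_eqF. Qed.

Lemma P_decr x y : 0 < x -> x < y -> y <= tau -> P w y < P w x.
Proof.
move=> x0 xy yt; have [c /andP[xc cy] E] := P_mvt x0 xy.
rewrite -subr_lt0 E pmulr_llt0 ?subr_gt0 // -dP_tau; apply: dP_mono; first exact: lt_trans xc.
exact: lt_le_trans yt.
Qed.

Lemma P_incr x y : tau <= x -> x < y -> P w x < P w y.
Proof.
move=> tx xy; have x0 := lt_le_trans tau0 tx; have [c /andP[xc cy] E] := P_mvt x0 xy.
rewrite -subr_gt0 E pmulr_lgt0 ?subr_gt0 // -dP_tau; apply: dP_mono => //.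
exact: le_lt_trans xc.
Qed.

Lemma P_gt0 u : 0 < u -> 0 < P w u.
Proof.
move=> u0; rewrite P_horner ltr_wpDr ?mulr_gt0 ?invr_gt0 ?phi0_gt0 //.
by rewrite horner_poly; apply: sumr_ge0 => j _; rewrite mulr_ge0 ?phi_ge0 // exprn_ge0 // ltW.
Qed.

Lemma P1 : P w 1 = 1.
Proof. 
have := P_sum (oner_neq0 R); rewrite mul1r => ->; rewrite -[RHS](sum_phi hw).
by apply: eq_bigr => j _; rewrite expr1n mulr1.
Qed.

Lemma drift_gt0 : 0 < drift w -> tau < 1.
Proof.
rewrite /drift derive1_P ?oner_neq0 // -dP_tau ltNge => H; rewrite ltNge; apply: contra H.
by rewrite le_eqVlt => /predU1P[<-//|t1]; apply/ltW/dP_mono.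
Qed.

Lemma drift_lt0 : drift w < 0 -> 1 < tau.
Proof.
rewrite /drift derive1_P ?oner_neq0 // -dP_tau ltNge => H; rewrite ltNge; apply: contra H.
by rewrite le_eqVlt => /predU1P[->//|t1]; apply/ltW/dP_mono.
Qed.

Lemma drift_eq0 : drift w = 0 -> tau = 1.
Proof.
rewrite /drift derive1_P ?oner_neq0 // => d1; apply/eqP; rewrite eq_le !leNgt.
apply/andP; split; apply/negP => t1.
  by have := dP_mono ltr01 t1; rewrite d1 dP_tau ltxx.
by have := dP_mono tau0 t1; rewrite d1 dP_tau ltxx.
Qed.

Lemma P_tau_le u : 0 < u -> P w tau <= P w u.
Proof.
move=> u0; have [ut|tu|<-//] := ltgtP u tau; first exact/ltW/P_decr.
exact/ltW/P_incr.
Qed.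

Section GeneratingFunction.
Variables (u z : R).
Hypotheses (u0 : 0 < u) (ut : u <= tau) (z0 : 0 < z) (zP : z * P w u = 1).

Let h k n := hit w n k * z ^+ n.

Let h_ge0 k n : 0 <= h k n.
Proof. by rewrite mulr_ge0 ?hit_ge0 // exprn_ge0 // ltW. Qed.

Let series_hS k N : series (h k.+1) N.+1 = z * \sum_(j < D) phi j * series (h (k + j)) N.
Proof.
rewrite /series/= big_nat_recl // /h /= mul0r add0r.
under eq_bigr do rewrite mulr_suml.
rewrite exchange_big mulr_sumr; apply: eq_bigr => j _ /=.
rewrite !mulr_sumr; apply: eq_bigr => n _; rewrite exprS /phi; ring.
Qed.

Let series_h0 N : series (h 0) N.+1 = 1.
Proof.
rewrite /series/= big_nat_recl // big1 ?addr0 => [|i _]; first by rewrite /h /= mul1r.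
by rewrite /h /= mul0r.
Qed.

(** By [z * P u = 1], the powers of [u] are a fixed point of the recursion for the truncated sums,
    so they dominate them. *)
Let h_le k N : series (h k) N <= u ^+ k.
Proof.
elim: N k => [|N IH] k; first by rewrite /series/= big_geq // exprn_ge0 // ltW.
case: k => [|k]; first by rewrite series_h0.
rewrite series_hS; apply: (@le_trans _ _ (z * \sum_(j < D) phi j * u ^+ (k + j))).
  by rewrite ler_wpM2l ?(ltW z0) //; apply: ler_sum => j _; rewrite ler_wpM2l ?phi_ge0.
under eq_bigr do rewrite exprD mulrCA.
by rewrite -mulr_sumr -P_sum ?gt_eqF // mulrCA mulrCA mulrC -!mulrA (mulrC (P w u)) zP mulr1 exprSr.
Qed.

Let h_cvg k : cvgn (series (h k)).
Proof.
apply: nondecreasing_is_cvgn; first by apply: series_homo.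
by exists (u ^+ k) => _ [n _ <-].
Qed.

Let x := limn (series (h 1)).

Let h_pow k : series (h k) @ \oo --> x ^+ k.
Proof.
elim: k => [|k IH].
  rewrite expr0 -(cvg_shiftS (series (h 0))).
  by under eq_fun do rewrite series_h0; exact: cvg_cst.
have -> : h k.+1 = conv (h k) (h 1).
  by apply/funext => n; rewrite conv_expz /h -(addn1 k) hit_add.
by rewrite exprSr; apply: cvg_series_conv => //; exact: h_cvg.
Qed.

(** By [hit_add] the limits are the powers of the limit [x] for [k = 1]. The one-step recursion
    gives [z * P x = 1] with [0 < x <= u <= tau], where [P] is strictly decreasing; hence
    [x = u]. *)
Lemma hit_series k : series (fun n => hit w n k * z ^+ n) @ \oo --> u ^+ k.
Proof.
suff xu : x = u by have := @h_pow k; rewrite xu.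
have xle : x <= u.
  by apply: limr_le; [exact: h_cvg | near=> n; rewrite -[u]expr1; exact: h_le].
have x0 : 0 < x.
  apply: (@lt_le_trans _ _ (series (h 1) 2)); last first.
    by apply: nondecreasing_cvgn_le; [exact: series_homo | exact: h_cvg].
  rewrite series_hS mulr_gt0 //; rewrite big_ord_recl ltr_wpDr //.
    by apply: sumr_ge0 => j _; rewrite mulr_ge0 ?phi_ge0 // sumr_ge0.
  by rewrite mulr_gt0 ?phi0_gt0 // series_h0.
have E : x = z * \sum_(j < D) phi j * x ^+ j.
  have c1 : series (h 1) N.+1 @[N --> \oo] --> x by rewrite (cvg_shiftS (series (h 1))); exact: h_cvg.
  rewrite -[LHS](cvg_lim (@Rhausdorff R) c1); apply/cvg_lim => //.
  under eq_fun do rewrite series_hS.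
  apply: cvgMl_tmp; apply: (@cvg_sumr R _ _ _ D (fun j N => phi j * series (h (0 + j)) N) (fun j => phi j * x ^+ j)) => j.
  by apply: cvgMl_tmp; exact: h_pow.
have zPx : z * P w x = 1.
  apply: (mulfI (lt0r_neq0 x0)); rewrite mulr1 mulrCA P_sum ?gt_eqF //.
apply/eqP; rewrite eq_le xle /= leNgt; apply/negP => xu.
have := P_decr x0 xu ut; rewrite -(ltr_pM2l z0) zP zPx ltxx //.
Unshelve. all: by end_near. Qed.

Lemma arch_series : series (fun n => arch w n * z ^+ n) @ \oo --> z * P0ge w u.
Proof.
rewrite -(cvg_shiftS (series _)) /=.
have -> : (fun N => series (fun n => arch w n * z ^+ n) N.+1) =
   (fun N => z * \sum_(i < (deg0 w).+1) wt0 w i%:Z * series (h i) N).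
  apply/funext => N; rewrite /series/= big_nat_recl // mul0r add0r.
  under eq_bigr do rewrite mulr_suml.
  rewrite exchange_big mulr_sumr; apply: eq_bigr => i _ /=.
  by rewrite !mulr_sumr; apply: eq_bigr => n _; rewrite exprS /h; ring.
apply: cvgMl_tmp.
apply: (@cvg_sumr R _ _ _ _ (fun i N => wt0 w i%:Z * series (h i) N) (fun i => wt0 w i%:Z * u ^+ i)) => i.
by apply: cvgMl_tmp; exact: hit_series.
Qed.

End GeneratingFunction.

End SmallBranch.

(** * Asymptotics of the arches by exponential tilting *)

Section ArchAsymptotics.
Variables (R : realType) (w : walk R) (tau : R).
Hypotheses (hw : lukasiewicz w) (hw0 : boundary_weights w) (haper : aperiodic w)
  (htau : is_tau w tau).

Let phi (j : nat) : R := wt w (j%:Z - 1).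
Let D := (deg w).+2.
Let Phi := \poly_(j < D) phi j.
Let c := tau * P w tau.
(** The law tilted by [tau], which is centred because [P'(tau) = 0]. *)
Let r j := phi j * tau ^+ j / c.
Let Q := \poly_(j < D) r j.

Let tau0 : 0 < tau. Proof. by case: htau. Qed.
Let taun0 : tau != 0. Proof. by rewrite gt_eqF. Qed.
Let Pt0 : 0 < P w tau. Proof. exact: P_gt0. Qed.
Let c0 : 0 < c. Proof. by rewrite mulr_gt0. Qed.
Let phi_ge0 j : 0 <= phi j. Proof. exact: phi_ge0. Qed.

Lemma derive2_P_gt0 : 0 < derive1n 2 (P w) tau.
Proof.
rewrite -(pmulr_rgt0 _ (exprn_gt0 3 tau0)) derive2_P_sum //.
rewrite big_ord_recl ltr_wpDr //.
  apply: sumr_ge0 => j _; apply: mulr_ge0.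
    by rewrite mulr_ge0 ?phi_ge0 // exprn_ge0 // ltW.
  rewrite lift0; case: (j : nat) => [|i]; first by rewrite subrr mul0r.
  by rewrite mulr_ge0 // subr_ge0 ?ler1n // ler_nat.
rewrite /= expr0 mulr1 mulr_gt0 ?(phi0_gt0 hw) //; lra.
Qed.

Let s2 := tau ^+ 2 * derive1n 2 (P w) tau / P w tau.

Let s20 : 0 < s2.
Proof. by rewrite /s2 divr_gt0 ?mulr_gt0 ?exprn_gt0 ?derive2_P_gt0. Qed.

Let mean0 : \sum_(j < D) phi j * tau ^+ j * (j%:R - 1) = 0.
Proof. by rewrite -derive1_P_sum //; case: htau => _ ->; rewrite mulr0. Qed.

Let r_ge0 j : 0 <= r j.
Proof. by rewrite divr_ge0 ?(ltW c0) // mulr_ge0 // exprn_ge0 // ltW. Qed.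

Let r0_gt0 : 0 < r 0%N.
Proof. by rewrite /r expr0 mulr1 divr_gt0 // (phi0_gt0 hw). Qed.

Let r_sum : \sum_(j < D) r j = 1.
Proof. by rewrite -mulr_suml -P_sum // divff // gt_eqF. Qed.

Let r_mean : \sum_(j < D) r j * (j%:R - 1) = 0.
Proof. by under eq_bigr do rewrite /r mulrAC; rewrite -mulr_suml mean0 mul0r. Qed.

Let r_var : \sum_(j < D) r j * (j%:R - 1) ^+ 2 = s2.
Proof.
under eq_bigr do rewrite /r mulrAC.
rewrite -mulr_suml.
have -> : \sum_(j < D) phi j * tau ^+ j * (j%:R - 1) ^+ 2 = tau ^+ 3 * derive1n 2 (P w) tau.
  rewrite derive2_P_sum // -[RHS]addr0 -[X in _ = _ + X]mean0 -big_split; apply: eq_bigr => j _ /=.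
  by rewrite /phi; ring.
by rewrite /s2 /c; field; rewrite taun0 gt_eqF.
Qed.

(** If [q] divided the whole support, dividing the exponents of [u * P u] by [q] would produce the
    excluded polynomial [H]. *)
Let r_aper q : (1 < q)%N -> exists2 j, (j < D)%N & (r j != 0) && ~~ (q %| j)%N.
Proof.
move=> q1; apply: contrapT => H; apply: haper.
have qphi j : (j < D)%N -> phi j != 0 -> (q %| j)%N.
  move=> jD pj; apply: contrapT => /negP qj; apply: H; exists j => //.
  by rewrite qj andbT /r !mulf_eq0 !negb_or pj invr_eq0 (gt_eqF c0) expf_neq0.
exists q, (\sum_(j < D) phi j *: 'X^(j %/ q)); split => // u u0.
apply: (mulfI u0); rewrite mulVKf // P_sum // horner_sum; apply: eq_bigr => j _.
rewrite -/(phi j) hornerZ hornerXn -exprM; have [->|pj] := eqVneq (phi j) 0; first by rewrite !mul0r.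
by rewrite mulnC divnK // qphi.
Qed.

Let coef_QX n m : (Q ^+ n)`_m = (Phi ^+ n)`_m * tau ^+ m / c ^+ n.
Proof.
elim: n m => [|n IH] m.
  by rewrite !expr0 divr1 coef1; case: m => [|m]; rewrite ?mulr1 ?mul0r.
rewrite !exprS !coefM !mulr_suml; apply: eq_bigr => j _; have jm : (j <= m)%N by rewrite -ltnS.
rewrite IH /Q /Phi !coef_poly; case: ifP => _; last by rewrite !mul0r.
have -> : tau ^+ m = tau ^+ j * tau ^+ (m - j) by rewrite -exprD subnKC.
by rewrite /r (invfM c (c ^+ n)); ring.
Qed.

Let rt n : R := Num.sqrt n%:R.

(** Kemperman's formula turns first passages into coefficients of [Phi ^+ n]. Undoing the tilt
    leaves the factor [tau ^+ k] and the scale [(P tau) ^+ n]. *)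
Lemma hit_asymptotics k :
  n%:R * rt n * (hit w n k * (P w tau)^-1 ^+ n) @[n --> \oo]
    --> k%:R * tau ^+ k * (Num.sqrt (2 * pi * s2))^-1.
Proof.
have L := local_limit r_ge0 r0_gt0 r_sum r_mean r_var s20 r_aper k.
have H : k%:R * tau ^+ k * (rt n * (Q ^+ n)`_(n - k)%N) @[n --> \oo]
    --> k%:R * tau ^+ k * (Num.sqrt (2 * pi * s2))^-1 by exact: cvgMl_tmp.
apply: cvg_trans H; apply: near_eq_cvg; near=> n.
have kn : (k <= n)%N by near: n; exists k.
rewrite -/Q coef_QX.
have -> : n%:R * rt n * (hit w n k * (P w tau)^-1 ^+ n) = rt n * (n%:R * hit w n k) * (P w tau)^-1 ^+ n.
  by ring.
rewrite hit_coef // kn -/Phi /c exprMn.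
have -> : tau ^+ n = tau ^+ k * tau ^+ (n - k) by rewrite -exprD subnKC.
rewrite exprVn; field.
by rewrite !expf_neq0 ?gt_eqF.
Unshelve. all: by end_near. Qed.

Let derive1_P0ge : derive1 (P0ge w) tau = \sum_(i < (deg0 w).+1) wt0 w i%:Z * (i%:R * tau ^+ i.-1).
Proof.
rewrite -(horner_deriv_poly (deg0 w).+1 (fun i => wt0 w i%:Z)) derivE; congr (derive1 _ tau).
by apply/funext => u; rewrite P0ge_horner.
Qed.

Lemma derive1_P0ge_gt0 : leaves_zero w -> 0 < derive1 (P0ge w) tau.
Proof.
have [w0 wout _] := hw0; move=> [i i0 wi]; rewrite derive1_P0ge.
have id : (i < (deg0 w).+1)%N.
  rewrite ltnS leqNgt; apply/negP => H; move: wi; rewrite wout ?eqxx //.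
  by apply/negP => /andP[_]; lia.
rewrite (bigD1 (Ordinal id)) //= ltr_wpDr //.
  by apply: sumr_ge0 => j _; rewrite !mulr_ge0 // exprn_ge0 // ltW.
by rewrite !mulr_gt0 ?ltr0n ?exprn_gt0 // lt_def w0 wi.
Qed.

Lemma Cconst_gt0 : 0 < Cconst w tau.
Proof. by rewrite sqrtr_gt0 divr_gt0 ?mulr_gt0 // derive2_P_gt0. Qed.

Lemma kappa_gt0 : leaves_zero w -> 0 < kappa w tau.
Proof. by move=> lz; rewrite !mulr_gt0 ?Cconst_gt0 ?invr_gt0 // derive1_P0ge_gt0. Qed.

Lemma arch_asymptotics :
  n%:R * rt n * (arch w n * rho w tau ^+ n) @[n --> \oo] --> kappa w tau / (2 * Num.sqrt pi).
Proof.
have E : kappa w tau / (2 * Num.sqrt pi) =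
   (P w tau)^-1 * \sum_(i < (deg0 w).+1) wt0 w i%:Z * (i%:R * tau ^+ i * (Num.sqrt (2 * pi * s2))^-1).
  (* Here [s2 = tau^2 P''(tau) / P(tau)]; this is where [C] of the statement arises from the
     Gaussian constant. *)
  have C : Cconst w tau / (2 * Num.sqrt pi) = tau * (Num.sqrt (2 * pi * s2))^-1.
    have p0 := pi_gt0 R; have d0 := derive2_P_gt0.
    have X0 : 0 < Num.sqrt (2 * pi * s2) by rewrite sqrtr_gt0 mulr_gt0 // mulr_gt0.
    have Y0 : 0 < Num.sqrt pi :> R by rewrite sqrtr_gt0.
    have Y2 : 2 * Num.sqrt pi != 0 :> R by rewrite mulf_neq0 // gt_eqF.
    apply/eqP; rewrite eqr_div ?Y2 ?(lt0r_neq0 X0) //.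
    have -> : tau * (2 * Num.sqrt pi) = Num.sqrt (tau ^+ 2 * 4 * pi).
      have h : 0 < tau * (2 * Num.sqrt pi) by rewrite mulr_gt0 // mulr_gt0.
      rewrite -[LHS](gtr0_norm h) -sqrtr_sqr; congr Num.sqrt.
      by rewrite !exprMn sqr_sqrtr ?pi_ge0 // mulrA; congr (_ * _ * _); ring.
    rewrite -sqrtrM ?divr_ge0 ?mulr_ge0 ?(ltW Pt0) ?(ltW d0) //; apply/eqP; congr Num.sqrt.
    by rewrite /s2; move: (pi : R) => p; field; rewrite !gt_eqF.
  rewrite /kappa /rho; move: (Cconst w tau) C => cc C.
  rewrite (_ : _ / _ = (P w tau)^-1 * (cc / (2 * Num.sqrt pi) * derive1 (P0ge w) tau)); last by ring.
  rewrite C derive1_P0ge; congr (_ * _); rewrite mulr_sumr; apply: eq_bigr => i _.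
  by case: (i : nat) => [|j] /=; rewrite ?mul0r ?mulr0 ?mul0r // exprS; ring.
rewrite E -(cvg_shiftS (fun n => n%:R * rt n * (arch w n * rho w tau ^+ n))).
have R1 := @cvg_sqrt_pow3_ratio R.
have R2 : (P w tau)^-1 * \sum_(i < (deg0 w).+1) wt0 w i%:Z * (n%:R * rt n * (hit w n i * (P w tau)^-1 ^+ n))
   @[n --> \oo] --> (P w tau)^-1 * \sum_(i < (deg0 w).+1) wt0 w i%:Z * (i%:R * tau ^+ i * (Num.sqrt (2 * pi * s2))^-1).
  apply: cvgMl_tmp.
  apply: (@cvg_sumr R _ _ _ _ (fun i n => wt0 w i%:Z * (n%:R * rt n * (hit w n i * (P w tau)^-1 ^+ n)))
    (fun i => wt0 w i%:Z * (i%:R * tau ^+ i * (Num.sqrt (2 * pi * s2))^-1))) => i.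
  by apply: cvgMl_tmp; exact: hit_asymptotics.
have H : (n.+1%:R * rt n.+1) / (n%:R * rt n) * ((P w tau)^-1 *
    \sum_(i < (deg0 w).+1) wt0 w i%:Z * (n%:R * rt n * (hit w n i * (P w tau)^-1 ^+ n)))
    @[n --> \oo] --> 1 * ((P w tau)^-1 *
    \sum_(i < (deg0 w).+1) wt0 w i%:Z * (i%:R * tau ^+ i * (Num.sqrt (2 * pi * s2))^-1)).
  exact: cvgM.
rewrite !mul1r in H; apply: cvg_trans H; apply: near_eq_cvg; near=> n.
have n0 : (0 < n)%N by near: n; exists 1%N.
have r0 : 0 < n%:R * rt n by rewrite mulr_gt0 ?sqrtr_gt0 ?ltr0n.
rewrite /= /rho exprS !mulr_suml !mulr_sumr; apply: eq_bigr => i _.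
move: r0; move: (n%:R * rt n) => X r0; field.
by rewrite !gt_eqF.
Unshelve. all: by end_near. Qed.

End ArchAsymptotics.

(** * Differentiated power series and mean waiting times *)

Section PowerSeriesMean.
Variable R : realType.
Implicit Types a : nat -> R.

Lemma bernoulli_pow (x y : R) n : 0 <= x -> x <= y ->
  x ^+ n + n%:R * x ^+ n.-1 * (y - x) <= y ^+ n.
Proof.
move=> x0 xy; have y0 := le_trans x0 xy; have d0 : 0 <= y - x by rewrite subr_ge0.
elim: n => [|n IH]; first by rewrite !expr0 mul0r mul0r addr0.
rewrite [leRHS]exprS; apply: le_trans (ler_wpM2l y0 IH).
case: n {IH} => [|n] /=; first by rewrite !expr0 expr1; lra.
rewrite -[n.+2%:R]natr1 !exprS; set N := n.+1%:R; set X := x ^+ n.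
have N0 : 0 <= N by exact: ler0n.
have X0 : 0 <= X by exact: exprn_ge0.
have H : 0 <= N * X * (y - x) ^+ 2 by rewrite mulr_ge0 ?sqr_ge0 // mulr_ge0.
by rewrite -subr_ge0 (_ : _ - _ = N * X * (y - x) ^+ 2) //; ring.
Qed.

(** Bernoulli's inequality gives [n.+1 * x ^+ n * (y - x) <= y ^+ n.+1], so the series at [y]
    dominates. *)
Lemma is_cvg_pseries_diffs a (x y : R) : (forall n, 0 <= a n) -> 0 < x -> x < y ->
  cvgn (pseries a y) -> cvgn (pseries (pseries_diffs a) x).
Proof.
move=> a0 x0 xy cy; have d0 : 0 < y - x by rewrite subr_gt0.
have y0 := lt_trans x0 xy.
apply: (@series_le_cvg _ _ (fun n => (y - x)^-1 * (a n.+1 * y ^+ n.+1))).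
- by move=> n; rewrite !mulr_ge0 ?exprn_ge0 ?(ltW x0).
- by move=> n; rewrite !mulr_ge0 ?invr_ge0 ?exprn_ge0 ?(ltW d0) ?(ltW y0).
- move=> n; rewrite /pseries_diffs ler_pdivlMl // mulrC -!mulrA mulrCA ler_wpM2l //.
  have := bernoulli_pow n.+1 (ltW x0) (ltW xy); rewrite /= mulrA.
  by have : 0 <= x ^+ n.+1 by [rewrite exprn_ge0 // ltW]; lra.
have -> : series (fun n => (y - x)^-1 * (a n.+1 * y ^+ n.+1)) =
   fun N => (y - x)^-1 * (pseries a y N.+1 - a 0%N).
  apply/funext => N; rewrite /pseries /series/= -mulr_sumr; congr (_ * _).
  by rewrite big_nat_recl //= expr0 mulr1 addrAC subrr add0r.
apply: is_cvgMl_tmp; apply: is_cvgB; last exact: is_cvg_cst.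
by move/cvg_ex: cy => [l cl]; apply/cvg_ex; exists l; rewrite (cvg_shiftS (pseries a y)).
Qed.

(** Summation by parts; the boundary term [N * (1 - series b N)] is at most the remainder of the
    series of the mean. *)
Lemma tail_series_mean (b : nat -> R) (mu : R) : (forall n, 0 <= b n) ->
  series b @ \oo --> (1:R) -> series (fun n => n%:R * b n) @ \oo --> mu ->
  series (fun n => 1 - series b n.+1) @ \oo --> mu.
Proof.
move=> b0 b1 bmu.
have nb0 n : 0 <= n%:R * b n by rewrite mulr_ge0.
have sb := series_le_lim b0 b1.
have E N : series (fun n => 1 - series b n.+1) N =
   N%:R * (1 - series b N) + series (fun n => n%:R * b n) N.
  elim: N => [|N IH]; first by rewrite /series/= !big_geq // mul0r addr0.
  by rewrite seriesSr IH (seriesSr (fun n => n%:R * b n)) (seriesSr b) -natr1; ring.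
rewrite (funext E) -[mu]add0r; apply: cvgD => //.
apply: (@squeeze_cvgr _ _ _ _ (fun=> 0) (fun N => mu - series (fun n => n%:R * b n) N)).
- near=> N; rewrite mulr_ge0 ?subr_ge0 //=.
  have c1 : N%:R * (series b M - series b N) @[M --> \oo] --> N%:R * (1 - series b N).
    by apply: cvgMl_tmp; apply: cvgB => //; exact: cvg_cst.
  have c2 : series (fun n => n%:R * b n) M - series (fun n => n%:R * b n) N @[M --> \oo]
     --> mu - series (fun n => n%:R * b n) N by apply: cvgB => //; exact: cvg_cst.
  rewrite -(cvg_lim (@Rhausdorff R) c1) -(cvg_lim (@Rhausdorff R) c2).
  apply: ler_lim; [exact: cvgP c1 | exact: cvgP c2 |]; near=> M.
  have NM : (N <= M)%N by near: M; exists N.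
  rewrite !sub_series_geq // mulr_sumr !big_nat; apply: ler_sum => i /andP[Ni _].
  by rewrite ler_wpM2r // ler_nat.
- exact: cvg_cst.
- by rewrite -(subrr mu); apply: cvgB => //; exact: cvg_cst.
Unshelve. all: by end_near. Qed.

End PowerSeriesMean.

(** * The small branch on the interval up to rho *)

Section Branch.
Variables (R : realType) (w : walk R) (tau : R) (u1 : R -> R).
Hypotheses (hw : lukasiewicz w) (hw0 : boundary_weights w)
  (htau : is_tau w tau) (hu1 : is_small_branch w (rho w tau) u1).

Let tau0 : 0 < tau. Proof. by case: htau. Qed.
Let Pt0 : 0 < P w tau. Proof. exact: P_gt0. Qed.

Lemma rho_gt0 : 0 < rho w tau.
Proof. by rewrite invr_gt0. Qed.

(** [P] is negative at small negative arguments, because of its pole, whereas [z * P (u1 z) = 1]; so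
    small values of [u1] are positive. *)
Lemma small_branch_near0 : exists2 d, 0 < d &
  forall z, 0 < z <= rho w tau -> z < d -> 0 < u1 z < tau.
Proof.
have [hz _ u0] := hu1.
pose phi0 := wt w (0%:Z - 1); have p0 : 0 < phi0 := phi0_gt0 hw.
(* For negative [u] with [|u| < e], the polar term is at most -1 by [e <= phi0], and the rest is at
   most [1 - phi0] by [e <= 1]. *)
pose e := Num.min tau (Num.min 1 phi0).
have e0 : 0 < e by rewrite !lt_min tau0 ltr01 p0.
have et : e <= tau by rewrite ge_min lexx.
have e1 : e <= 1 by rewrite !ge_min lexx orbT.
have ep : e <= phi0 by rewrite !ge_min lexx !orbT.
have /cvgrPdist_lt/(_ e e0) [d /= d0 Hd] := u0.
exists d => // z zr zd; have /andP[z0 _] := zr.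
have : `|u1 z| < e.
  have := Hd z; rewrite /= sub0r normrN gtr0_norm // sub0r normrN; exact.
have [un0 zP] := hz z zr.
move=> ue; rewrite (lt_le_trans (le_lt_trans (ler_norm _) ue)) // andbT.
rewrite lt_def un0 /= leNgt; apply/negP => un.
have Ppos : 0 < P w (u1 z).
  have : 0 < z * P w (u1 z) by move/eqP: zP; rewrite subr_eq0 => /eqP <-.
  by rewrite pmulr_rgt0.
move: Ppos; apply/negP; rewrite -leNgt P_horner -/phi0.
have n0 : 0 < `|u1 z| by rewrite normr_gt0.
have A : phi0 * (u1 z)^-1 <= - 1.
  rewrite -[u1 z]opprK -(ltr0_norm un) invrN mulrN lerN2 ler_pdivlMr // mul1r.
  exact: le_trans (ltW ue) ep.
have B : (\poly_(j < (deg w).+1) wt w (j.+1%:Z - 1)).[u1 z] <= 1 - phi0.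
  have -> : 1 - phi0 = \sum_(j < (deg w).+1) wt w (j.+1%:Z - 1).
    by rewrite -(sum_phi hw) big_ord_recl addrAC subrr add0r.
  rewrite horner_poly; apply: ler_sum => j _.
  rewrite ler_piMr ?phi_ge0 //; apply: le_trans (ler_norm _) _.
  by rewrite normrX exprn_ile1 //; apply: le_trans (ltW ue) e1.
by have := lerD A B; lra.
Qed.

(** By the intermediate value theorem from a point near 0: [u1] never vanishes, and it can take the
    value [tau] only at [z = rho], the end of the interval. *)
Lemma small_branch_range z : 0 < z <= rho w tau -> 0 < u1 z <= tau.
Proof.
have [hz cu _] := hu1; have [d d0 Hd] := small_branch_near0 => zr.
have /andP[z0 zrho] := zr.
pose z1 := Num.min z (d / 2).
have z10 : 0 < z1 by rewrite lt_min z0 divr_gt0.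
have z1z : z1 <= z by rewrite ge_min lexx.
have z1r : 0 < z1 <= rho w tau by rewrite z10 (le_trans z1z).
have z1d : z1 < d by rewrite gt_min; apply/orP; right; lra.
have /andP[u10 u1t] := Hd z1 z1r z1d.
have cont : {within `[z1, z], continuous u1}.
  apply: continuous_subspaceW cu => x /=; rewrite !in_itv /= => /andP[zx xz].
  by rewrite (lt_le_trans z10) //= (le_trans xz).
have inr c : c \in `[z1, z] -> 0 < c <= rho w tau.
  by rewrite in_itv /= => /andP[zc cz]; rewrite (lt_le_trans z10) //= (le_trans cz).
have [un0 zP] := hz z zr; apply/andP; split.
  rewrite lt_def un0 /= leNgt; apply/negP => un.
  have [|c cz uc] := @IVT R u1 z1 z 0 z1z cont.
    by rewrite ge_min le_max (ltW un) (ltW u10) orbT.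
  by have [] := hz c (inr c cz); rewrite uc eqxx.
rewrite leNgt; apply/negP => ut.
have [|c cz uc] := @IVT R u1 z1 z tau z1z cont.
  by rewrite ge_min le_max (ltW ut) (ltW u1t) orbT.
have [_ cP] := hz c (inr c cz); rewrite uc in cP.
have cr : c = rho w tau.
  apply: (mulIf (lt0r_neq0 Pt0)); rewrite mulVf ?gt_eqF //.
  by move/eqP: cP; rewrite subr_eq0 => /eqP.
have zc : z = c.
  by apply/eqP; rewrite eq_le {1}cr zrho /=; move: cz; rewrite in_itv /= => /andP[].
by rewrite zc uc ltxx in ut.
Qed.

Lemma small_branch_eq z : 0 < z <= rho w tau -> z * P w (u1 z) = 1.
Proof.
by have [hz _ _] := hu1; move=> /hz [_ /eqP]; rewrite subr_eq0 => /eqP.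
Qed.

Lemma small_branch_rho : u1 (rho w tau) = tau.
Proof.
have rr : 0 < rho w tau <= rho w tau by rewrite rho_gt0 lexx.
have /andP[u0 ut] := small_branch_range rr.
apply/eqP; rewrite eq_le ut /= leNgt; apply/negP => lt.
have := P_decr hw htau u0 lt (lexx _); have := small_branch_eq rr.
by rewrite /rho => /(canRL (mulVKf (lt0r_neq0 Pt0))); rewrite mulr1 => ->; rewrite ltxx.
Qed.

(** The arches have the generating function [B(z) = z * P0ge (u1 z)]. Differentiating [B(z) / z] at
    [rho1], where [B = 1], gives [alpha * rho1 ^+ 2 + 1 = rho1 * B'(rho1)], which is the mean. *)
Lemma arch_mean (rho1 : R) : 0 < rho1 < rho w tau -> rho1 * P0ge w (u1 rho1) = 1 ->
  series (fun n => n%:R * (arch w n * rho1 ^+ n)) @ \oo --> alpha w u1 rho1 * rho1 ^+ 2 + 1.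
Proof.
move=> /andP[r0 rr] r1P.
have arch0 := arch_ge0 hw hw0.
have diffs0 (a : nat -> R) : (forall n, 0 <= a n) -> forall n, 0 <= pseries_diffs a n.
  by move=> a0 n; rewrite mulr_ge0.
have cr : cvgn (pseries (arch w) (rho w tau)).
  have := @arch_series _ _ hw _ htau tau (rho w tau) tau0 (lexx _) rho_gt0.
  by rewrite mulVf ?gt_eqF // => /(_ erefl) /cvgP.
(* Each differentiation of the series costs a smaller radius, and two derived series must converge
   beyond [rho1]. *)
pose K1 := (rho1 + rho w tau) / 2; pose K := (rho1 + K1) / 2.
have r1K : rho1 < K by rewrite /K /K1; lra.
have K0 : 0 < K by exact: lt_trans r1K.
have KK1 : K < K1 by rewrite /K /K1; lra.
have K1r : K1 < rho w tau by rewrite /K1; lra.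
have K10 : 0 < K1 := lt_trans K0 KK1.
have cd1 := is_cvg_pseries_diffs arch0 K10 K1r cr.
have cd2 := is_cvg_pseries_diffs (diffs0 _ arch0) K0 KK1 cd1.
have cd1' : cvgn (pseries (pseries_diffs (arch w)) K).
  by apply: is_cvg_pseries_inside cd1 _; rewrite !gtr0_norm.
have c0 : cvgn (pseries (arch w) K).
  by apply: is_cvg_pseries_inside cr _; rewrite !gtr0_norm ?rho_gt0 // (lt_trans KK1).
have rK : `|rho1| < `|K| by rewrite !gtr0_norm.
have dB := pseries_snd_diffs c0 cd1' cd2 rK.
have cdr : cvgn (pseries (pseries_diffs (arch w)) rho1).
  exact: is_cvg_pseries_inside cd1' rK.
set B' := limn (pseries (pseries_diffs (arch w)) rho1) in dB cdr *.
have Bz z : 0 < z < rho w tau -> limn (pseries (arch w) z) = z * P0ge w (u1 z).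
  move=> /andP[z0 zr]; have zr' : 0 < z <= rho w tau by rewrite z0 ltW.
  have /andP[u0 ut] := small_branch_range zr'.
  apply/cvg_lim => //; apply: (arch_series hw htau) => //.
  exact: small_branch_eq.
have dinv : is_derive rho1 (1:R) (fun z : R => z^-1) (- rho1 ^- 2 *: 1) :=
  is_deriveV (lt0r_neq0 r0) (is_derive_id rho1 (1:R)).
have dA := is_deriveM dB dinv.
have al : alpha w u1 rho1 = B' / rho1 - rho1 ^- 2.
  rewrite /alpha derive1E.
  have -> : 'D_1 (fun z : R => P0ge w (u1 z)) rho1 =
     'D_1 ((fun z => limn (pseries (arch w) z)) * (fun z : R => z^-1)) rho1.
    apply: near_eq_derive; near=> z.
    have zr : 0 < z < rho w tau by apply/andP; split; near: z; [exact: lt_nbhsr | exact: lt_nbhsl].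
    by rewrite -[RHS]/(limn (pseries (arch w) z) * z^-1) Bz // mulrAC divff ?mul1r // gt_eqF //; case/andP: zr.
  rewrite (@derive_val _ _ _ _ _ _ _ dA) Bz ?r0 // r1P /GRing.scale /=.
  by field; rewrite gt_eqF.
have -> : alpha w u1 rho1 * rho1 ^+ 2 + 1 = rho1 * B'.
  by rewrite al; field; rewrite gt_eqF.
rewrite -(cvg_shiftS (series _)) /=.
have -> : (fun N => series (fun n => n%:R * (arch w n * rho1 ^+ n)) N.+1) =
  (fun N => rho1 * pseries (pseries_diffs (arch w)) rho1 N).
  apply/funext => N; rewrite /pseries /series/= big_nat_recl // mul0r add0r mulr_sumr.
  by apply: eq_bigr => n _; rewrite /pseries_diffs exprS; ring.
exact: cvgMl_tmp.
Unshelve. all: by end_near. Qed.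

End Branch.

(** * Meanders *)

Section Equivalents.
Variable R : realType.
Implicit Types f g m d v : nat -> R.

Lemma equiv_of_ratio f g (c : R) : c != 0 -> (\forall n \near \oo, g n != 0) ->
  f n / g n @[n --> \oo] --> c -> f ~_\oo (fun n => c * g n).
Proof.
move=> c0 g0 fg; apply/eqaddoP => eps eps0.
have /cvgrPdist_le/(_ (eps * `|c|)) := fg; rewrite mulr_gt0 ?normr_gt0 // => /(_ isT) H.
near=> n; have gn : g n != 0 by near: n.
have : `|c - f n / g n| <= eps * `|c| by near: n.
rewrite -(@ler_pM2r _ `|g n|) ?normr_gt0 // -normrM mulrBl divfK //.
by rewrite distrC normrM mulrA.
Unshelve. all: by end_near. Qed.

(** The factor [v] varies slowly, so the decrements of [x ^- n / v n] are equivalent to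
    [(1 - 1 / x)] times it, whence the constant [x / (x - 1)] by Stolz-Cesaro. *)
Lemma geometric_tail m v (x c l : R) : 1 < x -> m @ \oo --> (0:R) ->
  (m n - m n.+1) * x ^+ n * v n @[n --> \oo] --> c ->
  (\forall n \near \oo, 0 < v n) -> v n / v n.+1 @[n --> \oo] --> (1:R) ->
  (v n)^-1 @[n --> \oo] --> l ->
  m n / (x ^- n / v n) @[n --> \oo] --> c * x / (x - 1).
Proof.
move=> x1 m0 mc v0 vr vl; have x0 : 0 < x by exact: lt_trans x1.
have xi : `|x^-1| < 1 by rewrite gtr0_norm ?invr_gt0 // invf_lt1.
have vS : \forall n \near \oo, 0 < v n.+1.
  by case: v0 => N _ HN; exists N => // n /= Nn; apply: HN; exact: leqW.
apply: stolz => //.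
- rewrite -(mul0r l); under eq_fun do rewrite -exprVn.
  by apply: cvgM => //; exact: cvg_expr.
- have /cvgrPdist_lt/(_ (x - 1)) := vr; rewrite subr_gt0 => /(_ x1) H.
  near=> n; have vn : 0 < v n by near: n.
  have vn1 : 0 < v n.+1 by near: n.
  have : `|1 - v n / v n.+1| < x - 1 by near: n.
  rewrite ltr_norml => /andP[h _].
  have h2 : v n < x * v n.+1 by rewrite -ltr_pdivrMr //; lra.
  rewrite -!exprVn exprS (_ : _ / v n.+1 = x^-1 ^+ n * (x * v n.+1)^-1); last by rewrite invfM; ring.
  by rewrite ltr_pM2l ?exprn_gt0 ?invr_gt0 // ltf_pV2 ?posrE ?mulr_gt0.
have x10 : 1 - x^-1 * 1 != 0 by rewrite mulr1 subr_eq0 eq_sym invr_eq1 gt_eqF.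
have H : ((m n - m n.+1) * x ^+ n * v n) / (1 - x^-1 * (v n / v n.+1)) @[n --> \oo]
    --> c / (1 - x^-1 * 1).
  apply: cvgM => //; apply: cvgV => //; apply: cvgB; first exact: cvg_cst.
  exact: cvgMl_tmp.
have -> : c * x / (x - 1) = c / (1 - x^-1 * 1).
  by field; rewrite gt_eqF // subr_eq0 gt_eqF.
apply: cvg_trans H; apply: near_eq_cvg; near=> n.
have vn : 0 < v n by near: n.
have vn1 : 0 < v n.+1 by near: n.
have -> : x ^- n / v n - x ^- n.+1 / v n.+1 = (1 - x^-1 * (v n / v n.+1)) / (x ^+ n * v n).
  rewrite exprS; field; rewrite !gt_eqF ?exprn_gt0 //.
by rewrite invf_div; ring.
Unshelve. all: by end_near. Qed.

End Equivalents.

(** * The five asymptotic regimes *)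

Section Meanders.
Variables (R : realType) (w : walk R) (tau : R) (u1 : R -> R).
Hypotheses (hw : lukasiewicz w) (hw0 : boundary_weights w) (haper : aperiodic w)
  (habs : absorption w) (htau : is_tau w tau) (hu1 : is_small_branch w (rho w tau) u1).

Let q := 1 - P0ge w 1.
Let q0 : 0 < q. Proof. by rewrite subr_gt0. Qed.
Let tau0 : 0 < tau. Proof. by case: htau. Qed.
Let Pt0 : 0 < P w tau. Proof. exact: P_gt0. Qed.
Let rt n : R := Num.sqrt n%:R.

Let exc_scaled (z : R) n : exc w n * z ^+ n = delta R n +
  conv (fun k => arch w k * z ^+ k) (fun k => exc w k * z ^+ k) n.
Proof.
rewrite {1}exc_renewal conv_expz mulrDl; congr (_ + _).
by case: n => [|n]; rewrite /delta /= ?mul0r // mulr1.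
Qed.

Let EgfE (z : R) : Egf w z = limn (series (fun n => exc w n * z ^+ n)).
Proof.
rewrite /Egf /pseries; congr (limn (series _)); apply/funext => n.
by rewrite /= (excursions_evol hw hw0).
Qed.

Let meanders_mea : meanders w = mea w.
Proof. by apply/funext => n; exact: meanders_evol. Qed.

Let arch_scaled0 (z : R) : arch w 0 * z ^+ 0 = 0. Proof. by rewrite mul0r. Qed.

Let arch_scaled_ge0 (z : R) n : 0 < z -> 0 <= arch w n * z ^+ n.
Proof. by move=> z0; rewrite mulr_ge0 ?(arch_ge0 hw hw0) // exprn_ge0 // ltW. Qed.

Let Egf_value (z u : R) : 0 < u -> u <= tau -> 0 < z -> z * P w u = 1 -> z * P0ge w u < 1 ->
  Egf w z = (1 - z * P0ge w u)^-1.
Proof.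
move=> u0 ut z0 zP zP0; rewrite EgfE; apply/cvg_lim => //.
by apply: (renewal_series (arch_scaled0 z) (fun n => arch_scaled_ge0 n z0)
  (arch_series hw htau u0 ut z0 zP) zP0); exact: exc_scaled.
Qed.

Let mea_diff n : mea w n - mea w n.+1 = q * exc w n.
Proof. by rewrite !(meaE hw) seriesSr /q; ring. Qed.

Section Recurrent.
Hypothesis tau1 : 1 <= tau.

(** As [P 1 = 1] and [1 <= tau], the small root at [z = 1] is [u = 1]. *)
Lemma Egf1 : Egf w 1 = q^-1.
Proof.
by rewrite (@Egf_value 1 1) ?ltr01 ?mul1r // P1.
Qed.

Lemma mea_cvg0 : mea w @ \oo --> (0:R).
Proof.
have -> : mea w = fun n => 1 - q * series (fun n => exc w n * 1 ^+ n) n.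
  apply/funext => n; rewrite (meaE hw); congr (1 - _ * series _ _).
  by apply/funext => k; rewrite expr1n mulr1.
have -> : 0 = 1 - q * q^-1 by rewrite divff ?subrr // gt_eqF.
apply: cvgB; first exact: cvg_cst.
apply: cvgMl_tmp.
have P11 : 1 * P w 1 = 1 by rewrite mul1r P1.
have Pq : 1 * P0ge w 1 < 1 by rewrite mul1r.
have := renewal_series (arch_scaled0 1) (fun n => arch_scaled_ge0 n ltr01)
  (arch_series hw htau ltr01 tau1 ltr01 P11) Pq (exc_scaled 1).
by rewrite mul1r.
Qed.

End Recurrent.

Let rho0 : 0 < rho w tau. Proof. by rewrite invr_gt0. Qed.
Let rhoP : rho w tau * P w tau = 1. Proof. by rewrite mulVf // gt_eqF. Qed.

Let rho_gt1 : drift w < 0 -> 1 < rho w tau.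
Proof.
move=> /(drift_lt0 hw htau) t1; rewrite invf_gt1 // -(P1 hw).
by apply: (P_decr hw htau).
Qed.

(** Nonnegativity of the meanders bounds the partial sums of [e], so the limit exists. An equivalent
    also needs a nonzero limit: the walk can jump from 0 to some [i > 0], and with [tau < 1] it may
    never return. *)
Lemma meanders_transient : 0 < drift w -> leaves_zero w ->
  meanders w ~_\oo (fun _ : nat => 1 - (1 - P0ge w 1) * Egf w 1).
Proof.
move=> dr lz; have t1 := drift_gt0 hw htau dr; rewrite meanders_mea.
have eE : (fun n => exc w n * 1 ^+ n) = exc w by apply/funext => n; rewrite expr1n mulr1.
have ce : cvgn (series (exc w)).
  apply: nondecreasing_is_cvgn; first by apply: series_homo => k; exact: exc_ge0.
  exists q^-1 => _ [n _ <-]; have := mea_ge0 hw hw0 n.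
  by rewrite (meaE hw) subr_ge0 -ler_pdivlMl // mulr1.
have mc : mea w @ \oo --> 1 - q * Egf w 1.
  rewrite EgfE eE (_ : mea w = fun n => 1 - q * series (exc w) n); last by apply/funext => n; exact: meaE.
  by apply: cvgB; [exact: cvg_cst | apply: cvgMl_tmp].
(* [1 - tau ^ k] bounds from below the probability never to go down from [k] to [0]. *)
have low n k : 1 - tau ^+ k <= evol w (fun=> 1) n k.
  elim: n k => [|n IH] k; first by rewrite /= gerBl exprn_ge0 // ltW.
  case: k => [|k]; first by rewrite expr0 subrr evol_ge0.
  apply: (@le_trans _ _ (\sum_(j < (deg w).+2) wt w (j%:Z - 1) * (1 - tau ^+ (k + j)))); last first.
    by apply: ler_sum => j _; rewrite ler_wpM2l ?(phi_ge0 hw).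
  under eq_bigr do rewrite mulrBr mulr1 exprD mulrCA.
  rewrite sumrB (sum_phi hw) -mulr_sumr -P_sum ?gt_eqF // lerD2l lerN2.
  rewrite mulrA -exprSr ler_piMr ?exprn_ge0 ?(ltW tau0) // -(P1 hw).
  exact: (P_tau_le hw htau).
have [i i0 wi] := lz; have [w0 wout _] := hw0.
have id : (i < (deg0 w).+1)%N.
  rewrite ltnS leqNgt; apply/negP => H; move: wi; rewrite wout ?eqxx //.
  by apply/negP => /andP[_]; lia.
pose c := wt0 w i%:Z * (1 - tau ^+ i).
have c0 : 0 < c.
  apply: mulr_gt0; first by rewrite lt_def wi w0.
  by rewrite subr_gt0 exprn_ilt1 // ?ltW // -lt0n.
have mlow n : c <= mea w n.+1.
  rewrite /mea /= (bigD1 (Ordinal id)) //= ler_wpDr ?ler_wpM2l //.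
  by apply: sumr_ge0 => j _; rewrite mulr_ge0 // evol_ge0.
have lim0 : 0 < 1 - q * Egf w 1.
  apply: lt_le_trans c0 _; rewrite -(cvg_lim _ mc) //; apply: limr_ge; first exact: cvgP mc.
  by near=> n; rewrite -(@prednK n) ?mlow //; near: n; exists 1%N.
have := @equiv_of_ratio R (mea w) (fun=> 1) (1 - q * Egf w 1) (lt0r_neq0 lim0).
rewrite mulr1; apply; first by near=> n; exact: oner_neq0.
by under eq_fun do rewrite divr1.
Unshelve. all: by end_near. Qed.

Lemma meanders_supercritical : drift w < 0 -> P w tau < P0ge w tau ->
  forall rho1 : R, is_rho1 w (rho w tau) u1 rho1 ->
  meanders w ~_\oo (fun n : nat =>
    rho1 * gamma w u1 rho1 / (Egf w 1 * (rho1 - 1)) * rho1 ^- n).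
Proof.
move=> dr sup z [zr /eqP]; rewrite subr_eq0 eq_sym => /eqP zP0.
have /andP[z0 zrho] := zr; have t1 := drift_lt0 hw htau dr.
have /andP[u0 ut] := small_branch_range hw htau hu1 zr.
have zP := small_branch_eq hu1 zr.
(* At [rho] the branch equals [tau], where [P0ge] exceeds [P], so the defining equation of [rho1]
   fails there. *)
have zlt : z < rho w tau.
  rewrite lt_neqAle zrho andbT; apply/eqP => E.
  move: zP0; rewrite E (small_branch_rho hw htau hu1) /rho => /(canRL (mulVKf (lt0r_neq0 Pt0))).
  by rewrite mulr1 => h; rewrite h ltxx in sup.
have ser := arch_series hw htau u0 ut z0 zP; rewrite zP0 in ser.
(* For [z <= 1] the total weight 1 of the arches at [z] would be at most their weight [P0ge 1 < 1]
   at 1. *)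
have z1 : 1 < z.
  rewrite ltNge; apply/negP => z1.
  have P11 : 1 * P w 1 = 1 by rewrite mul1r P1.
  have ser1 := arch_series hw htau ltr01 (ltW t1) ltr01 P11.
  have : 1 <= 1 * P0ge w 1; last by rewrite mul1r leNgt habs.
  rewrite -[X in X <= _](cvg_lim (@Rhausdorff R) ser) -(cvg_lim (@Rhausdorff R) ser1).
  apply: ler_lim; [exact: cvgP ser | exact: cvgP ser1 |]; near=> N.
  apply: ler_sum => n _; rewrite ler_wpM2l ?(arch_ge0 hw hw0) //.
  by rewrite expr1n exprn_ile1 // ltW.
have ren := exc_scaled z.
have b0 n := arch_scaled_ge0 n z0.
have [g0 ez] : 0 < gamma w u1 z /\ exc w n * z ^+ n @[n --> \oo] --> gamma w u1 z.
  (* Without jumps from 0 to a positive altitude, [kappa = 0] and the arch asymptotics give no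
     positivity. But then the only arches have length 1, [alpha = 0], and the scaled excursions are
     constantly 1. *)
  have [lz|nlz] := pselect (leaves_zero w).
    have mean := arch_mean hw hw0 htau hu1 (introT andP (conj z0 zlt)) zP0.
    have kap0 := kappa_gt0 hw hw0 htau lz.
    have [K HK] : exists K, forall k, (K <= k)%N -> 0 < arch w k * z ^+ k.
      have A := arch_asymptotics hw haper htau.
      have l0 : 0 < kappa w tau / (2 * Num.sqrt pi) by rewrite divr_gt0 // mulr_gt0 // sqrtr_gt0 pi_gt0.
      have /cvgrPdist_lt/(_ _ l0) [K _ HK] := A.
      exists K.+1 => k Kk; have := HK k (ltnW Kk).
      rewrite /= ltr_norml => /andP[_]; rewrite ltrBlDr ltrDl => h.
      have k0 : 0 < k%:R * rt k by rewrite mulr_gt0 ?sqrtr_gt0 ?ltr0n //; exact: leq_trans Kk.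
      by move: h; rewrite pmulr_rgt0 // pmulr_lgt0 ?exprn_gt0 // => h; rewrite mulr_gt0 // exprn_gt0.
    have tail := tail_series_mean b0 ser mean.
    split; last exact: renewal_cvg (arch_scaled0 z) b0 ser HK ren _ tail.
    rewrite /gamma invr_gt0; apply: lt_le_trans (_ : 1 <= _) => //.
    rewrite -(cvg_lim (@Rhausdorff R) tail); apply: limr_ge; first exact: cvgP tail.
    near=> N; have N0 : (0 < N)%N by near: N; exists 1%N.
    rewrite /series/= big_ltn // /series/= big_nat1 mul0r subr0 lerDl.
    by apply: sumr_ge0 => n _; rewrite subr_ge0; exact: series_le_lim ser _.
  have [_ wout _] := hw0.
  have wz i : (0 < i)%N -> wt0 w i%:Z = 0.
    by move=> i0; apply: contrapT => /eqP wi; apply: nlz; exists i.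
  have P0c u : P0ge w u = wt0 w 0.
    rewrite /P0ge big_ord_recl expr0 mulr1 big1 ?addr0 // => i _.
    by rewrite wz ?mul0r.
  have al0 : alpha w u1 z = 0.
    rewrite /alpha (_ : (fun z => _) = cst (wt0 w 0)) ?derive1_cst //.
    by apply/funext => x; rewrite P0c.
  rewrite /gamma al0 mul0r add0r invr1; split => //.
  have archE n : arch w n = (n == 1%N)%:R * wt0 w 0.
    case: n => [|n] /=; first by rewrite mul0r.
    rewrite big_ord_recl big1 ?addr0 => [|i _]; last by rewrite wz ?mul0r.
    by rewrite hit0 mulrC.
  have e1 n : exc w n * z ^+ n = 1.
    elim: n => [|n IH]; first by rewrite mulr1 /exc /=.
    rewrite ren /delta add0r conv_recl arch_scaled0 mul0r add0r /conv big_ord_recl.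
    rewrite big1 ?addr0 => [|i _]; last by rewrite archE !mul0r.
    by rewrite subn0 IH mulr1 archE mul1r expr1 mulrC -(P0c (u1 z)).
  by under eq_fun do rewrite e1; exact: cvg_cst.
rewrite meanders_mea (Egf1 (ltW t1)).
have := @geometric_tail R (mea w) (fun=> 1) z (q * gamma w u1 z) 1 z1 (mea_cvg0 (ltW t1)).
have -> : (fun n => (mea w n - mea w n.+1) * z ^+ n * 1) = (fun n => q * (exc w n * z ^+ n)).
  by apply/funext => n; rewrite mea_diff mulr1 mulrA.
have -> : (fun n => mea w n / (z ^- n / 1)) = (fun n => mea w n / z ^- n).
  by apply/funext => n; rewrite divr1.
move=> H; have {}H : mea w n / z ^- n @[n --> \oo] --> q * gamma w u1 z * z / (z - 1).
  apply: H.
  - exact: cvgMl_tmp.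
  - by near=> n; exact: ltr01.
  - by under eq_fun do rewrite divr1; exact: cvg_cst.
  - by rewrite -[X in _ --> X]invr1; exact: cvg_cst.
have -> : z * gamma w u1 z / (q^-1 * (z - 1)) = q * gamma w u1 z * z / (z - 1).
  by field; rewrite subr_eq0 !gt_eqF.
apply: equiv_of_ratio H.
- by rewrite gt_eqF // divr_gt0 ?subr_gt0 // !mulr_gt0.
- by near=> n; rewrite invr_neq0 // expf_neq0 // gt_eqF.
Unshelve. all: by end_near. Qed.

Let asym := arch_asymptotics hw haper htau.
Let kap := kappa w tau / (2 * Num.sqrt pi).
Let serrho := arch_series hw htau tau0 (lexx _) rho0 rhoP.
Let brho n := arch_scaled_ge0 n rho0.
Let spi0 : 0 < Num.sqrt pi :> R. Proof. by rewrite sqrtr_gt0 pi_gt0. Qed.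

Lemma meanders_critical : drift w < 0 -> P w tau = P0ge w tau -> leaves_zero w ->
  meanders w ~_\oo (fun n : nat =>
    rho w tau / (Egf w 1 * kappa w tau * (rho w tau - 1))
    * (rho w tau ^- n / Num.sqrt (pi * n%:R))).
Proof.
move=> dr crit lz; have t1 := drift_lt0 hw htau dr; have r1 := rho_gt1 dr.
have k0 := kappa_gt0 hw hw0 htau lz.
have kap0 : 0 < kap by rewrite divr_gt0 // mulr_gt0.
have b1 : series (fun n => arch w n * rho w tau ^+ n) @ \oo --> (1:R).
  by have := serrho; rewrite -crit rhoP.
have g0 : 0 < (Num.sqrt pi)^-1 :> R by rewrite invr_gt0.
have C := critical_renewal (arch_scaled0 _) brho b1 (exc_scaled _) kap0 g0 asym (@invsqrt_coef_cvg R).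
rewrite meanders_mea (Egf1 (ltW t1)).
have H := @geometric_tail R (mea w) rt (rho w tau) (q * ((Num.sqrt pi)^-1 ^+ 2 / (2 * kap))) 0 r1
  (mea_cvg0 (ltW t1)).
have {}H : mea w n / (rho w tau ^- n / rt n) @[n --> \oo] -->
    q * ((Num.sqrt pi)^-1 ^+ 2 / (2 * kap)) * rho w tau / (rho w tau - 1).
  apply: H.
  - have -> : (fun n => (mea w n - mea w n.+1) * rho w tau ^+ n * rt n) =
      (fun n => q * (rt n * (exc w n * rho w tau ^+ n))).
      by apply/funext => n; rewrite mea_diff; ring.
    exact: cvgMl_tmp.
  - by near=> n; rewrite sqrtr_gt0 ltr0n; near: n; exists 1%N.
  - exact: cvg_sqrt_ratio.
  - exact: cvg_sqrtV.
have -> : (fun n => rho w tau / (q^-1 * kappa w tau * (rho w tau - 1)) *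
    (rho w tau ^- n / Num.sqrt (pi * n%:R))) =
  (fun n => q * ((Num.sqrt pi)^-1 ^+ 2 / (2 * kap)) * rho w tau / (rho w tau - 1) * (rho w tau ^- n / rt n)).
  apply/funext => n; rewrite sqrtrM ?pi_ge0 // (invfM (Num.sqrt pi)) -/(rt n) /kap.
  move: (rho w tau ^- n) (rt n)^-1 => A B; move: spi0 q0 k0 r1.
  move: (Num.sqrt pi) q (kappa w tau) (rho w tau) => p s k r p0 s0 kp r1.
  by field; rewrite subr_eq0 !gt_eqF // (lt_trans ltr01).
apply: equiv_of_ratio H.
- by rewrite gt_eqF // divr_gt0 ?subr_gt0 // mulr_gt0 // mulr_gt0 // divr_gt0 ?exprn_gt0 // mulr_gt0.
- near=> n; have n0 : (0 < n)%N by near: n; exists 1%N.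
  by rewrite gt_eqF // divr_gt0 ?invr_gt0 ?exprn_gt0 // sqrtr_gt0 ltr0n.
Unshelve. all: by end_near. Qed.

Section Subcritical.
Hypothesis sub : P0ge w tau < P w tau.

Let rP1 : rho w tau * P0ge w tau < 1.
Proof. by rewrite -rhoP ltr_pM2l. Qed.

Lemma exc_subcritical : n%:R * rt n * (exc w n * rho w tau ^+ n) @[n --> \oo]
  --> kap * Egf w (rho w tau) ^+ 2.
Proof.
rewrite (Egf_value tau0 (lexx _) rho0 rhoP rP1).
exact: subcritical_renewal (arch_scaled0 _) brho serrho rP1 (exc_scaled _) asym.
Qed.

Lemma Egf_rho_gt0 : 0 < Egf w (rho w tau).
Proof. by rewrite (Egf_value tau0 (lexx _) rho0 rhoP rP1) invr_gt0 subr_gt0. Qed.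

Let cvg_w : (n%:R * rt n) / (n.+1%:R * rt n.+1) @[n --> \oo] --> (1:R).
Proof.
rewrite -[X in _ --> X]invr1.
have -> : (fun n => (n%:R * rt n) / (n.+1%:R * rt n.+1)) =
   (fun n => ((n.+1%:R * rt n.+1) / (n%:R * rt n))^-1).
  by apply/funext => n; rewrite invf_div.
by apply: cvgV; [exact: oner_neq0 | exact: cvg_sqrt_pow3_ratio].
Qed.

Let cvg_wV : (n%:R * rt n)^-1 @[n --> \oo] --> (0:R).
Proof.
rewrite -(mulr0 (0:R)); under eq_fun do rewrite invfM.
apply: cvgM; last exact: cvg_sqrtV.
by rewrite -(cvg_shiftS (fun n => n%:R^-1 : R)); exact: cvg_harmonic.
Qed.

Lemma meanders_subcritical : drift w < 0 -> leaves_zero w ->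
  meanders w ~_\oo (fun n : nat =>
    Egf w (rho w tau) ^+ 2 / Egf w 1
    * (kappa w tau * rho w tau / (2 * (rho w tau - 1)))
    * (rho w tau ^- n / Num.sqrt (pi * n%:R ^+ 3))).
Proof.
move=> dr lz; have t1 := drift_lt0 hw htau dr; have r1 := rho_gt1 dr.
have k0 := kappa_gt0 hw hw0 htau lz; have E0 := Egf_rho_gt0.
rewrite meanders_mea (Egf1 (ltW t1)).
have H := @geometric_tail R (mea w) (fun n => n%:R * rt n) (rho w tau)
  (q * (kap * Egf w (rho w tau) ^+ 2)) 0 r1 (mea_cvg0 (ltW t1)).
have {}H : mea w n / (rho w tau ^- n / (n%:R * rt n)) @[n --> \oo] -->
    q * (kap * Egf w (rho w tau) ^+ 2) * rho w tau / (rho w tau - 1).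
  apply: H => //.
  - have -> : (fun n => (mea w n - mea w n.+1) * rho w tau ^+ n * (n%:R * rt n)) =
      (fun n => q * (n%:R * rt n * (exc w n * rho w tau ^+ n))).
      by apply/funext => n; rewrite mea_diff; ring.
    by apply: cvgMl_tmp; exact: exc_subcritical.
  - near=> n; have n0 : (0 < n)%N by near: n; exists 1%N.
    by rewrite mulr_gt0 ?sqrtr_gt0 ?ltr0n.
have -> : (fun n => Egf w (rho w tau) ^+ 2 / q^-1 * (kappa w tau * rho w tau / (2 * (rho w tau - 1)))
    * (rho w tau ^- n / Num.sqrt (pi * n%:R ^+ 3))) =
  (fun n => q * (kap * Egf w (rho w tau) ^+ 2) * rho w tau / (rho w tau - 1) *
     (rho w tau ^- n / (n%:R * rt n))).
  apply/funext => n.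
  have -> : Num.sqrt (pi * n%:R ^+ 3) = Num.sqrt pi * (n%:R * rt n) :> R.
    by rewrite sqrtrM ?pi_ge0 // exprSr sqrtrM ?sqr_ge0 // sqrtr_sqr ger0_norm.
  rewrite (invfM (Num.sqrt pi)) /kap.
  move: (rho w tau ^- n) (n%:R * rt n)^-1 => A B; move: spi0 q0 k0 r1.
  move: (Num.sqrt pi) q (kappa w tau) (rho w tau) (Egf w (rho w tau)) => p s k r E p0 s0 kp r1'.
  by field; rewrite subr_eq0 !gt_eqF.
apply: equiv_of_ratio H.
- by rewrite gt_eqF // divr_gt0 ?subr_gt0 // mulr_gt0 // mulr_gt0 // mulr_gt0 ?exprn_gt0 // divr_gt0 // mulr_gt0.
- near=> n; have n0 : (0 < n)%N by near: n; exists 1%N.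
  by rewrite gt_eqF // divr_gt0 ?invr_gt0 ?exprn_gt0 // mulr_gt0 ?sqrtr_gt0 ?ltr0n.
Unshelve. all: by end_near. Qed.

(** Here [tau = rho = 1]: with no geometric factor, the tail sums of terms of order [n^(-3/2)] are
    of order [n^(-1/2)]. *)
Lemma meanders_zero_drift : drift w = 0 -> leaves_zero w ->
  meanders w ~_\oo (fun n : nat => Egf w 1 * kappa w tau / Num.sqrt (pi * n%:R)).
Proof.
move=> dr lz; have t1 := drift_eq0 hw htau dr.
have r1 : rho w tau = 1 by rewrite /rho t1 (P1 hw) invr1.
have k0 := kappa_gt0 hw hw0 htau lz.
have t1' : 1 <= tau by rewrite t1.
have C := exc_subcritical; rewrite r1 (Egf1 t1') in C.
rewrite meanders_mea (Egf1 t1').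
have H : rt n * mea w n @[n --> \oo] --> 2 * (q * (kap * q^-1 ^+ 2)).
  apply: cvg_sqrt_tail; first exact: mea_cvg0.
  have H : (n.+1%:R * rt n.+1) / (n%:R * rt n) * (q * (n%:R * rt n * (exc w n * 1 ^+ n)))
      @[n --> \oo] --> 1 * (q * (kap * q^-1 ^+ 2)).
    by apply: cvgM; [exact: cvg_sqrt_pow3_ratio | exact: cvgMl_tmp].
  rewrite mul1r in H; apply: cvg_trans H; apply: near_eq_cvg; near=> n.
  have n0 : (0 < n)%N by near: n; exists 1%N.
  have w0 : 0 < n%:R * rt n by rewrite mulr_gt0 ?sqrtr_gt0 ?ltr0n.
  rewrite mea_diff expr1n mulr1 -/(rt n.+1); move: w0; move: (n%:R * rt n) => W w0.
  by field; rewrite gt_eqF.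
have {}H : mea w n / (rt n)^-1 @[n --> \oo] --> 2 * (q * (kap * q^-1 ^+ 2)).
  by under eq_fun do rewrite invrK mulrC.
have -> : (fun n => q^-1 * kappa w tau / Num.sqrt (pi * n%:R)) =
  (fun n => 2 * (q * (kap * q^-1 ^+ 2)) * (rt n)^-1).
  apply/funext => n; rewrite sqrtrM ?pi_ge0 // (invfM (Num.sqrt pi)) -/(rt n) /kap.
  move: (rt n)^-1 => B; move: spi0 q0; move: (Num.sqrt pi) q (kappa w tau) => p s k p0 s0.
  by field; rewrite !gt_eqF.
apply: equiv_of_ratio H.
- by rewrite gt_eqF // mulr_gt0 // mulr_gt0 // mulr_gt0 ?exprn_gt0 ?invr_gt0 // mulr_gt0 // invr_gt0 mulr_gt0.
- near=> n; have n0 : (0 < n)%N by near: n; exists 1%N.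
  by rewrite gt_eqF // invr_gt0 sqrtr_gt0 ltr0n.
Unshelve. all: by end_near. Qed.

End Subcritical.

Lemma zero_drift_subcritical : drift w = 0 -> P0ge w tau < P w tau.
Proof. by move=> /(drift_eq0 hw htau) ->; rewrite (P1 hw). Qed.

End Meanders.

Theorem theorem5p1 (R : realType) (w : walk R) (tau : R) (u1 : R -> R)
    (hw : lukasiewicz w) (hw0 : boundary_weights w) (haper : aperiodic w)
    (habs : absorption w) (htau : is_tau w tau)
    (hu1 : is_small_branch w (rho w tau) u1) :
  (* (a) *)
  (0 < drift w -> leaves_zero w ->
     meanders w ~_\oo (fun _ : nat => 1 - (1 - P0ge w 1) * Egf w 1)) /\
  (* (b) *)
  (drift w < 0 -> P w tau < P0ge w tau ->
     forall rho1 : R, is_rho1 w (rho w tau) u1 rho1 ->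
     meanders w ~_\oo (fun n : nat =>
       rho1 * gamma w u1 rho1 / (Egf w 1 * (rho1 - 1)) * rho1 ^- n)) /\
  (* (c) *)
  (drift w < 0 -> P w tau = P0ge w tau -> leaves_zero w ->
     meanders w ~_\oo (fun n : nat =>
       rho w tau / (Egf w 1 * kappa w tau * (rho w tau - 1))
       * (rho w tau ^- n / Num.sqrt (pi * n%:R)))) /\
  (* (d) *)
  (drift w < 0 -> P0ge w tau < P w tau -> leaves_zero w ->
     meanders w ~_\oo (fun n : nat =>
       Egf w (rho w tau) ^+ 2 / Egf w 1
       * (kappa w tau * rho w tau / (2 * (rho w tau - 1)))
       * (rho w tau ^- n / Num.sqrt (pi * n%:R ^+ 3)))) /\
  (* (e) *)
  (drift w = 0 -> P0ge w tau < P w tau -> leaves_zero w ->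
     meanders w ~_\oo (fun n : nat =>
       Egf w 1 * kappa w tau / Num.sqrt (pi * n%:R))) /\
  (drift w = 0 -> ~ (P w tau <= P0ge w tau)).
Proof.
split; first exact: (meanders_transient hw hw0 habs htau).
split; first exact: (meanders_supercritical hw hw0 haper habs htau hu1).
split; first exact: (meanders_critical hw hw0 haper habs htau).
split; first by move=> dr sub; exact: (meanders_subcritical hw hw0 haper habs htau sub dr).
split; first by move=> dr sub; exact: (meanders_zero_drift hw hw0 haper habs htau sub dr).
move=> dr; apply/negP; rewrite -ltNge; exact: (zero_drift_subcritical hw habs htau).
Qed.
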